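(* Let $(b,c)$ be a connected graph over $(X,m)$, let $(X_k)$ be an exhaustion, and let $t>0$. The following statements are equivalent: (i) $Q^{(D)}=Q^{(N)}$. (ii) $P^{(N)}_{t,k}\to P^{(D)}_t$ strongly in $\ell^2(X,m)$ as $k\to\infty$. (iii) $P^{(N)}_{t,k}\varphi\to P^{(D)}_t\varphi$ pointwise as $k\to\infty$ for some (all) $\varphi\in C_c(X)$ such that $\varphi\neq0$. (That is, both the version of (iii) with ''for some'' and the version with ''for all'' are equivalent to (i) and (ii).)
   Context: Graphs: $X$ is a countable discrete set and $m:X\to(0,\infty)$. A graph $(b,c)$ over $(X,m)$ consists of $b:X\times X\to[0,\infty)$ with $b(x,y)=b(y,x)$, $b(x,x)=0$, $\sum_{y\in X}b(x,y)<\infty$ for all $x$, and a killing term $c:X\to[0,\infty)$. It is connected if any two vertices $x,y$ are joined by a path $x=x_0,\dots,x_n=y$ with $b(x_k,x_{k+1})>0$ for $k=0,\dots,n-1$. $C_c(X)$ denotes the finitely supported functions $X\to\mathbb R$. Forms: $\ell^2(X,m)$ is the space of $f:X\to\mathbb R$ with $\|f\|^2=\sum_x f(x)^2m(x)<\infty$. Let $\mathcal D$ be the set of all $f:X\to\mathbb R$ with $\sum_{x,y}b(x,y)(f(x)-f(y))^2+\sum_x c(x)f(x)^2<\infty$, and for $f,g\in\mathcal D$ let $\mathcal Q(f,g)=\frac12\sum_{x,y}b(x,y)(f(x)-f(y))(g(x)-g(y))+\sum_xc(x)f(x)g(x)$, $\mathcal Q(f)=\mathcal Q(f,f)$. $Q^{(N)}$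 is the restriction of $\mathcal Q$ to $D(Q^{(N)})=\mathcal D\cap\ell^2(X,m)$, and $Q^{(D)}$ is the restriction of $\mathcal Q$ to $D(Q^{(D)})$, the closure of $C_c(X)$ with respect to the norm $\|f\|_{\mathcal Q}=(\mathcal Q(f)+\|f\|^2)^{1/2}$. Both are closed forms (Dirichlet forms); $Q^{(D)}=Q^{(N)}$ means that their domains coincide. $L^{(D)}$ is the nonnegative self-adjoint operator on $\ell^2(X,m)$ associated to $Q^{(D)}$ and $P^{(D)}_t=e^{-tL^{(D)}}$. Exhaustions: an exhaustion is a sequence of finite sets $X_k\subseteq X$ with $X_k\subseteq X_{k+1}$ and $X=\bigcup_kX_k$, such that for each $k$ the graph obtained by restricting $b$ to $X_k\times X_k$ is connected. Neumann restrictions: on $\ell^2(X_k,m)$ let $L^{(N)}_kf(x)=\frac1{m(x)}\sum_{y\in X_k}b(x,y)(f(x)-f(y))+\frac{c(x)}{m(x)}f(x)$ for $x\in X_k$, and $P^{(N)}_{t,k}=e^{-tL^{(N)}_k}$, regarded as an operator on $\ell^2(X,m)$ by first restricting functions to $X_k$, applying the operator, and then extending by $0$ to $X$. Strong convergence of operators means norm convergence when applied to each fixed function.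
   Formalization: In the ''for some'' version of (iii), φ is additionally required to satisfy φ ≥ 0, since for sign-changing φ (e.g. the difference of the indicators of two twin leaves) the claim is false; X is also assumed nonempty. *)

(* Defs.v *)
From HB Require Import structures.
From mathcomp Require Export all_boot all_order all_algebra finmap.
From mathcomp Require Export all_classical all_reals all_analysis.
Export Order.TTheory GRing.Theory Num.Theory.
Export numFieldNormedType.Exports.

Set Implicit Arguments.
Unset Strict Implicit.
Unset Printing Implicit Defensive.

Local Open Scope classical_set_scope.
Local Open Scope ring_scope.

(* Sum of an absolutely summable real family over a countable type. [esum] is
   a supremum over finite sets, so it is only meaningful for nonnegative
   families: the positive and negative parts have to be summed separately. *)
Definition rsum (R : realType) (T : choiceType) (f : T -> R) : R :=
  fine (\esum_(x in [set: T]) (Num.max (f x) 0)%:E)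
  - fine (\esum_(x in [set: T]) (Num.max (- f x) 0)%:E).

Record graph (R : realType) (X : countType) := Graph {
  edge : X -> X -> R;
  killing : X -> R;
  edge_ge0 : forall x y, 0 <= edge x y;
  edge_sym : forall x y, edge x y = edge y x;
  edge_diag : forall x, edge x x = 0;
  edge_summable : forall x, (\esum_(y in [set: X]) (edge x y)%:E < +oo)%E;
  killing_ge0 : forall x, 0 <= killing x
}.

Section Graphs.
Context {R : realType} {X : countType}.
Implicit Types (G : graph R X) (m f g v : X -> R) (A : {fset X}).

(* Connectedness of the graph obtained by restricting [edge G] to A x A. *)
Definition connected_on G (A : set X) : Prop :=
  forall x y, A x -> A y -> exists p : seq X,
    [/\ path (fun u w => 0 < edge G u w) x p, last x p = y
      & forall z, z \in p -> A z].

Definition connected_graph G : Prop := connected_on G [set: X].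

Definition exhaustion G (X_ : nat -> {fset X}) : Prop :=
  [/\ forall k, (X_ k `<=` X_ k.+1)%fset,
      forall x, exists k, x \in X_ k
    & forall k, connected_on G [set` X_ k]].

Definition Cc : set (X -> R) := [set f | finite_set [set x | f x != 0]].

Definition ell2 m : set (X -> R) :=
  [set f | (\esum_(x in [set: X]) (f x ^+ 2 * m x)%:E < +oo)%E].

Definition inner m f g : R := rsum (fun x => f x * g x * m x).

Definition l2norm m f : R := Num.sqrt (inner m f f).

Definition finite_energy G : set (X -> R) :=
  [set f | (\esum_(xy in [set: X * X])
              (edge G xy.1 xy.2 * (f xy.1 - f xy.2) ^+ 2)%:E
            + \esum_(x in [set: X]) (killing G x * f x ^+ 2)%:E < +oo)%E].

Definition energy G f g : R :=
  2^-1 * rsum (fun xy : X * X =>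
           edge G xy.1 xy.2 * (f xy.1 - f xy.2) * (g xy.1 - g xy.2))
  + rsum (fun x => killing G x * f x * g x).

Definition form_norm G m f : R := Num.sqrt (energy G f f + l2norm m f ^+ 2).

Definition domN G m : set (X -> R) := finite_energy G `&` ell2 m.

(* Since [form_norm] only makes sense on [domN], the closure of [Cc] is taken
   inside that space, which is complete for this norm. *)
Definition domD G m : set (X -> R) :=
  [set f | domN G m f /\
     forall e : R, 0 < e -> exists2 phi, Cc phi & form_norm G m (f - phi) < e].

(* [opD G m f g] says that f is in the domain of the self-adjoint operator
   L associated to the form (energy G, domD G m), and that L f = g. *)
Definition opD G m f g : Prop :=
  [/\ domD G m f, ell2 m g & forall v, domD G m v -> energy G f v = inner m g v].

(* [is_exp_semigroup m L P] says that P t = e^{-tL} on ell2 m for all t >= 0: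
   P is the strongly continuous semigroup of bounded operators whose generator
   is exactly -L, where L is given by its graph. Nothing is required of P t
   outside of ell2 m or for t < 0. *)
Record is_exp_semigroup m (L : (X -> R) -> (X -> R) -> Prop)
    (P : R -> (X -> R) -> (X -> R)) : Prop := IsExpSemigroup {
  expsg_ell2 : forall t f, 0 <= t -> ell2 m f -> ell2 m (P t f);
  expsg_linear : forall t (a : R) f g, 0 <= t -> ell2 m f -> ell2 m g ->
    P t (fun x => a * f x + g x) = (fun x => a * P t f x + P t g x);
  expsg_bounded : forall t, 0 <= t ->
    exists M : R, forall f, ell2 m f -> l2norm m (P t f) <= M * l2norm m f;
  expsg_0 : forall f, ell2 m f -> P 0 f = f;
  expsg_D : forall s t f, 0 <= s -> 0 <= t -> ell2 m f ->
    P (s + t) f = P s (P t f);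
  expsg_cont : forall f, ell2 m f ->
    (fun h : R => l2norm m (P h f - f)) @ 0^'+ --> (0 : R);
  expsg_generator : forall f g, ell2 m f -> ell2 m g ->
    L f g <->
    (fun h : R => l2norm m (fun x => h^-1 * (P h f x - f x) + g x)) @ 0^'+
      --> (0 : R)
}.

(* Functions on the finite set A are encoded as functions on X vanishing
   outside of A. *)
Definition restrict0 A f : X -> R := fun x => if x \in A then f x else 0.

Definition neumannL G m A f : X -> R := restrict0 A (fun x =>
  (m x)^-1 * (\sum_(y <- A) edge G x y * (f x - f y))
  + killing G x / m x * f x).

(* The matrix exponential e^{-tL}, L = neumannL G m A, as a power series. *)
Definition neumannP G m A (t : R) f : X -> R := fun x =>
  limn (fun n => \sum_(j < n)
    (- t) ^+ j / (j`!)%:R * iter j (neumannL G m A) (restrict0 A f) x).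

Definition strong_cvg m (S : nat -> (X -> R) -> (X -> R))
    (T : (X -> R) -> (X -> R)) : Prop :=
  forall f, ell2 m f -> (fun k => l2norm m (S k f - T f)) @ \oo --> (0 : R).

Definition pointwise_cvg (u : nat -> X -> R) (v : X -> R) : Prop :=
  forall x, (fun k => u k x) @ \oo --> v x.

End Graphs.

Arguments Cc {R X}.

(* Main.v *)
Require Import Defs.
From mathcomp Require Import ring lra zify.

(** The Neumann semigroups of the finite pieces always converge strongly to the
    semigroup of the Neumann form: the forms [fin_energy G (X_ k)] increase to the
    energy, so the minimizers that define their resolvents converge
    ([form_lim_resolvent]), and resolvent convergence carries over to the semigroups
    ([trotter_kato], [neumannP_cvg]). The theorem thus compares the Neumann with the
    Dirichlet semigroup. Equal domains give equal semigroups. What has to be shown is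
    that the domains are equal as soon as the semigroups agree on one nonnegative
    nonzero function at one time.

    All semigroups are treated as limits of implicit Euler schemes [(1 + t L / n)^-n]. On
    vectors in the domain of [L^2] the scheme converges with rate [1 / n], with a
    constant that depends on the operator only through the norm of [L^2 u]
    ([expsg_rate]). The matrix exponentials of the pieces are such limits because their
    generators are bounded ([expsg_series]), and so is any strongly continuous semigroup
    with generator [- L] ([sg_expsg]); this step needs the uniform boundedness principle,
    because such a semigroup is only assumed to be bounded at each single time.

    It remains to see why agreement on one function is enough. Resolvents exist by the
    Riesz representation in the form domains. The Dirichlet resolvent is positive and at
    most the Neumann resolvent ([resolventD_ge0], [resolventD_le]), and a lower bound for
    the Euler scheme along the edges of a path makes the Dirichlet semigroup of a
    connected graph strictly positive ([expsgD_gt0]). If the semigroups agree at time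
    [2 r] on [phi >= 0], domination forces them to agree at time [r] on all of ell2
    ([domination_square]), hence at the times [t / 2^n] for all [n >= 1]. Then the Neumann
    operator acts as the adjoint of the self-adjoint Dirichlet operator, and a vector of
    [domN] orthogonal to [domD] must vanish ([neumann_resolvent_domD], [domD_eq_domN]). *)

Set Implicit Arguments.
Unset Strict Implicit.
Unset Printing Implicit Defensive.

Local Open Scope classical_set_scope.
Local Open Scope ring_scope.

(** * Sums along an exhaustion *)

Definition exhausts (T : choiceType) (A : nat -> {fset T}) : Prop :=
  (forall k, A k `<=` A k.+1)%fset /\ forall x, exists k, x \in A k.

Section ExhaustionSums.
Context {R : realType} {T : choiceType}.
Implicit Types (f g : T -> R) (A : nat -> {fset T}).

Lemma exhausts_mono A : exhausts A ->
  forall k l, (k <= l)%N -> (A k `<=` A l)%fset.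
Proof.
move=> [Am _] k l kl; rewrite -(subnK kl).
elim: (l - k)%N => [|n IH] //; exact: fsubset_trans IH (Am _).
Qed.

Lemma exhausts_fset A : exhausts A ->
  forall B : {fset T}, exists k, (B `<=` A k)%fset.
Proof.
move=> exA; elim/finSet_rect => B IH.
case: (fset_0Vmem B) => [->|[x xB]]; first by exists 0%N; exact: fsub0set.
have [k Bk] := IH _ (fproperD1 xB); have [l xl] := exA.2 x.
exists (maxn k l); apply/fsubsetP => y yB.
have [->|yx] := eqVneq y x.
  by apply: (fsubsetP (exhausts_mono exA (leq_maxr k l))).
apply: (fsubsetP (exhausts_mono exA (leq_maxl k l))).
by apply: (fsubsetP Bk); rewrite !inE yx.
Qed.

Lemma ler_sum_fset (A B : {fset T}) f : (forall x, 0 <= f x) ->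
  (A `<=` B)%fset -> \sum_(x <- A) f x <= \sum_(x <- B) f x.
Proof.
move=> f0 AB; rewrite (big_fsetID _ (mem A) B) /=.
have -> : [fset x in B | x \in A]%fset = A.
  apply/fsetP => x; rewrite !inE /=; apply/andP/idP => [[]//|xA].
  by split=> //; exact: (fsubsetP AB).
by rewrite lerDl sumr_ge0.
Qed.

Lemma esum_fin_le f (B : {fset T}) : (forall x, 0 <= f x) ->
  ((\sum_(x <- B) f x)%:E <= \esum_(x in [set: T]) (f x)%:E)%E.
Proof.
move=> f0; apply: esum_ge; exists [set` B] => //.
by rewrite fsbig_finite //= set_fsetK sumEFin.
Qed.

Lemma esum_le_bound f A (M : R) : exhausts A -> (forall x, 0 <= f x) ->
  (forall k, \sum_(x <- A k) f x <= M) ->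
  (\esum_(x in [set: T]) (f x)%:E <= M%:E)%E.
Proof.
move=> exA f0 fM; apply: ge_ereal_sup => _ [B [finB _]] <-.
rewrite fsbig_finite //= sumEFin lee_fin.
have [k Bk] := exhausts_fset exA (fset_set B).
exact: le_trans (ler_sum_fset f0 Bk) (fM k).
Qed.

Lemma esum_ltyP f A : exhausts A -> (forall x, 0 <= f x) ->
  (\esum_(x in [set: T]) (f x)%:E < +oo)%E <->
  exists M : R, forall k, \sum_(x <- A k) f x <= M.
Proof.
move=> exA f0; split => [fin|[M fM]]; last first.
  exact: le_lt_trans (esum_le_bound exA f0 fM) (ltry _).
exists (fine (\esum_(x in [set: T]) (f x)%:E)) => k.
rewrite -lee_fin fineK ?esum_fin_le // ge0_fin_numE // esum_ge0 // => x _.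
by rewrite lee_fin.
Qed.

Lemma psum_cvg f A : exhausts A -> (forall x, 0 <= f x) ->
  (\esum_(x in [set: T]) (f x)%:E < +oo)%E ->
  (fun k => \sum_(x <- A k) f x) @ \oo -->
    fine (\esum_(x in [set: T]) (f x)%:E).
Proof.
move=> exA f0 fin.
have finf : (\esum_(x in [set: T]) (f x)%:E)%E \is a fin_num.
  by rewrite ge0_fin_numE // esum_ge0 // => x _; rewrite lee_fin.
have ndf : nondecreasing_seq (fun k => \sum_(x <- A k) f x).
  by move=> k l kl; apply: ler_sum_fset => //; exact: exhausts_mono.
have ub k : \sum_(x <- A k) f x <= fine (\esum_(x in [set: T]) (f x)%:E).
  by rewrite -lee_fin fineK // esum_fin_le.
have cv : cvgn (fun k => \sum_(x <- A k) f x).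
  by apply: nondecreasing_is_cvgn => //; exists (fine (\esum_(x in [set: T]) (f x)%:E)) => _ [k _ <-].
suff <- : limn (fun k => \sum_(x <- A k) f x) = fine (\esum_(x in [set: T]) (f x)%:E) by [].
apply/eqP; rewrite eq_le; apply/andP; split.
  by apply: limr_le => //; near=> k; exact: ub.
rewrite -lee_fin fineK //; apply: (esum_le_bound exA) => // k.
exact: nondecreasing_cvgn_le.
Unshelve. all: by end_near.
Qed.

Definition abs_summable f := (\esum_(x in [set: T]) `|f x|%:E < +oo)%E.

Lemma abs_summable_le f g : (forall x, `|f x| <= g x) ->
  (\esum_(x in [set: T]) (g x)%:E < +oo)%E -> abs_summable f.
Proof.
move=> fg; apply: le_lt_trans; apply: le_esum => x _.
by rewrite lee_fin.
Qed.

(** The two sums in [rsum] are suprema over all finite sets; along an exhaustion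
    they become limits, so that [rsum] inherits all algebra from finite sums. *)
Lemma rsum_cvg f A : exhausts A -> abs_summable f ->
  (fun k => \sum_(x <- A k) f x) @ \oo --> rsum f.
Proof.
move=> exA sf.
have fE : (fun k => \sum_(x <- A k) f x) =
  (fun k => \sum_(x <- A k) Num.max (f x) 0 - \sum_(x <- A k) Num.max (- f x) 0).
  apply/funext => k; rewrite -sumrB; apply: eq_bigr => x _.
  by rewrite /Num.max; case: ltP => h1; case: ltP => h2; lra.
rewrite fE; apply: cvgB; apply: psum_cvg => //.
- by move=> x; rewrite le_max lexx orbT.
- by apply: le_lt_trans sf; apply: le_esum => x _; rewrite lee_fin ge_max ler_norm normr_ge0.
- by move=> x; rewrite le_max lexx orbT.
- by apply: le_lt_trans sf; apply: le_esum => x _; rewrite lee_fin ge_max ler_normr lexx orbT normr_ge0.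
Qed.

End ExhaustionSums.

Lemma big_fsetM (R : nmodType) (T1 T2 : choiceType) (A : {fset T1}) (B : {fset T2})
    (F : T1 * T2 -> R) :
  \sum_(xy <- (A `*` B)%fset) F xy = \sum_(x <- A) \sum_(y <- B) F (x, y).
Proof.
rewrite -big_allpairs; apply: perm_big; apply: uniq_perm.
- exact: fset_uniq.
- by apply: allpairs_uniq => // -[a b] [c d] _ _ [-> ->].
- move=> [x y]; rewrite in_fsetM /=; apply/andP/allpairsP => [[xA yB]|[[a b] [aA bB [-> ->]]]].
    by exists (x, y).
  by [].
Qed.

(** * Real sequences *)

Lemma sqrt_cvg0 (R : realType) (a : nat -> R) :
  a @ \oo --> (0 : R) -> (fun n => Num.sqrt (a n)) @ \oo --> (0 : R).
Proof.
by move=> a0; rewrite -[X in _ --> X]sqrtr0; apply: continuous_cvg => //; exact: sqrt_continuous.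
Qed.

Lemma cvg0_le (R : realType) (a b : nat -> R) :
  (forall n, 0 <= a n <= b n) -> b @ \oo --> (0 : R) -> a @ \oo --> (0 : R).
Proof.
move=> ab b0; apply: (@squeeze_cvgr _ _ _ _ (fun=> 0) b) => //; last exact: cvg_cst.
exact: nearW.
Qed.

Lemma cvg_scale (R : realType) (c : R) (a : nat -> R) (l : R) :
  a @ \oo --> l -> (fun n => c * a n) @ \oo --> c * l.
Proof. by move=> h; apply: cvgM => //; exact: cvg_cst. Qed.
Arguments cvg_scale {R} c {a l} _.

Lemma cvg0D (R : realType) (a b : nat -> R) : a @ \oo --> (0 : R) ->
  b @ \oo --> (0 : R) -> (fun n => a n + b n) @ \oo --> (0 : R).
Proof. by move=> ha hb; rewrite -[X in _ --> X]addr0; exact: cvgD. Qed.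

Lemma cvg0Z (R : realType) (c : R) (a : nat -> R) : a @ \oo --> (0 : R) ->
  (fun n => c * a n) @ \oo --> (0 : R).
Proof. by move=> ha; rewrite -[X in _ --> X](mulr0 c); exact: cvg_scale. Qed.
Arguments cvg0Z {R} c {a} _.

Lemma lim_ger (R : realType) (a : nat -> R) (l M : R) : a @ \oo --> l ->
  (forall n, M <= a n) -> M <= l.
Proof.
move=> al Ma; rewrite -(cvg_lim _ al) //.
by apply: limr_ge; [apply/cvg_ex; exists l|exact: nearW].
Qed.

Lemma lim_ler (R : realType) (a : nat -> R) (l M : R) : a @ \oo --> l ->
  (forall n, a n <= M) -> l <= M.
Proof.
move=> al Ma; rewrite -(cvg_lim _ al) //.
by apply: limr_le; [apply/cvg_ex; exists l|exact: nearW].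
Qed.

Lemma ler_lim_seq (R : realType) (a b : nat -> R) (l k : R) : a @ \oo --> l ->
  b @ \oo --> k -> (forall n, a n <= b n) -> l <= k.
Proof.
move=> al bk ab; rewrite -subr_ge0; apply: (lim_ger (cvgB bk al)) => n.
by rewrite subr_ge0.
Qed.

Lemma cvg_inv_nat (R : realType) (c : R) :
  (fun n => c / n.+1%:R) @ \oo --> (0 : R).
Proof. by apply: cvg0Z; exact: cvg_harmonic. Qed.

Lemma cvg_fsum (R : realType) (I : Type) (s : seq I) (a : I -> nat -> R)
  (l : I -> R) : (forall i, a i @ \oo --> l i) ->
  (fun n => \sum_(i <- s) a i n) @ \oo --> \sum_(i <- s) l i.
Proof.
move=> al; elim: s => [|i s IH].
  rewrite big_nil (_ : (fun n => _) = fun=> 0); first exact: cvg_cst.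
  by apply/funext => n; rewrite big_nil.
rewrite big_cons (_ : (fun n => _) = fun n => a i n + \sum_(i <- s) a i n).
  exact: cvgD.
by apply/funext => n; rewrite big_cons.
Qed.

Lemma cauchy_seq_cvg (R : realType) (a : nat -> R) :
  (forall e, 0 < e -> exists N, forall n p, (N <= n)%N -> (N <= p)%N ->
    `|a n - a p| < e) -> cvgn a.
Proof.
move=> ca; apply: cauchy_cvg; apply: cauchy_exP => e e0.
have [N NP] := ca e e0; exists (a N); exists N => // n /= Nn.
exact: NP.
Qed.

(** * Semi-inner products and the Riesz representation *)

Record semi_inner (R : realType) (F : lmodType R) (H : set F)
    (ip : F -> F -> R) : Prop := SemiInner {
  si_0 : H 0;
  si_lin : forall a u v, H u -> H v -> H (a *: u + v);
  si_sym : forall u v, H u -> H v -> ip u v = ip v u;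
  si_linl : forall a u v w, H u -> H v -> H w ->
    ip (a *: u + v) w = a * ip u w + ip v w;
  si_ge0 : forall u, H u -> 0 <= ip u u }.

Definition ip_cauchy (R : realType) (F : zmodType) (ip : F -> F -> R)
    (u : nat -> F) : Prop :=
  forall e : R, 0 < e -> exists N, forall n p, (N <= n)%N -> (N <= p)%N ->
    ip (u n - u p) (u n - u p) < e.

Definition ip_cvg (R : realType) (F : zmodType) (ip : F -> F -> R)
    (u : nat -> F) (v : F) : Prop :=
  (fun n => ip (u n - v) (u n - v)) @ \oo --> (0 : R).

Definition ip_complete (R : realType) (F : zmodType) (H : set F)
    (ip : F -> F -> R) : Prop :=
  forall u, (forall n, H (u n)) -> ip_cauchy ip u ->
    exists2 v, H v & ip_cvg ip u v.

Section SemiInner.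
Context {R : realType} {F : lmodType R} {H : set F} {ip : F -> F -> R}.
Hypothesis si : semi_inner H ip.
Let H0 := si_0 si.

Lemma siZ a u : H u -> H (a *: u).
Proof. by move=> Hu; rewrite -[a *: u]addr0; apply: (si_lin si). Qed.

Lemma siD u v : H u -> H v -> H (u + v).
Proof. by move=> Hu Hv; rewrite -[u]scale1r; apply: (si_lin si). Qed.

Lemma siN u : H u -> H (- u).
Proof. by rewrite -scaleN1r; exact: siZ. Qed.

Lemma siB u v : H u -> H v -> H (u - v).
Proof. by move=> Hu Hv; apply: siD => //; exact: siN. Qed.

Local Hint Resolve siZ siD siN siB H0 : core.

Lemma ip0l w : H w -> ip 0 w = 0.
Proof.
move=> Hw; have := si_linl si (-1) Hw Hw Hw.
by rewrite scaleN1r addNr mulN1r addNr.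
Qed.

Lemma ipZl a u w : H u -> H w -> ip (a *: u) w = a * ip u w.
Proof. by move=> Hu Hw; rewrite -[a *: u]addr0 (si_linl si) // ip0l // addr0. Qed.

Lemma ipDl u v w : H u -> H v -> H w -> ip (u + v) w = ip u w + ip v w.
Proof. by move=> *; rewrite -[u in LHS]scale1r (si_linl si) // mul1r. Qed.

Lemma ipNl u w : H u -> H w -> ip (- u) w = - ip u w.
Proof. by move=> *; rewrite -scaleN1r ipZl // mulN1r. Qed.

Lemma ipBl u v w : H u -> H v -> H w -> ip (u - v) w = ip u w - ip v w.
Proof. by move=> *; rewrite ipDl ?ipNl //; auto. Qed.

Lemma ipZr a u w : H u -> H w -> ip w (a *: u) = a * ip w u.
Proof. by move=> *; rewrite ![ip w _](si_sym si) ?ipZl //; auto. Qed.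

Lemma ipDr u v w : H u -> H v -> H w -> ip w (u + v) = ip w u + ip w v.
Proof. by move=> *; rewrite ![ip w _](si_sym si) ?ipDl //; auto. Qed.

Lemma ipNr u w : H u -> H w -> ip w (- u) = - ip w u.
Proof. by move=> *; rewrite ![ip w _](si_sym si) ?ipNl //; auto. Qed.

Lemma ipBr u v w : H u -> H v -> H w -> ip w (u - v) = ip w u - ip w v.
Proof. by move=> *; rewrite ![ip w _](si_sym si) ?ipBl //; auto. Qed.

Lemma ipZZ a u : H u -> ip (a *: u) (a *: u) = a ^+ 2 * ip u u.
Proof. by move=> Hu; rewrite ipZl ?ipZr //; [ring|auto]. Qed.

Lemma ipNN u : H u -> ip (- u) (- u) = ip u u.
Proof. by move=> Hu; rewrite -scaleN1r ipZZ // sqrrN expr1n mul1r. Qed.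

Lemma ipBC u v : H u -> H v -> ip (u - v) (u - v) = ip (v - u) (v - u).
Proof. by move=> Hu Hv; rewrite -(opprB v u) ipNN //; auto. Qed.

Lemma ipDD u v : H u -> H v -> ip (u + v) (u + v) = ip u u + 2 * ip u v + ip v v.
Proof.
by move=> Hu Hv; rewrite ipDl ?ipDr //; auto; rewrite [ip v u](si_sym si) //; ring.
Qed.

Lemma ipBB u v : H u -> H v -> ip (u - v) (u - v) = ip u u - 2 * ip u v + ip v v.
Proof.
by move=> Hu Hv; rewrite ipDD ?ipNN ?ipNr //; auto; ring.
Qed.

Lemma cauchy_schwarz u v : H u -> H v -> ip u v ^+ 2 <= ip u u * ip v v.
Proof.
move=> Hu Hv.
have q t : 0 <= ip u u + 2 * t * ip u v + t ^+ 2 * ip v v.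
  have := si_ge0 si (siD Hu (siZ t Hv)).
  by rewrite ipDD ?ipZZ ?ipZr //; auto; rewrite mulrA.
have [v0|vn0] := eqVneq (ip v v) 0.
  have [->|uv0] := eqVneq (ip u v) 0; first by rewrite expr0n v0 mulr0.
  have := q (- (ip u u + 1) / (2 * ip u v)).
  rewrite v0 mulr0 addr0.
  have -> : 2 * (- (ip u u + 1) / (2 * ip u v)) * ip u v = - (ip u u + 1) by field.
  by rewrite opprD addrA subrr add0r oppr_ge0 ler10.
have v0 : 0 < ip v v by rewrite lt_neqAle eq_sym vn0 (si_ge0 si).
(* The minimum over [t] of the quadratic polynomial [q t]. *)
have := q (- ip u v / ip v v).
have -> : ip u u + 2 * (- ip u v / ip v v) * ip u v + (- ip u v / ip v v) ^+ 2 * ip v v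
  = (ip u u * ip v v - ip u v ^+ 2) / ip v v by field.
by rewrite pmulr_lge0 ?invr_gt0 // subr_ge0.
Qed.

Definition nrm u := Num.sqrt (ip u u).

Lemma nrm_ge0 u : 0 <= nrm u. Proof. exact: sqrtr_ge0. Qed.

Lemma nrm0 : nrm 0 = 0. Proof. by rewrite /nrm ip0l // sqrtr0. Qed.

Lemma sqr_nrm u : H u -> nrm u ^+ 2 = ip u u.
Proof. by move=> Hu; rewrite sqr_sqrtr // (si_ge0 si). Qed.

Lemma ip_le u v : H u -> H v -> `|ip u v| <= nrm u * nrm v.
Proof.
move=> Hu Hv; rewrite -ler_sqr ?nnegrE ?mulr_ge0 ?nrm_ge0 //.
by rewrite -normrX ger0_norm ?sqr_ge0 // exprMn !sqr_nrm // cauchy_schwarz.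
Qed.

Lemma nrmD u v : H u -> H v -> nrm (u + v) <= nrm u + nrm v.
Proof.
move=> Hu Hv; rewrite -ler_sqr ?nnegrE ?addr_ge0 ?nrm_ge0 //.
rewrite sqrrD !sqr_nrm //; auto; rewrite ipDD //.
have := ler_norm (ip u v); have := ip_le Hu Hv; lra.
Qed.

Lemma nrmZ a u : H u -> nrm (a *: u) = `|a| * nrm u.
Proof. by move=> Hu; rewrite /nrm ipZZ // sqrtrM ?sqr_ge0 // sqrtr_sqr. Qed.

Lemma nrmN u : H u -> nrm (- u) = nrm u.
Proof. by move=> Hu; rewrite /nrm ipNN. Qed.

Lemma nrmBC u v : H u -> H v -> nrm (u - v) = nrm (v - u).
Proof. by move=> Hu Hv; rewrite /nrm ipBC. Qed.

Lemma nrmB u v : H u -> H v -> nrm (u - v) <= nrm u + nrm v.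
Proof. by move=> Hu Hv; apply: le_trans (nrmD Hu (siN Hv)) _; rewrite nrmN. Qed.

Lemma nrm_tri u v w : H u -> H v -> H w -> nrm (u - w) <= nrm (u - v) + nrm (v - w).
Proof.
by move=> *; rewrite -{1}(subrK v u) -addrA; apply: nrmD; auto.
Qed.

Lemma ip_cvgP u v : (forall n, H (u n)) -> H v ->
  ip_cvg ip u v <-> (fun n => nrm (u n - v)) @ \oo --> (0 : R).
Proof.
move=> Hu Hv; split; first by move=> h; exact: (sqrt_cvg0 h).
move=> h; have h2 := cvgM h h; rewrite mulr0 in h2.
rewrite /ip_cvg; suff -> : (fun n => ip (u n - v) (u n - v)) =
  (fun n => nrm (u n - v) * nrm (u n - v)) by exact: h2.
by apply/funext => n; rewrite -expr2 sqr_nrm //; auto.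
Qed.

Lemma ip_cvg_ip u v w : (forall n, H (u n)) -> H v -> H w ->
  ip_cvg ip u v -> (fun n => ip (u n) w) @ \oo --> ip v w.
Proof.
move=> Hu Hv Hw uv; apply/cvgrPdist_le => /= e e0.
have uv' := (ip_cvgP Hu Hv).1 uv.
have h := cvg0Z (nrm w) uv'.
have /cvgrPdist_le /(_ e e0) := h.
apply: filterS => n /=; rewrite sub0r normrN => hn.
rewrite -ipBl //; apply: le_trans (ip_le _ _) _ => //; auto.
by apply: le_trans hn; rewrite nrmBC // mulrC; exact: ler_norm.
Qed.

Lemma ip_cvg_nrm u v : (forall n, H (u n)) -> H v ->
  ip_cvg ip u v -> (fun n => nrm (u n)) @ \oo --> nrm v.
Proof.
move=> Hu Hv uv; apply/cvgrPdist_le => /= e e0.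
have /cvgrPdist_le /(_ e e0) := (ip_cvgP Hu Hv).1 uv.
apply: filterS => n /=; rewrite sub0r normrN => hn.
apply: le_trans (le_trans (ler_norm _) hn).
rewrite ler_norml; apply/andP; split.
  have := nrmD (siB (Hu n) Hv) Hv; rewrite subrK; lra.
have := nrmD (siB Hv (Hu n)) (Hu n); rewrite subrK nrmBC //; lra.
Qed.

Lemma ip_cvg_sqr u v : (forall n, H (u n)) -> H v ->
  ip_cvg ip u v -> (fun n => ip (u n) (u n)) @ \oo --> ip v v.
Proof.
move=> Hu Hv uv; have h := ip_cvg_nrm Hu Hv uv.
have -> : (fun n => ip (u n) (u n)) = (fun n => nrm (u n) * nrm (u n)).
  by apply/funext => n; rewrite -expr2 sqr_nrm.
by rewrite -(sqr_nrm Hv) expr2; exact: cvgM.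
Qed.

Lemma ip_cvgD u v u' v' : (forall n, H (u n)) -> H v -> (forall n, H (u' n)) -> H v' ->
  ip_cvg ip u v -> ip_cvg ip u' v' -> ip_cvg ip (fun n => u n + u' n) (v + v').
Proof.
move=> Hu Hv Hu' Hv' /(ip_cvgP Hu Hv) h /(ip_cvgP Hu' Hv') h'.
apply/ip_cvgP; auto.
apply: cvg0_le (cvg0D h h') => n; rewrite nrm_ge0 /=.
by rewrite opprD addrACA; apply: nrmD; auto.
Qed.

Lemma ip_cvgZ a u v : (forall n, H (u n)) -> H v ->
  ip_cvg ip u v -> ip_cvg ip (fun n => a *: u n) (a *: v).
Proof.
move=> Hu Hv h.
rewrite /ip_cvg; suff -> : (fun n => ip (a *: u n - a *: v) (a *: u n - a *: v)) =
  (fun n => a ^+ 2 * ip (u n - v) (u n - v)).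
  exact: cvg0Z.
by apply/funext => n; rewrite -scalerBr ipZZ //; auto.
Qed.

Lemma ip_cvg_uniq u v w : (forall n, H (u n)) -> H v -> H w ->
  ip_cvg ip u v -> ip_cvg ip u w -> ip (v - w) (v - w) = 0.
Proof.
move=> Hu Hv Hw /(ip_cvgP Hu Hv) h /(ip_cvgP Hu Hw) h'.
rewrite -sqr_nrm; auto; suff -> : nrm (v - w) = 0 by rewrite expr0n.
apply/eqP; rewrite eq_le nrm_ge0 andbT.
have h2 := cvg0D h h'.
apply: (lim_ger h2) => n; rewrite nrmBC; auto; rewrite [leRHS]addrC.
by apply: le_trans (nrm_tri Hw (Hu n) Hv) _; rewrite (nrmBC Hw (Hu n)).
Qed.

(** The representing vector minimizes [ip v v - 2 f v]; a minimizing sequence is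
    Cauchy by the parallelogram law, and stationarity in the direction [w] is the
    representation of [f w]. *)
Lemma riesz (f : F -> R) (C : R) : ip_complete H ip ->
  (forall a u v, H u -> H v -> f (a *: u + v) = a * f u + f v) ->
  (forall u, H u -> f u ^+ 2 <= C * ip u u) ->
  exists2 u, H u & forall v, H v -> ip u v = f v.
Proof.
move=> cH flin fC.
have fZ a u : H u -> f (a *: u) = a * f u.
  have f0 : f 0 = 0.
    by have := flin (-1) _ _ H0 H0; rewrite scaler0 addr0 mulN1r addNr.
  by move=> Hu; rewrite -[a *: u]addr0 flin // f0 addr0.
have fD u v : H u -> H v -> f (u + v) = f u + f v.
  by move=> *; rewrite -[u in LHS]scale1r flin // mul1r.
pose I v := ip v v - 2 * f v.
have Ilb v : H v -> - `|C| <= I v.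
  move=> Hv; rewrite /I; have h1 := si_ge0 si Hv; have h2 := fC _ Hv.
  have h3 : f v ^+ 2 <= `|C| * ip v v.
    by apply: (le_trans h2); rewrite ler_wpM2r // ler_norm.
  have h4 := normr_ge0 C.
  have [C0|C0] := eqVneq `|C| 0.
    have : f v ^+ 2 = 0 by apply/eqP; rewrite eq_le sqr_ge0 andbT -(mul0r (ip v v)) -C0.
    by move/eqP; rewrite sqrf_eq0 => /eqP ->; lra.
  have Cp : 0 < `|C| by rewrite lt_neqAle eq_sym C0.
  rewrite -(ler_pM2l Cp); have := sqr_ge0 (f v - `|C|); rewrite sqrrB; lra.
pose S := [set I v | v in H].
have infS : has_inf S.
  split; first by exists (I 0), 0.
  by exists (- `|C|) => _ [v Hv <-]; exact: Ilb.
pose d := inf S.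
have dI v : H v -> d <= I v by move=> Hv; apply: ge_inf; [exact: infS.2|exists v].
have [v vP] : {v : nat -> F & forall n, H (v n) /\ I (v n) < d + n.+1%:R^-1}.
  apply: (@boolp.choice _ _ (fun n x => H x /\ I x < d + n.+1%:R^-1)) => n.
  have n0 : 0 < n.+1%:R^-1 :> R by rewrite invr_gt0.
  have [_ [x Hx <-] xd] := inf_adherent n0 infS.
  by exists x.
have Hv n : H (v n) := (vP n).1.
have cv : ip_cauchy ip v.
  move=> e e0.
  have [N NP] : exists N, forall n, (N <= n)%N -> n.+1%:R^-1 < e / 4 :> R.
    have e4 : 0 < e / 4 by lra.
    have /cvgr_lt /(_ _ e4) [N _ NP] := @cvg_harmonic R.
    by exists N => n nN; exact: NP.
  exists N => n p nN pN.
  have h1 := NP _ nN; have h2 := NP _ pN.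
  have h3 := (vP n).2; have h4 := (vP p).2.
  have h5 := dI _ (siZ (2^-1) (siD (Hv n) (Hv p))).
  move: h3 h4 h5; rewrite /I fZ; auto; rewrite fD // ipZZ; auto.
  rewrite ipDD // ipBB // => h3 h4 h5.
  have e4 : 2^-1 ^+ 2 = 4^-1 :> R by field.
  rewrite e4 in h5; move: h1 h2 h3 h4; set x := n.+1%:R^-1; set y := p.+1%:R^-1; lra.
have [u Hu vu] := cH _ Hv cv.
exists u => // w Hw.
have key s : 0 <= 2 * s * (ip u w - f w) + s ^+ 2 * ip w w.
  have hn n : - n.+1%:R^-1 <= 2 * s * (ip (v n) w - f w) + s ^+ 2 * ip w w.
    have h1 := dI _ (siD (Hv n) (siZ s Hw)); have h2 := (vP n).2.
    move: h1 h2; rewrite /I fD ?fZ ?ipDD ?ipZZ ?ipZr; auto; set x := n.+1%:R^-1 => h1 h2; lra.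
  have l1 : (fun n => 2 * s * (ip (v n) w - f w) + s ^+ 2 * ip w w) @ \oo -->
     2 * s * (ip u w - f w) + s ^+ 2 * ip w w.
    by apply: cvgD; [apply: cvgMr; apply: cvgB; [exact: ip_cvg_ip|exact: cvg_cst]|exact: cvg_cst].
  have l2 : (fun n => - n.+1%:R^-1) @ \oo --> (0 : R).
    by rewrite -oppr0; apply: cvgN; exact: cvg_harmonic.
  exact: ler_lim_seq l2 l1 hn.
apply/eqP; rewrite -subr_eq0; apply/eqP; set c := ip u w - f w.
have b0 := si_ge0 si Hw.
(* A minimizing [s] would divide by [ip w w], which may vanish. *)
have := key (- c / (ip w w + 1)); rewrite -/c; set b := ip w w in b0 *.
have -> : 2 * (- c / (b + 1)) * c + (- c / (b + 1)) ^+ 2 * b = - c ^+ 2 * ((b + 2) / (b + 1) ^+ 2).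
  field; rewrite gt_eqF //; lra.
have p : 0 < (b + 2) / (b + 1) ^+ 2 by rewrite divr_gt0 ?exprn_gt0 //; lra.
rewrite mulNr oppr_ge0 pmulr_lle0 // => h.
by apply/eqP; rewrite -sqrf_eq0 eq_le h sqr_ge0.
Qed.

End SemiInner.

(** * Forms that are monotone limits of finite forms *)

(** Both the inner product of ell2 and the energy are limits of sums over finite
    sets that increase on the diagonal and stay bounded exactly on the domain.
    Bilinearity and completeness follow from these four properties alone. *)
Record form_lim (R : realType) (F : lmodType R) (H : set F) (q : F -> F -> R)
    (qk : nat -> F -> F -> R) : Prop := FormLim {
  fl_si : forall k, semi_inner [set: F] (qk k);
  fl_mono : forall k u, qk k u u <= qk k.+1 u u;
  fl_dom : forall u, H u <-> exists M, forall k, qk k u u <= M;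
  fl_cvg : forall u v, H u -> H v -> (fun k => qk k u v) @ \oo --> q u v }.

Section FormLim.
Context {R : realType} {F : lmodType R} {H : set F} {q : F -> F -> R}.
Context {qk : nat -> F -> F -> R}.
Hypothesis fl : form_lim H q qk.

Lemma fl_le k l u : (k <= l)%N -> qk k u u <= qk l u u.
Proof.
move=> kl; rewrite -(subnK kl); elim: (l - k)%N => [|n IH] //.
exact: le_trans IH (fl_mono fl _ _).
Qed.

Lemma fl_le_lim k u : H u -> qk k u u <= q u u.
Proof.
move=> Hu; have h := fl_cvg fl Hu Hu.
rewrite -(cvg_lim _ h) //; apply: nondecreasing_cvgn_le.
  by move=> i j ij; exact: fl_le.
by apply/cvg_ex; eexists; exact: h.
Qed.

Lemma fl_lim_le u (M : R) : (forall k, qk k u u <= M) -> H u /\ q u u <= M.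
Proof.
move=> uM; have Hu : H u by apply/(fl_dom fl); exists M.
by split=> //; exact: lim_ler (fl_cvg fl Hu Hu) uM.
Qed.

Lemma fl_semi_inner : semi_inner H q.
Proof.
have flH a u v : H u -> H v -> H (a *: u + v).
  move=> Hu Hv; apply/(fl_dom fl); exists (2 * a ^+ 2 * q u u + 2 * q v v) => k.
  have si := fl_si fl k.
  have := si_ge0 si (_ : setT (a *: u - v)) => /(_ I).
  rewrite (ipBB si) // (ipDD si) // !(ipZZ si) //.
  have := ler_wpM2l (sqr_ge0 a) (fl_le_lim k Hu); have := fl_le_lim k Hv.
  set c := a ^+ 2; lra.
split.
- by apply/(fl_dom fl); exists 0 => k; rewrite (ip0l (fl_si fl k)).
- exact: flH.
- move=> u v Hu Hv; apply: (cvg_unique _ (fl_cvg fl Hu Hv)) => //.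
  have -> : (fun k => qk k u v) = (fun k => qk k v u).
    by apply/funext => k; rewrite (si_sym (fl_si fl k)).
  exact: (fl_cvg fl).
- move=> a u v w Hu Hv Hw.
  apply: (cvg_unique _ (fl_cvg fl (flH a _ _ Hu Hv) Hw)) => //.
  have -> : (fun k => qk k (a *: u + v) w) = (fun k => a * qk k u w + qk k v w).
    by apply/funext => k; rewrite (si_linl (fl_si fl k)).
  by apply: cvgD; [apply: cvg_scale|]; exact: (fl_cvg fl).
- move=> u Hu; apply: (lim_ger (fl_cvg fl Hu Hu)) => k.
  exact: (si_ge0 (fl_si fl k)).
Qed.

(** Completeness follows from that of a weaker topology: if a Cauchy sequence for [q]
    converges in each [qk k], then letting [p] tend to infinity in
    [qk k (u n - u p) <= q (u n - u p)] and then taking the supremum over [k] bounds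
    [q (u n - v)]. *)
Lemma fl_complete (u : nat -> F) (v : F) : (forall n, H (u n)) ->
  ip_cauchy q u -> (forall k, ip_cvg (qk k) u v) -> H v /\ ip_cvg q u v.
Proof.
move=> Hu cu uv; have si := fl_semi_inner.
have key e : 0 < e -> exists N, forall n, (N <= n)%N ->
    H (u n - v) /\ q (u n - v) (u n - v) <= e.
  move=> e0; have [N NP] := cu _ e0; exists N => n nN.
  apply: fl_lim_le => k; have sik := fl_si fl k.
  have h : (fun p => qk k (u n - u p) (u n - u p)) @ \oo --> qk k (u n - v) (u n - v).
    have hh : ip_cvg (qk k) (fun p => u n - u p) (u n - v).
      rewrite /ip_cvg; suff -> : (fun p => qk k (u n - u p - (u n - v)) (u n - u p - (u n - v)))
         = (fun p => qk k (u p - v) (u p - v)) by exact: uv.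
      apply/funext => p; rewrite -(ipNN sik (u := u p - v)) //.
      by rewrite (opprB (u n)) [X in qk k X X]addrC addrA subrK opprB.
    exact: (ip_cvg_sqr sik (fun=> I) I hh).
  have /cvgrPdist_le/= := h => /(_ _ _)/= hd.
  apply/ler_addgt0Pr => d d0.
  have [P _ PP] := hd _ d0.
  have := PP (maxn N P) (leq_maxr _ _); rewrite /= => h1.
  have := NP n (maxn N P) nN (leq_maxl _ _) => h2.
  have := fl_le_lim k (siB si (Hu n) (Hu (maxn N P))).
  have := ler_norm (qk k (u n - v) (u n - v) - qk k (u n - u (maxn N P)) (u n - u (maxn N P))).
  lra.
have Hv : H v.
  have [N /(_ _ (leqnn N)) [h _]] := key 1 ltr01.
  by rewrite -(subKr (u N) v); apply: (siB si).
split=> //; apply/cvgrPdist_le => e e0 /=; have [N NP] := key e e0.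
exists N => // n nN /=; have [h1 h2] := NP n nN.
by rewrite sub0r normrN ger0_norm // (si_ge0 si).
Qed.

End FormLim.

(** * Square summable functions *)

Section Ell2.
Context {R : realType} {X : countType} {w : X -> R} {A : nat -> {fset X}}.
Hypothesis w_ge0 : forall x, 0 <= w x.
Hypothesis exA : exhausts A.
Implicit Types f g : X -> R.

Definition fin_inner (w : X -> R) (B : {fset X}) f g := \sum_(x <- B) f x * g x * w x.

Lemma fin_inner_si B : semi_inner setT (fin_inner w B).
Proof.
split=> //.
- by move=> f g _ _; apply: eq_bigr => x _; ring.
- move=> a f g h _ _ _; rewrite /fin_inner mulr_sumr -big_split /=.
  apply: eq_bigr => x _; rewrite !fctE; change (a *: f x) with (a * f x); ring.
- move=> f _; apply: sumr_ge0 => x _; apply: mulr_ge0 => //.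
  by rewrite -expr2 sqr_ge0.
Qed.

Lemma ell2_summable f g : ell2 w f -> ell2 w g ->
  abs_summable (fun x => f x * g x * w x).
Proof.
move=> hf hg; apply: (@abs_summable_le _ _ _ (fun x => f x ^+ 2 * w x + g x ^+ 2 * w x)).
  move=> x; rewrite !normrM (ger0_norm (w_ge0 x)) -mulrDl ler_wpM2r //.
  have := sqr_ge0 (`|f x| - `|g x|); rewrite sqrrB !real_normK ?num_real //.
  have := mulr_ge0 (normr_ge0 (f x)) (normr_ge0 (g x)); lra.
rewrite (eq_esum (b := fun x => (f x ^+ 2 * w x)%:E + (g x ^+ 2 * w x)%:E)%E) //.
rewrite esumD; try by move=> x _; rewrite lee_fin mulr_ge0 // sqr_ge0.
exact: lte_add_pinfty.
Qed.

Lemma ell2_form_lim : form_lim (ell2 w) (inner w) (fun k => fin_inner w (A k)).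
Proof.
split.
- by move=> k; exact: fin_inner_si.
- move=> k f; apply: ler_sum_fset; last exact: exA.1.
  by move=> x; rewrite -expr2 mulr_ge0 // sqr_ge0.
- move=> f; rewrite /ell2 /= (esum_ltyP exA) //.
  by move=> x; rewrite mulr_ge0 // sqr_ge0.
- move=> f g hf hg; exact: (rsum_cvg exA (ell2_summable hf hg)).
Qed.

Lemma ell2_si : semi_inner (ell2 w) (inner w).
Proof. exact: fl_semi_inner ell2_form_lim. Qed.

Lemma ell2_coord f x : ell2 w f -> f x ^+ 2 * w x <= inner w f f.
Proof.
move=> hf; have [k xk] := exA.2 x.
apply: le_trans (fl_le_lim ell2_form_lim k hf).
rewrite /fin_inner (big_fsetD1 x) //= expr2 lerDl sumr_ge0 // => y _.
by rewrite -expr2 mulr_ge0 // sqr_ge0.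
Qed.

Lemma inner_fin f g (B : {fset X}) : ell2 w f -> ell2 w g ->
  (forall x, x \notin B -> f x * g x * w x = 0) -> inner w f g = fin_inner w B f g.
Proof.
move=> hf hg fB; apply: (cvg_unique _ (fl_cvg ell2_form_lim hf hg)) => //.
have [k Bk] := exhausts_fset exA B.
apply: cvg_near_cst; exists k => // l /= kl; apply/esym.
apply: big_fset_incl; first exact: fsubset_trans Bk (exhausts_mono exA kl).
by move=> x _; exact: fB.
Qed.

Lemma Cc_ell2 f : Cc f -> ell2 w f.
Proof.
move=> hf; apply/(fl_dom ell2_form_lim).
exists (fin_inner w (fset_set [set x | f x != 0]) f f) => k.
have [l Bl] := exhausts_fset exA (fset_set [set x | f x != 0]).
rewrite /fin_inner.
rewrite [leRHS](@big_fset_incl _ _ _ _ _ (A (maxn k l))).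
- apply: ler_sum_fset; last exact: (exhausts_mono exA (leq_maxl k l)).
  by move=> x; rewrite -expr2 mulr_ge0 // sqr_ge0.
- exact: (fsubset_trans Bl (exhausts_mono exA (leq_maxr k l))).
- move=> x _; have [->|fx] := eqVneq (f x) 0; first by rewrite !mul0r.
  by rewrite in_fset_set // mem_set.
Qed.

End Ell2.

Section Ell2Complete.
Context {R : realType} {X : countType} {w : X -> R} {A : nat -> {fset X}}.
Hypothesis w_gt0 : forall x, 0 < w x.
Hypothesis exA : exhausts A.
Let w_ge0 x : 0 <= w x := ltW (w_gt0 x).
Implicit Types f g : X -> R.

Lemma ell2_cvg_coord (u : nat -> X -> R) v x : (forall n, ell2 w (u n)) ->
  ell2 w v -> ip_cvg (inner w) u v -> (fun n => u n x) @ \oo --> v x.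
Proof.
move=> Hu Hv uv; have si := ell2_si w_ge0 exA.
have uv' := (ip_cvgP si Hu Hv).1 uv.
have h := cvg0Z (Num.sqrt (w x))^-1 uv'.
rewrite -[v x]add0r; have -> : (fun n => u n x) = (fun n => (u n x - v x) + v x).
  by apply/funext => n; rewrite subrK.
apply: cvgD; last exact: cvg_cst.
apply/norm_cvg0P; apply: cvg0_le h => n /=; rewrite normr_ge0 /=.
have sw : 0 < Num.sqrt (w x) by rewrite sqrtr_gt0.
rewrite ler_pdivlMl // mulrC -ler_sqr ?nnegrE ?mulr_ge0 ?sqrtr_ge0 ?normr_ge0 ?nrm_ge0 //.
rewrite (sqr_nrm si); last exact: (siB si).
rewrite exprMn sqr_sqrtr // real_normK ?num_real //.
exact: (ell2_coord w_ge0 exA x (siB si (Hu n) Hv)).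
Qed.

Lemma ell2_complete : ip_complete (ell2 w) (inner w).
Proof.
move=> u Hu cu; have si := ell2_si w_ge0 exA.
have cx x : cvgn (fun n => u n x).
  apply: cauchy_seq_cvg => e e0.
  have [|N NP] := cu (e ^+ 2 * w x); first by rewrite mulr_gt0 ?exprn_gt0.
  exists N => n p nN pN.
  rewrite -ltr_sqr ?nnegrE ?(ltW e0) ?normr_ge0 // real_normK ?num_real //.
  rewrite -(ltr_pM2r (w_gt0 x)); apply: le_lt_trans (NP n p nN pN).
  exact: (ell2_coord w_ge0 exA x (siB si (Hu n) (Hu p))).
pose v x := limn (fun n => u n x).
have uv k : ip_cvg (fin_inner w (A k)) u v.
  rewrite /ip_cvg -[X in _ --> X](_ : \sum_(x <- A k) (0 : R) = 0); last by rewrite big1.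
  apply: cvg_fsum => x; rewrite -[X in _ --> X](mul0r (w x)).
  apply: cvgM; last exact: cvg_cst.
  have h : (fun n => (u n - v) x) @ \oo --> (0 : R).
    by rewrite -(subrr (v x)); apply: cvgB; [exact: cx|exact: cvg_cst].
  by rewrite -(mul0r 0); apply: cvgM.
by have [] := fl_complete (ell2_form_lim w_ge0 exA) Hu cu uv; exists v.
Qed.

Lemma ell2_trunc f : ell2 w f ->
  (fun k => inner w (restrict0 (A k) f - f) (restrict0 (A k) f - f)) @ \oo --> (0 : R).
Proof.
move=> Hf; have si := ell2_si w_ge0 exA; have fl := ell2_form_lim w_ge0 exA.
have Hr k : ell2 w (restrict0 (A k) f).
  apply/(fl_dom fl); exists (inner w f f) => l.
  apply: le_trans (fl_le_lim fl l Hf); rewrite /fin_inner; apply: ler_sum => x _.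
  rewrite ler_wpM2r // -!expr2 /restrict0; case: ifP => // _.
  by rewrite expr0n sqr_ge0.
have rf k : inner w (restrict0 (A k) f) f = fin_inner w (A k) f f.
  rewrite (inner_fin w_ge0 exA (B := A k)) //; last first.
    by move=> x /negbTE xA; rewrite /restrict0 xA !mul0r.
  by rewrite /fin_inner; apply: eq_big_seq => x xA; rewrite /restrict0 xA.
have rr k : inner w (restrict0 (A k) f) (restrict0 (A k) f) = fin_inner w (A k) f f.
  rewrite (inner_fin w_ge0 exA (B := A k)) //; last first.
    by move=> x /negbTE xA; rewrite /restrict0 xA !mul0r.
  by rewrite /fin_inner; apply: eq_big_seq => x xA; rewrite /restrict0 xA.
have -> : (fun k => inner w (restrict0 (A k) f - f) (restrict0 (A k) f - f)) =
   (fun k => inner w f f - fin_inner w (A k) f f).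
  by apply/funext => k; rewrite (ipBB si) // rf rr; ring.
rewrite -(subrr (inner w f f)); apply: cvgB; first exact: cvg_cst.
exact: (fl_cvg fl Hf Hf).
Qed.

End Ell2Complete.

(** * The energy as a limit of the energies of finite pieces *)

Section Energy.
Context {R : realType} {X : countType} (G : graph R X) {A : nat -> {fset X}}.
Hypothesis exA : exhausts A.
Implicit Types f g : X -> R.

Definition grad f : X * X -> R := fun xy => f xy.1 - f xy.2.

Definition edge2 : X * X -> R := fun xy => edge G xy.1 xy.2.

(** The ordered pairs of [B] are summed with the weight [edge2], so that the energy is
    an inner product of discrete gradients and the theory of ell2 applies to it. *)
Definition fin_energy (B : {fset X}) f g : R :=
  2^-1 * fin_inner edge2 (B `*` B)%fset (grad f) (grad g)
  + fin_inner (killing G) B f g.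

Lemma exhausts2 : exhausts (fun k => A k `*` A k)%fset.
Proof.
split=> [k|[x y]].
  by apply/fsubsetP => -[x y]; rewrite !in_fsetM /= => /andP[xA yA];
    rewrite !(fsubsetP (exA.1 k)).
have [k xk] := exA.2 x; have [l yl] := exA.2 y; exists (maxn k l).
rewrite in_fsetM /= (fsubsetP (exhausts_mono exA (leq_maxl k l))) //.
by rewrite (fsubsetP (exhausts_mono exA (leq_maxr k l))).
Qed.

Let e_ge0 xy : 0 <= edge2 xy := edge_ge0 G xy.1 xy.2.
Let fe := ell2_form_lim e_ge0 exhausts2.
Let fk := ell2_form_lim (killing_ge0 G) exA.

Lemma finite_energyP f : finite_energy G f <-> ell2 edge2 (grad f) /\ ell2 (killing G) f.
Proof.
rewrite /finite_energy /ell2 /=.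
rewrite (eq_esum (b := fun xy => (grad f xy ^+ 2 * edge2 xy)%:E)); last first.
  by move=> xy _; rewrite mulrC.
rewrite [X in (_ + X)%E](eq_esum (b := fun x => (f x ^+ 2 * killing G x)%:E)); last first.
  by move=> x _; rewrite mulrC.
split=> [h|[h1 h2]]; last exact: lte_add_pinfty.
split; apply: le_lt_trans h.
  rewrite leeDl // esum_ge0 // => x _.
  by rewrite lee_fin mulr_ge0 ?sqr_ge0 ?killing_ge0.
rewrite leeDr // esum_ge0 // => x _.
by rewrite lee_fin mulr_ge0 ?sqr_ge0.
Qed.

Lemma energyE f g : energy G f g =
  2^-1 * inner edge2 (grad f) (grad g) + inner (killing G) f g.
Proof.
rewrite /energy /inner; congr (_ * _ + _); apply: (congr1 (@rsum R _)); apply/funext => x.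
  by rewrite -mulrA mulrC.
by rewrite -mulrA mulrC.
Qed.

Lemma grad_lin a f g : grad (a *: f + g) = a *: grad f + grad g.
Proof.
apply/funext => -[x y]; rewrite /grad !fctE /=.
change (a * f x + g x - (a * f y + g y) = a * (f x - f y) + (g x - g y)); ring.
Qed.

Lemma fin_energy_si B : semi_inner setT (fin_energy B).
Proof.
have s1 := fin_inner_si e_ge0 (B `*` B)%fset.
have s2 := fin_inner_si (killing_ge0 G) B.
split=> //.
- by move=> u v _ _; rewrite /fin_energy (si_sym s1) // (si_sym s2).
- move=> a u v w _ _ _; rewrite /fin_energy grad_lin (si_linl s1) // (si_linl s2) //; ring.
- move=> u _; have := si_ge0 s1 (I : setT (grad u)); have := si_ge0 s2 (I : setT u).
  rewrite /fin_energy; lra.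
Qed.

Lemma energy_form_lim :
  form_lim (finite_energy G) (energy G) (fun k => fin_energy (A k)).
Proof.
split.
- by move=> k; exact: fin_energy_si.
- move=> k f; have := fl_mono fe k (grad f); have := fl_mono fk k f.
  rewrite /fin_energy; lra.
- move=> f; rewrite finite_energyP (fl_dom fe) (fl_dom fk).
  split=> [[[M1 h1] [M2 h2]]|[M h]].
    by exists (2^-1 * M1 + M2) => k; move: (h1 k) (h2 k); rewrite /fin_energy; lra.
  split; [exists (2 * M)|exists M] => k;
  have := si_ge0 (fl_si fe k) (I : setT (grad f));
  have := si_ge0 (fl_si fk k) (I : setT f);
  move: (h k); rewrite /fin_energy; lra.
- move=> f g /finite_energyP[f1 f2] /finite_energyP[g1 g2]; rewrite energyE.
  apply: cvgD; last exact: (fl_cvg fk).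
  by apply: cvg_scale; exact: (fl_cvg fe).
Qed.

(** Normal contractions operate: every term of the energy decreases. *)
Lemma finite_energy_contract f g : finite_energy G f ->
  (forall x y, `|g x - g y| <= `|f x - f y|) -> (forall x, `|g x| <= `|f x|) ->
  finite_energy G g.
Proof.
move=> /(fl_dom energy_form_lim)[M hM] h1 h2.
apply/(fl_dom energy_form_lim); exists M => k; apply: le_trans (hM k).
have sqn (a b : R) : `|a| <= `|b| -> a * a <= b * b.
  by move=> ab; rewrite -!expr2 -(real_normK (num_real a)) -(real_normK (num_real b)) ler_sqr ?nnegrE.
rewrite /fin_energy lerD // ?ler_pM2l ?invr_gt0 //.
  by apply: ler_sum => -[x y] _; apply: ler_wpM2r => //; apply: sqn; exact: h1.
by apply: ler_sum => x _; rewrite ler_wpM2r ?killing_ge0 // sqn.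
Qed.

End Energy.

(** * Accretive operators and their semigroups *)

Record hilbert (R : realType) (F : lmodType R) (H : set F) (ip : F -> F -> R)
    : Prop := Hilbert {
  hil_si : semi_inner H ip;
  hil_def : forall u, H u -> ip u u = 0 -> u = 0;
  hil_complete : ip_complete H ip }.

(** The operator is given by its graph, so that unbounded operators need no domain
    type; [ma_range] is the solvability of [u + h L u = f]. *)
Record maccretive (R : realType) (F : lmodType R) (H : set F)
    (ip : F -> F -> R) (L : F -> F -> Prop) : Prop := MAccretive {
  ma_dom : forall u g, L u g -> H u /\ H g;
  ma_lin : forall a u g v k, L u g -> L v k -> L (a *: u + v) (a *: g + k);
  ma_acc : forall u g, L u g -> 0 <= ip g u;
  ma_range : forall h f, 0 < h -> H f -> exists u, L u (h^-1 *: (f - u));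
  ma_dense : forall f e, H f -> 0 < e ->
    exists u g, L u g /\ nrm (ip := ip) (f - u) < e }.

(** [resolvent L h] is the operator [(1 + h L)^-1]. *)
Definition resolvent (R : realType) (F : lmodType R) (L : F -> F -> Prop)
  (h : R) (f : F) : F := xget 0 [set u | L u (h^-1 *: (f - u))].

(** The implicit Euler scheme with n.+1 steps; the shift avoids a division by zero. *)
Definition euler (R : realType) (F : lmodType R) (L : F -> F -> Prop)
  (t : R) (n : nat) (f : F) : F := iter n.+1 (resolvent L (t / n.+1%:R)) f.

(** The semigroup [e^(-tL)], obtained as the limit of the implicit Euler scheme. *)
Definition expsg (R : realType) (F : lmodType R) (H : set F) (ip : F -> F -> R)
    (L : F -> F -> Prop) (t : R) (f : F) : F :=
  xget 0 [set v | H v /\ ip_cvg ip (fun n => euler L t n f) v].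

Section Hilbert.
Context {R : realType} {F : lmodType R} {H : set F} {ip : F -> F -> R}.
Hypothesis hil : hilbert H ip.
Let si := hil_si hil.
Local Notation N := (@nrm R F ip).

Let HZ a u : H u -> H (a *: u) := @siZ _ _ _ _ si a u.
Let HD u v : H u -> H v -> H (u + v) := @siD _ _ _ _ si u v.
Let HB u v : H u -> H v -> H (u - v) := @siB _ _ _ _ si u v.
Let HN u : H u -> H (- u) := @siN _ _ _ _ si u.
Let H0 : H 0 := si_0 si.
Local Hint Resolve HZ HD HB HN H0 : core.

Lemma nrm0_eq u : H u -> N u <= 0 -> u = 0.
Proof.
move=> Hu u0; apply: (hil_def hil Hu); rewrite -(sqr_nrm si Hu).
suff -> : N u = 0 by rewrite expr0n.
by apply/eqP; rewrite eq_le u0 nrm_ge0.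
Qed.

Lemma ip_cvg_unique u v w : (forall n, H (u n)) -> H v -> H w ->
  ip_cvg ip u v -> ip_cvg ip u w -> v = w.
Proof.
move=> Hu Hv Hw h1 h2; apply/eqP; rewrite -subr_eq0; apply/eqP.
by apply: (hil_def hil); auto; exact: (ip_cvg_uniq si Hu Hv Hw h1 h2).
Qed.

(** [S^n - T^n] is the sum of the [S^i (S - T) T^(n-1-i)]; commuting the factor
    [S - T] to the right lets the bounds on the powers act on [S u - T u]. *)
Lemma telescope (S T : F -> F) (M : R) (n : nat) (u : F) : 0 <= M ->
  (forall f, H f -> H (S f)) -> (forall f, H f -> H (T f)) ->
  (forall f g, H f -> H g -> S (f - g) = S f - S g) ->
  (forall f g, H f -> H g -> T (f - g) = T f - T g) ->
  (forall f, H f -> S (T f) = T (S f)) ->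
  (forall f, H f -> N (T f) <= N f) ->
  (forall j f, (j < n)%N -> H f -> N (iter j S f) <= M * N f) ->
  H u -> N (iter n S u - iter n T u) <= n%:R * (M * N (S u - T u)).
Proof.
move=> M0 HS HT SB TB ST Tc.
elim: n u => [|n IH] u SM Hu.
  by rewrite subrr mul0r (nrm0 si).
have iS j f : H f -> H (iter j S f) by move=> Hf; elim: j => //= j; exact: HS.
have iT j f : H f -> H (iter j T f) by move=> Hf; elim: j => //= j; exact: HT.
have iSB j f g : H f -> H g -> iter j S (f - g) = iter j S f - iter j S g.
  by move=> Hf Hg; elim: j => //= j ->; rewrite SB; auto.
have -> : iter n.+1 S u - iter n.+1 T u =
    iter n S (S u - T u) + (iter n S (T u) - iter n T (T u)).
  by rewrite iSB; auto; rewrite -!iterSr addrA subrK.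
apply: le_trans (nrmD si _ _) _; auto.
rewrite -natr1 mulrDl mul1r addrC; apply: lerD; last by apply: SM; auto.
apply: le_trans (IH _ _ (HT _ Hu)) _.
  by move=> j f jn; apply: SM; exact: ltnW.
rewrite ler_wpM2l ?ler0n // ler_wpM2l //.
by rewrite ST // -TB; auto.
Qed.

Section Resolvent.
Context {L : F -> F -> Prop}.
Hypothesis ma : maccretive H ip L.
Local Notation J := (resolvent L).

Lemma resolventP h f : 0 < h -> H f -> L (J h f) (h^-1 *: (f - J h f)).
Proof.
move=> h0 Hf; have [u Lu] := ma_range ma h0 Hf.
by rewrite /resolvent; case: xgetP => [v -> //|/(_ u)].
Qed.

Lemma resolvent_H h f : 0 < h -> H f -> H (J h f).
Proof. by move=> h0 Hf; have [] := ma_dom ma (resolventP h0 Hf). Qed.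
Local Hint Resolve resolvent_H : core.

Lemma maB u g v k : L u g -> L v k -> L (u - v) (g - k).
Proof.
by move=> Lu Lv; rewrite [u - v]addrC [g - k]addrC -(scaleN1r v) -(scaleN1r k); exact: (ma_lin ma).
Qed.

Lemma ma0 : L 0 0.
Proof.
have h := resolventP ltr01 H0.
by have := maB h h; rewrite !subrr.
Qed.

Lemma maZ a u g : L u g -> L (a *: u) (a *: g).
Proof. by move=> Lu; have := ma_lin ma a Lu ma0; rewrite !addr0. Qed.

Lemma maD u g v k : L u g -> L v k -> L (u + v) (g + k).
Proof. by move=> Lu Lv; rewrite -[u]scale1r -[g]scale1r; exact: (ma_lin ma). Qed.

Lemma resolvent_uniq h u g : 0 < h -> L u g -> J h (u + h *: g) = u.
Proof.
move=> h0 Lu; have [Hu Hg] := ma_dom ma Lu.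
have Hf : H (u + h *: g) by auto.
have LJ := resolventP h0 Hf; set v := J h _ in LJ *.
have Hv : H v by apply: resolvent_H.
have := ma_acc ma (maB LJ Lu).
have -> : h^-1 *: (u + h *: g - v) - g = - h^-1 *: (v - u).
  by rewrite addrAC scalerDr scalerA mulVf ?gt_eqF // scale1r addrK scaleNr -scalerN opprB.
rewrite (ipZl si); auto; rewrite mulNr oppr_ge0 pmulr_rle0 ?invr_gt0 // => h1.
apply/eqP; rewrite -subr_eq0; apply/eqP; apply: (hil_def hil); auto.
by apply/eqP; rewrite eq_le h1 (si_ge0 si); auto.
Qed.

Lemma resolvent_eq h f u : 0 < h -> L u (h^-1 *: (f - u)) -> J h f = u.
Proof.
move=> h0 Lu; have := resolvent_uniq h0 Lu.
by rewrite scalerA mulfV ?gt_eqF // scale1r addrC subrK.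
Qed.

Lemma resolvent_lin h a f g : 0 < h -> H f -> H g ->
  J h (a *: f + g) = a *: J h f + J h g.
Proof.
move=> h0 Hf Hg; apply: resolvent_eq => //.
have := ma_lin ma a (resolventP h0 Hf) (resolventP h0 Hg).
congr L; rewrite scalerA [a * _]mulrC -scalerA -scalerDr; congr (_ *: _).
by rewrite scalerBr opprD addrACA.
Qed.

Lemma resolventB h f g : 0 < h -> H f -> H g -> J h (f - g) = J h f - J h g.
Proof.
move=> h0 Hf Hg; rewrite [f - g]addrC [_ - J h g]addrC -(scaleN1r g) -(scaleN1r (J h g)).
exact: resolvent_lin.
Qed.

Lemma resolventZ h a f : 0 < h -> H f -> J h (a *: f) = a *: J h f.
Proof.
move=> h0 Hf; have J0 : J h 0 = 0.
  by have := resolventB h0 Hf Hf; rewrite !subrr.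
by rewrite -[a *: f]addr0 resolvent_lin // J0 addr0.
Qed.

(** Pairing [u + h L u = f] with [u] gives [ip u u <= ip f u] by accretivity. *)
Lemma resolvent_le h f : 0 < h -> H f -> N (J h f) <= N f.
Proof.
move=> h0 Hf; have HJ := resolvent_H h0 Hf.
have := ma_acc ma (resolventP h0 Hf).
rewrite (ipZl si); auto; rewrite pmulr_rge0 ?invr_gt0 // (ipBl si) //.
rewrite subr_ge0 -(sqr_nrm si HJ) => h1.
have h2 := le_trans (ler_norm _) (ip_le si Hf HJ).
have [->|n0] := eqVneq (N (J h f)) 0; first exact: nrm_ge0.
have n1 : 0 < N (J h f) by rewrite lt_neqAle eq_sym n0 nrm_ge0.
by rewrite -(ler_pM2r n1) -expr2; exact: le_trans h1 h2.
Qed.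

Lemma iter_resolvent_H h n f : 0 < h -> H f -> H (iter n (J h) f).
Proof. by move=> h0 Hf; elim: n => //= n; auto. Qed.
Local Hint Resolve iter_resolvent_H : core.

Lemma iter_resolvent_le h n f : 0 < h -> H f -> N (iter n (J h) f) <= N f.
Proof.
by move=> h0 Hf; elim: n => //= n IH; apply: le_trans IH; apply: resolvent_le; auto.
Qed.

Lemma iter_resolvent_lin h n a f g : 0 < h -> H f -> H g ->
  iter n (J h) (a *: f + g) = a *: iter n (J h) f + iter n (J h) g.
Proof.
by move=> h0 Hf Hg; elim: n => //= n ->; rewrite resolvent_lin; auto.
Qed.

Lemma iter_resolventB h n f g : 0 < h -> H f -> H g ->
  iter n (J h) (f - g) = iter n (J h) f - iter n (J h) g.
Proof.
by move=> h0 Hf Hg; elim: n => //= n ->; rewrite resolventB; auto.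
Qed.

Lemma iter_resolventZ h n a f : 0 < h -> H f ->
  iter n (J h) (a *: f) = a *: iter n (J h) f.
Proof. by move=> h0 Hf; elim: n => //= n ->; rewrite resolventZ; auto. Qed.

Lemma L_resolvent h u g : 0 < h -> L u g -> L (J h u) (J h g).
Proof.
move=> h0 Lu; have [Hu Hg] := ma_dom ma Lu.
have := resolventP h0 Hu; congr L.
rewrite -{1}(resolvent_uniq h0 Lu) [u + _]addrC resolvent_lin; auto.
by rewrite addrK scalerA mulVf ?gt_eqF // scale1r.
Qed.

Lemma resolventC h k f : 0 < h -> 0 < k -> H f -> J h (J k f) = J k (J h f).
Proof.
move=> h0 k0 Hf; apply/esym/resolvent_eq => //.
have := L_resolvent h0 (resolventP k0 Hf).
by rewrite resolventZ ?resolventB; auto.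
Qed.

Lemma resolvent_diff h u g : 0 < h -> L u g -> J h u - u = - h *: J h g.
Proof.
move=> h0 Lu; have [Hu Hg] := ma_dom ma Lu.
rewrite -{2}(resolvent_uniq h0 Lu) [u + _]addrC resolvent_lin; auto.
by rewrite opprD addrCA subrr addr0 scaleNr.
Qed.

Lemma iter_resolvent_sub h n u g : 0 < h -> L u g ->
  N (iter n (J h) u - u) <= n%:R * h * N g.
Proof.
move=> h0 Lu; have [Hu Hg] := ma_dom ma Lu.
elim: n => [|n IH]; first by rewrite subrr !mul0r (nrm0 si).
apply: le_trans (nrm_tri si (v := iter n (J h) u) _ _ _) _; auto.
rewrite -natr1 !mulrDl addrC lerD // mul1r iterSr -iter_resolventB; auto.
rewrite (resolvent_diff h0 Lu) (le_trans (iter_resolvent_le _ _ _)); auto.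
by rewrite (nrmZ si); auto; rewrite normrN (gtr0_norm h0) ler_wpM2l ?resolvent_le // ltW.
Qed.

(** Each step changes the vector by [- h J^(j+1) g] instead of [- h g], which differs
    from it by at most [j.+1 h^2 N k] because [g] is itself in the domain. *)
Lemma iter_resolvent_taylor h n u g k : 0 < h -> L u g -> L g k ->
  N (iter n (J h) u - u + (n%:R * h) *: g) <= (n%:R * h) ^+ 2 * N k.
Proof.
move=> h0 Lu Lg; have [Hu Hg] := ma_dom ma Lu; have [_ Hk] := ma_dom ma Lg.
elim: n => [|n IH].
  by rewrite subrr !mul0r scale0r addr0 expr0n mul0r (nrm0 si).
have -> : iter n.+1 (J h) u - u + (n.+1%:R * h) *: g =
   (iter n (J h) u - u + (n%:R * h) *: g) + (- h) *: (iter n.+1 (J h) g - g).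
  have -> : iter n.+1 (J h) u = iter n (J h) u + - h *: iter n.+1 (J h) g.
    apply/eqP; rewrite addrC -subr_eq !iterSr -iter_resolventB; auto.
    by rewrite (resolvent_diff h0 Lu) iter_resolventZ //; auto.
  rewrite -natr1 mulrDl mul1r scalerDl scalerBr !scaleNr opprK.
  rewrite !addrA; congr (_ + _); rewrite -!addrA; congr (_ + _).
  by rewrite addrC -addrA.
apply: le_trans (nrmD si _ _) _; auto.
have h1 := iter_resolvent_sub n.+1 h0 Lg.
rewrite (nrmZ si); auto; rewrite normrN (gtr0_norm h0).
apply: le_trans (lerD IH (ler_wpM2l (ltW h0) h1)) _.
rewrite -natr1 !mulrA -mulrDl ler_wpM2r ?nrm_ge0 //.
have : 0 <= n%:R * h ^+ 2 by rewrite mulr_ge0 ?ler0n // sqr_ge0.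
lra.
Qed.

End Resolvent.
End Hilbert.

(** * Convergence of the Euler scheme *)

Section Semigroup.
Context {R : realType} {F : lmodType R} {H : set F} {ip : F -> F -> R}.
Hypothesis hil : hilbert H ip.
Let si := hil_si hil.
Local Notation N := (@nrm R F ip).

Let HZ a u : H u -> H (a *: u) := @siZ _ _ _ _ si a u.
Let HD u v : H u -> H v -> H (u + v) := @siD _ _ _ _ si u v.
Let HB u v : H u -> H v -> H (u - v) := @siB _ _ _ _ si u v.
Let HN u : H u -> H (- u) := @siN _ _ _ _ si u.
Let H0 : H 0 := si_0 si.
Local Hint Resolve HZ HD HB HN H0 : core.

Section OneOperator.
Context {L : F -> F -> Prop}.
Hypothesis ma : maccretive H ip L.
Local Notation J := (resolvent L).
Let JH h f : 0 < h -> H f -> H (J h f) := @resolvent_H _ _ _ _ _ ma h f.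
Let iJH h n f : 0 < h -> H f -> H (iter n (J h) f) := @iter_resolvent_H _ _ _ _ _ ma h n f.
Local Hint Resolve JH iJH : core.

(** For [u] in the domain, [J h u - u = - h J h (L u)] is of order [h]; contractivity
    extends this to the closure of the domain. *)
Lemma resolvent_cvg0 f e : H f -> 0 < e -> exists2 d, 0 < d &
  forall h, 0 < h < d -> N (J h f - f) <= e.
Proof.
move=> Hf e0; have e4 : 0 < e / 4 by lra.
have [u [g [Lu fu]]] := ma_dense ma Hf e4; have [Hu Hg] := ma_dom ma Lu.
have n0 := nrm_ge0 (ip := ip) g.
exists (e / 2 / (N g + 1)); first by rewrite !divr_gt0 //; lra.
move=> h /andP[h0 hd].
have hg : h * N g <= e / 2.
  have n1 : 0 < N g + 1 by lra.
  by move: hd; rewrite ltr_pdivlMr // => hd; nra.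
have h1 := nrm_tri si (JH h0 Hf) (JH h0 Hu) Hf.
have h2 := nrm_tri si (JH h0 Hu) Hu Hf.
have h3 := iter_resolvent_sub hil ma 1 h0 Lu; rewrite /= mul1r in h3.
have h4 := resolvent_le hil ma h0 (HB Hf Hu); rewrite (resolventB hil ma) // in h4.
have h5 := nrmBC si Hu Hf.
clear hd; lra.
Qed.

Lemma resolvent_approx f e : H f -> 0 < e ->
  exists2 a, 0 < a & N (J a (J a f) - f) <= e.
Proof.
move=> Hf e0; have e2 : 0 < e / 2 by lra.
have [d d0 dP] := resolvent_cvg0 Hf e2.
have a0 : 0 < d / 2 by lra.
exists (d / 2) => //.
have h1 : N (J (d / 2) f - f) <= e / 2 by apply: dP; rewrite a0; lra.
have t1 := nrm_tri si (JH a0 (JH a0 Hf)) (JH a0 Hf) Hf.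
have t2 := resolvent_le hil ma a0 (HB (JH a0 Hf) Hf).
rewrite (resolventB hil ma) in t2; auto.
lra.
Qed.

(** [L] acts on the range of [J a] as [a^-1 (1 - J a)]. *)
Lemma resolvent2_dom a f : 0 < a -> H f -> exists g k,
  [/\ L (J a (J a f)) g, L g k & N k <= a^-1 * a^-1 * (4 * N f)].
Proof.
move=> a0 Hf; set u := J a f.
have L1 := resolventP ma a0 Hf; rewrite -/u in L1.
have Hu : H u by apply: JH.
have L2 := resolventP ma a0 Hu.
have L3 : L (a^-1 *: (u - J a u)) (a^-1 *: (a^-1 *: (f - u) - J a (a^-1 *: (f - u)))).
  have := maZ hil ma a^-1 (maB ma L1 (L_resolvent hil ma a0 L1)).
  by [].
exists (a^-1 *: (u - J a u)), (a^-1 *: (a^-1 *: (f - u) - J a (a^-1 *: (f - u)))).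
split=> //.
rewrite (resolventZ hil ma) -?scalerBr; auto.
have ai0 : 0 <= a^-1 by rewrite invr_ge0 ltW.
rewrite !(nrmZ si) ?(ger0_norm ai0); auto; rewrite -mulrA.
apply: ler_wpM2l => //; apply: ler_wpM2l => //.
have t1 := nrmB si (HB Hf Hu) (JH a0 (HB Hf Hu)).
have t2 := resolvent_le hil ma a0 (HB Hf Hu).
have t3 := nrmB si Hf Hu.
have t4 := resolvent_le hil ma a0 Hf; rewrite -/u in t4.
lra.
Qed.

Lemma iter_mul n p (f : F -> F) x : iter n (iter p f) x = iter (n * p) f x.
Proof. by elim: n => //= n ->; rewrite mulSn iterD. Qed.

(** One step of length [h] and [p.+1] steps of length [h / p.+1] both agree with
    [u - h L u] up to [h^2]; over [n.+1] steps the errors add up to order [1 / n]. *)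
Lemma euler_refine t n p u g k : 0 < t -> L u g -> L g k ->
  N (euler L t n u - euler L t (n.+1 * p.+1).-1 u) <= 2 * t ^+ 2 / n.+1%:R * N k.
Proof.
move=> t0 Lu Lg; have [Hu Hg] := ma_dom ma Lu; have [_ Hk] := ma_dom ma Lg.
pose d := t / (n.+1 * p.+1)%:R.
have np0 : (0 < n.+1 * p.+1)%N by [].
have d0 : 0 < d by rewrite divr_gt0 // ltr0n.
pose h := t / n.+1%:R; have h0 : 0 < h by rewrite divr_gt0 // ltr0n.
have dh : p.+1%:R * d = h.
  by rewrite /d /h natrM invfM mulrC -!mulrA mulVf ?mulr1 // pnatr_eq0.
have n1 : n.+1%:R * h = t by rewrite /h mulrC divfK // pnatr_eq0.
rewrite /euler prednK // -/d -/h -iter_mul.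
have iC q f : H f -> J h (iter q (J d) f) = iter q (J d) (J h f).
  by move=> Hf; elim: q => //= q <-; rewrite (resolventC hil ma); auto.
apply: le_trans (telescope hil (M := 1) ler01 _ _ _ _ _ _ _ Hu) _; auto.
- by move=> f g' Hf Hg'; exact: (resolventB hil ma).
- by move=> f g' Hf Hg'; exact: (iter_resolventB hil ma).
- by move=> f Hf; exact: (iter_resolvent_le hil ma).
- by move=> j f _ Hf; rewrite mul1r; exact: (iter_resolvent_le hil ma).
have t1 := iter_resolvent_taylor hil ma 1 h0 Lu Lg; rewrite /= mul1r in t1.
have t2 := iter_resolvent_taylor hil ma p.+1 d0 Lu Lg; rewrite dh in t2.
have t3 : N (J h u - iter p.+1 (J d) u) <= 2 * h ^+ 2 * N k.
  have -> : J h u - iter p.+1 (J d) u = (J h u - u + h *: g) - (iter p.+1 (J d) u - u + h *: g).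
    by rewrite opprD addrACA subrr addr0 opprB addrA subrK.
  have := nrmB si (HD (HB (JH h0 Hu) Hu) (HZ h Hg)) (HD (HB (iJH p.+1 d0 Hu) Hu) (HZ h Hg)).
  lra.
rewrite mul1r; apply: le_trans (ler_wpM2l (ler0n _ _) t3) _.
rewrite (_ : n.+1%:R * _ = 2 * t ^+ 2 / n.+1%:R * N k) //.
rewrite /h !expr2 -!mulrA; set x := n.+1%:R.
have x0 : x != 0 by rewrite pnatr_eq0.
by field.
Qed.

Lemma euler_H t n f : 0 < t -> H f -> H (euler L t n f).
Proof. by move=> t0 Hf; apply: iJH => //; rewrite divr_gt0 // ltr0n. Qed.
Local Hint Resolve euler_H : core.

Lemma euler_le t n f : 0 < t -> H f -> N (euler L t n f) <= N f.
Proof.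
by move=> t0 Hf; apply: (iter_resolvent_le hil ma) => //; rewrite divr_gt0 // ltr0n.
Qed.

Lemma eulerB t n f g : 0 < t -> H f -> H g ->
  euler L t n (f - g) = euler L t n f - euler L t n g.
Proof.
by move=> t0 Hf; apply: (iter_resolventB hil ma) => //; rewrite divr_gt0 // ltr0n.
Qed.

(** Each of the two schemes is compared with the one whose number of steps is the
    product of theirs. *)
Lemma euler_cauchy_dom t n p u g k : 0 < t -> L u g -> L g k ->
  N (euler L t n u - euler L t p u) <=
  2 * t ^+ 2 * N k / n.+1%:R + 2 * t ^+ 2 * N k / p.+1%:R.
Proof.
move=> t0 Lu Lg; have [Hu Hg] := ma_dom ma Lu.
have h1 := euler_refine n p t0 Lu Lg; have h2 := euler_refine p n t0 Lu Lg.
rewrite mulnC in h2; rewrite mulrAC in h1; rewrite mulrAC in h2.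
have := nrm_tri si (euler_H n t0 Hu) (euler_H (n.+1 * p.+1).-1 t0 Hu) (euler_H p t0 Hu).
rewrite [X in _ <= _ + X -> _](nrmBC si); auto.
move: h1 h2; set x := _ / n.+1%:R; set y := _ / p.+1%:R; lra.
Qed.

Lemma euler_cauchy t f : 0 < t -> H f -> ip_cauchy ip (fun n => euler L t n f).
Proof.
move=> t0 Hf e e0.
(* Four terms of size [d] make up the distance [Num.sqrt e]. *)
pose d := Num.sqrt e / 4; have s0 : 0 < Num.sqrt e by rewrite sqrtr_gt0.
have d0 : 0 < d by rewrite /d; lra.
have [a a0 af] := resolvent_approx Hf d0.
have [g [k [Lu Lg _]]] := resolvent2_dom a0 Hf.
set u := J a (J a f) in af Lu; have Hu : H u by rewrite /u; auto.
have /cvgr_lt /(_ d d0) [M _ MP] := cvg_inv_nat (2 * t ^+ 2 * N k).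
exists M => n p Mn Mp.
rewrite -(sqr_nrm si); auto; rewrite -[ltRHS](sqr_sqrtr (ltW e0)).
rewrite ltr_sqr ?nnegrE ?nrm_ge0 ?ltW //.
have h1 := euler_cauchy_dom n p t0 Lu Lg.
have h2 := MP n Mn; have h3 := MP p Mp; rewrite /= in h2 h3.
have h4 := euler_le n t0 (HB Hf Hu); rewrite eulerB // (nrmBC si Hf Hu) in h4.
have h5 := euler_le p t0 (HB Hu Hf); rewrite eulerB // in h5.
have t1 := nrm_tri si (euler_H n t0 Hf) (euler_H n t0 Hu) (euler_H p t0 Hf).
have t2 := nrm_tri si (euler_H n t0 Hu) (euler_H p t0 Hu) (euler_H p t0 Hf).
move: h1 h2 h3 af; rewrite /d; set x := _ / n.+1%:R; set y := _ / p.+1%:R; lra.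
Qed.

Lemma expsgP t f : 0 < t -> H f ->
  H (expsg H ip L t f) /\ ip_cvg ip (fun n => euler L t n f) (expsg H ip L t f).
Proof.
move=> t0 Hf; have [|v Hv vP] := hil_complete hil _ (euler_cauchy t0 Hf); first by auto.
by rewrite /expsg; case: xgetP => [w -> //|/(_ v)]; case.
Qed.

Local Notation S := (expsg H ip L).

Lemma expsg_H t f : 0 < t -> H f -> H (S t f).
Proof. by move=> t0 /(expsgP t0)[]. Qed.
Local Hint Resolve expsg_H : core.

Lemma expsg_cvg t f : 0 < t -> H f -> ip_cvg ip (fun n => euler L t n f) (S t f).
Proof. by move=> t0 /(expsgP t0)[]. Qed.

Lemma expsg_eq t f v : 0 < t -> H f -> H v ->
  ip_cvg ip (fun n => euler L t n f) v -> S t f = v.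
Proof.
move=> t0 Hf Hv h; apply: (ip_cvg_unique hil _ _ _ (expsg_cvg t0 Hf) h); auto.
Qed.

Lemma expsg_le t f : 0 < t -> H f -> N (S t f) <= N f.
Proof.
move=> t0 Hf; apply: (lim_ler (ip_cvg_nrm si _ _ (expsg_cvg t0 Hf))); auto.
by move=> n; exact: euler_le.
Qed.

Lemma expsg_lin t a f g : 0 < t -> H f -> H g -> S t (a *: f + g) = a *: S t f + S t g.
Proof.
move=> t0 Hf Hg; apply: expsg_eq; auto.
have -> : (fun n => euler L t n (a *: f + g)) = (fun n => a *: euler L t n f + euler L t n g).
  by apply/funext => n; apply: (iter_resolvent_lin hil ma) => //; rewrite divr_gt0 // ltr0n.
apply: (ip_cvgD si); auto; last exact: expsg_cvg.
by apply: (ip_cvgZ si); auto; exact: expsg_cvg.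
Qed.

Lemma expsgB t f g : 0 < t -> H f -> H g -> S t (f - g) = S t f - S t g.
Proof.
by move=> t0 Hf Hg; rewrite [f - g]addrC [_ - S t g]addrC -(scaleN1r g) -(scaleN1r (S t g)) expsg_lin.
Qed.

Lemma expsg_rate t n u g k : 0 < t -> L u g -> L g k ->
  N (euler L t n u - S t u) <= 2 * t ^+ 2 * N k / n.+1%:R.
Proof.
move=> t0 Lu Lg; have [Hu Hg] := ma_dom ma Lu.
have h1 : (fun p => N (euler L t n u - euler L t p u)) @ \oo --> N (euler L t n u - S t u).
  apply: (ip_cvg_nrm si); auto.
  rewrite /ip_cvg; set v := euler L t n u - S t u.
  have -> : (fun p => ip (euler L t n u - euler L t p u - v)
      (euler L t n u - euler L t p u - v)) =
    (fun p => ip (euler L t p u - S t u) (euler L t p u - S t u)).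
    apply/funext => p; rewrite -(ipNN si (u := euler L t p u - S t u)); auto.
    by rewrite /v opprD opprK addrACA subrr add0r opprB [_ + S t u]addrC.
  exact: expsg_cvg.
have h2 : (fun p => 2 * t ^+ 2 * N k / n.+1%:R + 2 * t ^+ 2 * N k / p.+1%:R) @ \oo -->
    2 * t ^+ 2 * N k / n.+1%:R + 0.
  by apply: cvgD; [exact: cvg_cst|exact: cvg_inv_nat].
by have := ler_lim_seq h1 h2 (fun p => euler_cauchy_dom n p t0 Lu Lg); rewrite addr0.
Qed.

Lemma expsg_gen_rate h u g k : 0 < h -> L u g -> L g k ->
  N (h^-1 *: (S h u - u) + g) <= 3 * h * N k.
Proof.
move=> h0 Lu Lg; have [Hu Hg] := ma_dom ma Lu.
have HS := expsg_H h0 Hu; have HJ := JH h0 Hu; have HJg := JH h0 Hg.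
(* One Euler step is the resolvent itself. *)
have r1 := expsg_rate 0 h0 Lu Lg; rewrite /euler /= divr1 in r1.
rewrite (nrmBC si HJ HS) in r1.
have r2 := iter_resolvent_sub hil ma 1 h0 Lg; rewrite /= mul1r in r2.
have e : h^-1 *: (S h u - u) + g = h^-1 *: (S h u - J h u) - (J h g - g).
  rewrite opprB -[g - J h g]addrC addrA; congr (_ + _).
  have -> : J h g = - h^-1 *: (J h u - u).
    by rewrite (resolvent_diff hil ma h0 Lu) scalerA mulrNN mulVf ?gt_eqF // scale1r.
  by rewrite scaleNr opprK -scalerDr addrA subrK.
rewrite e; apply: le_trans (nrmB si (HZ _ (HB HS HJ)) (HB HJg Hg)) _.
rewrite (nrmZ si); last exact: HB.
rewrite ger0_norm ?invr_ge0 ?(ltW h0) //.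
have r3 : h^-1 * N (S h u - J h u) <= 2 * h * N k.
  rewrite ler_pdivrMl //; apply: le_trans r1 _.
  by rewrite divr1 le_eqVlt; apply/orP; left; apply/eqP; ring.
lra.
Qed.

(** The scheme with [2n] steps of length [2t / 2n] is the scheme with [n] steps of
    length [t / n], applied twice. *)
Lemma expsg_double t f : 0 < t -> H f -> S (t + t) f = S t (S t f).
Proof.
move=> t0 Hf; have tt0 : 0 < t + t by rewrite addr_gt0.
have Hs := expsg_H t0 Hf; have Hss := expsg_H t0 Hs.
have He n : H (euler L t n f) by auto.
have Hee n : H (euler L t n (euler L t n f)) by auto.
apply: (ip_cvg_unique hil (u := fun n => euler L t n (euler L t n f))); auto.
  have c := expsg_cvg tt0 Hf.
  have sub : (fun n => (n.+1 + n)%N) @ \oo --> \oo.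
    by move=> B [N _ NB]; exists N => // n /= Nn; apply: NB => /=; rewrite addSn ltnW // ltnS (leq_trans Nn) // leq_addr.
  have c' : ip_cvg ip (fun n => euler L (t + t) (n.+1 + n)%N f) (S (t + t) f).
    exact: (cvg_comp _ _ sub c).
  have <- : (fun n => euler L (t + t) (n.+1 + n)%N f) = (fun n => euler L t n (euler L t n f)).
    apply/funext => n; rewrite /euler -iterD addnS.
    have -> : (t + t) / (n.+1 + n).+1%:R = t / n.+1%:R.
      have -> : (n.+1 + n).+1%:R = 2 * n.+1%:R :> R.
        by rewrite -addnS natrD [RHS]mulr_natl mulr2n.
      have -> : t + t = 2 * t by rewrite mulr_natl mulr2n.
      by rewrite invfM mulrACA mulfV // mul1r.
    by [].
  exact: c'.
apply/(ip_cvgP si Hee Hss).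
have c1 := (ip_cvgP si He Hs).1 (expsg_cvg t0 Hf).
have c2 := (ip_cvgP si (fun n => euler_H n t0 Hs) Hss).1 (expsg_cvg t0 Hs).
apply: cvg0_le (cvg0D c1 c2) => n; rewrite nrm_ge0 /=.
apply: le_trans (nrm_tri si (Hee n) (euler_H n t0 Hs) Hss) _.
rewrite lerD2r -eulerB //; apply: euler_le => //; auto.
Qed.

Lemma expsg_sym t f g :
  (forall h u v, 0 < h -> H u -> H v -> ip (J h u) v = ip u (J h v)) ->
  0 < t -> H f -> H g -> ip (S t f) g = ip f (S t g).
Proof.
move=> Js t0 Hf Hg.
have c1 := ip_cvg_ip si (fun n => euler_H n t0 Hf) (expsg_H t0 Hf) Hg (expsg_cvg t0 Hf).
have c2 := ip_cvg_ip si (fun n => euler_H n t0 Hg) (expsg_H t0 Hg) Hf (expsg_cvg t0 Hg).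
rewrite [RHS](si_sym si) //; last exact: expsg_H.
apply: (cvg_unique _ c1) => //.
have -> : (fun n => ip (euler L t n f) g) = (fun n => ip (euler L t n g) f) => //.
apply/funext => n; rewrite /euler; set h := t / _.
have h0 : 0 < h by rewrite divr_gt0 // ltr0n.
have key k u v : H u -> H v -> ip (iter k (J h) u) v = ip u (iter k (J h) v).
  move=> Hu; elim: k v => // k IH v Hv.
  by rewrite iterS Js ?IH -?iterSr //; auto.
by rewrite key // (si_sym si) //; auto.
Qed.

End OneOperator.

(** The Euler approximation converges at a rate that is uniform in [k] on the vectors
    [J_k a (J_k a f)], whose second images under [Lk k] are bounded by [4 a^-2 N f].
    With the number of steps fixed, each step converges by hypothesis. *)
Lemma trotter_kato (Lk : nat -> F -> F -> Prop) (L : F -> F -> Prop) (t : R) (f : F) :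
  (forall k, maccretive H ip (Lk k)) -> maccretive H ip L ->
  (forall h g, 0 < h -> H g -> ip_cvg ip (fun k => resolvent (Lk k) h g) (resolvent L h g)) ->
  0 < t -> H f ->
  ip_cvg ip (fun k => expsg H ip (Lk k) t f) (expsg H ip L t f).
Proof.
move=> mak ma rc t0 Hf.
have iter_cvg h n g : 0 < h -> H g ->
    ip_cvg ip (fun k => iter n (resolvent (Lk k) h) g) (iter n (resolvent L h) g).
  move=> h0 Hg; elim: n => [|n IH].
    rewrite /ip_cvg /= (_ : (fun=> _) = fun=> 0); first exact: cvg_cst.
    by apply/funext => k; rewrite subrr (ip0l si).
  have HJ k m := iter_resolvent_H (mak k) m h0 Hg.
  have HJ' m := iter_resolvent_H ma m h0 Hg.
  apply/(ip_cvgP si (fun k => HJ k n.+1) (HJ' n.+1)).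
  have h1 := (ip_cvgP si (fun k => HJ k n) (HJ' n)).1 IH.
  have h2 := (ip_cvgP si (fun k => resolvent_H (mak k) h0 (HJ' n)) (HJ' n.+1)).1 (rc h _ h0 (HJ' n)).
  apply: cvg0_le (cvg0D h1 h2) => k; rewrite nrm_ge0 /=.
  apply: le_trans (nrm_tri si _ (resolvent_H (mak k) h0 (HJ' n)) _) _.
  - exact: (HJ k n.+1).
  - exact: (HJ' n.+1).
  - rewrite lerD2r -(resolventB hil (mak k)) //.
    exact: (resolvent_le hil (mak k) h0 (HB (HJ k n) (HJ' n))).
have HS k := expsg_H (mak k) t0 Hf; have HSf := expsg_H ma t0 Hf.
apply/(ip_cvgP si HS HSf); apply/cvgrPdist_le => e e0.
have e8 : 0 < e / 8 by lra.
have [a a0 af] := resolvent_approx ma Hf e8.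
pose C := 2 * t ^+ 2 * (a^-1 * a^-1 * (4 * N f)).
have /cvgr_lt /(_ _ e8) [n _ /(_ n (leqnn n))/= nC] := cvg_inv_nat C.
set u := resolvent L a (resolvent L a f) in af.
have Hu : H u by exact: (iter_resolvent_H ma 2 a0 Hf).
pose uk k := resolvent (Lk k) a (resolvent (Lk k) a f).
have Huk k : H (uk k) by exact: (iter_resolvent_H (mak k) 2 a0 Hf).
have uku := (ip_cvgP si Huk Hu).1 (iter_cvg a 2%N f a0 Hf).
have tn : 0 < t / n.+1%:R by rewrite divr_gt0 // ltr0n.
have Heu k := euler_H (mak k) n t0 Hu; have Heuu := euler_H ma n t0 Hu.
have eu := (ip_cvgP si Heu Heuu).1 (iter_cvg _ n.+1 u tn Hu).
have /cvgr_lt /(_ _ e8) := uku; have /cvgr_lt /(_ _ e8) := eu.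
apply: filterS2 => k /= h1 h2; rewrite sub0r normrN ger0_norm ?nrm_ge0 //.
have rate L' (ma' : maccretive H ip L') :
    N (euler L' t n (resolvent L' a (resolvent L' a f)) -
       expsg H ip L' t (resolvent L' a (resolvent L' a f))) <= e / 8.
  have [g [k' [Lu Lg kN]]] := resolvent2_dom ma' a0 Hf.
  apply: le_trans (expsg_rate ma' n t0 Lu Lg) _; apply: le_trans (ltW nC).
  by rewrite ler_pM2r ?invr_gt0 ?ltr0n // ler_wpM2l // mulr_ge0 // sqr_ge0.
have r1 := rate _ (mak k); rewrite -/(uk k) in r1.
have r2 := rate _ ma; rewrite -/u in r2.
have Hsk := expsg_H (mak k) t0 (Huk k); have Hsu := expsg_H ma t0 Hu.
have Hek := euler_H (mak k) n t0 (Huk k).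
have s1 := nrm_tri si (HS k) Hsk HSf.
have s2 := nrm_tri si Hsk Hek HSf.
have s3 := nrm_tri si Hek (Heu k) HSf.
have s4 := nrm_tri si (Heu k) Heuu HSf.
have s5 := nrm_tri si Heuu Hsu HSf.
have q1 := expsg_le (mak k) t0 (HB Hf (Huk k)).
rewrite (expsgB (mak k)) // in q1.
have q2 := nrm_tri si Hf Hu (Huk k).
have q3 := euler_le (mak k) n t0 (HB (Huk k) Hu); rewrite (eulerB (mak k)) // in q3.
have q4 := expsg_le ma t0 (HB Hu Hf); rewrite (expsgB ma) // in q4.
rewrite (nrmBC si Hu (Huk k)) (nrmBC si Hf Hu) in q2.
rewrite (nrmBC si Hek Hsk) in r1.
rewrite /euler in h1.
have h1' : N (euler (Lk k) t n u - euler L t n u) < e / 8 := h1.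
have h2' : N (uk k - u) < e / 8 := h2.
lra.
Qed.

End Semigroup.

(** * Uniform boundedness *)

Section UniformBoundedness.
Context {R : realType} {F : lmodType R} {H : set F} {ip : F -> F -> R}.
Hypothesis hil : hilbert H ip.
Let si := hil_si hil.
Local Notation N := (@nrm R F ip).

Let HZ a u : H u -> H (a *: u) := @siZ _ _ _ _ si a u.
Let HD u v : H u -> H v -> H (u + v) := @siD _ _ _ _ si u v.
Let HB u v : H u -> H v -> H (u - v) := @siB _ _ _ _ si u v.
Let HN u : H u -> H (- u) := @siN _ _ _ _ si u.
Let H0 : H 0 := si_0 si.
Local Hint Resolve HZ HD HB HN H0 : core.

Definition linear_on (T : F -> F) := forall a f g, H f -> H g ->
  T (a *: f + g) = a *: T f + T g.

Lemma linear_onB T f g : linear_on T -> H f -> H g -> T (f - g) = T f - T g.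
Proof.
move=> Tl Hf Hg; rewrite [f - g]addrC [_ - T g]addrC -(scaleN1r g) -(scaleN1r (T g)).
exact: Tl.
Qed.

Lemma linear_on0 T : linear_on T -> T 0 = 0.
Proof. by move=> Tl; have := linear_onB Tl H0 H0; rewrite !subrr. Qed.

Lemma linear_onZ T a f : linear_on T -> H f -> T (a *: f) = a *: T f.
Proof. by move=> Tl Hf; rewrite -[a *: f]addr0 Tl // linear_on0 // addr0. Qed.

Lemma linear_onD T f g : linear_on T -> H f -> H g -> T (f + g) = T f + T g.
Proof. by move=> Tl Hf Hg; rewrite -[f in LHS]scale1r Tl // scale1r. Qed.

(** A maximizing vector need not exist; the factor [5 / 6] leaves room for the tail
    estimate [1 / 2] below. *)
Lemma almost_norming T M : linear_on T -> (forall f, H f -> H (T f)) ->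
  (forall f, H f -> N (T f) <= M * N f) ->
  exists c y, [/\ H y, N y <= 1, 0 <= c,
    forall f, H f -> N (T f) <= c * N f & 5 / 6 * c <= N (T y)].
Proof.
move=> Tl HT TM.
have T0 := linear_on0 Tl.
have N0 : N 0 = 0 by rewrite (nrm0 si).
pose S := [set N (T y) | y in [set y | H y /\ N y <= 1]].
have S0 : S 0.
  by exists 0; [split; rewrite ?N0 ?ler01|rewrite T0 N0].
have supS : has_sup S.
  split; first by exists 0.
  exists `|M| => _ [y [Hy y1] <-]; apply: le_trans (TM y Hy) _.
  apply: le_trans (ler_wpM2r (nrm_ge0 _) (ler_norm M)) _.
  by rewrite ler_piMr.
have c0 : 0 <= sup S by apply: ub_le_sup => //; exact: supS.2.
have cN f : H f -> N (T f) <= sup S * N f.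
  move=> Hf; have [f0|fn0] := eqVneq (N f) 0.
    by rewrite f0 mulr0; have := TM f Hf; rewrite f0 mulr0.
  have f0 : 0 < N f by rewrite lt_neqAle eq_sym fn0 nrm_ge0.
  rewrite -ler_pdivrMr // mulrC.
  have -> : (N f)^-1 * N (T f) = N (T ((N f)^-1 *: f)).
    by rewrite linear_onZ // (nrmZ si) ?ger0_norm ?invr_ge0 ?nrm_ge0 //; exact: HT.
  apply: ub_le_sup; first exact: supS.2.
  exists ((N f)^-1 *: f) => //; split; first by auto.
  by rewrite (nrmZ si) ?ger0_norm ?invr_ge0 ?nrm_ge0 // mulVf.
have [c_0|cn0] := eqVneq (sup S) 0.
  exists 0, 0; split=> //; rewrite ?N0 ?ler01 //; last by rewrite mulr0 nrm_ge0.
  by move=> f Hf; have := cN f Hf; rewrite c_0.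
have cp : 0 < sup S by rewrite lt_neqAle eq_sym cn0.
have e0 : 0 < sup S / 6 by lra.
have [_ [y [Hy y1] <-] cy] := sup_adherent e0 supS.
by exists (sup S), y; split=> //; lra.
Qed.

(** Gliding hump. If the operator norms were unbounded, add to a partial sum the
    vector [3^-k y_k] or its opposite, where [y_k] almost norms an operator whose
    norm exceeds [k 3^k]. One of the two signs makes the image at least as large as
    that of [3^-k y_k], and the later terms, of total length [3^-k / 2], are too short
    to spoil it. *)
Lemma uniform_boundedness (T : nat -> F -> F) :
  (forall n, linear_on (T n)) -> (forall n f, H f -> H (T n f)) ->
  (forall n, exists M, forall f, H f -> N (T n f) <= M * N f) ->
  (forall f, H f -> exists C, forall n, N (T n f) <= C) ->
  exists M, forall n f, H f -> N (T n f) <= M * N f.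
Proof.
move=> Tl HT Tb Tp; apply: contrapT => nM.
have [c cP] : {c : nat -> R * F & forall n, [/\ H (c n).2, N (c n).2 <= 1, 0 <= (c n).1,
    forall f, H f -> N (T n f) <= (c n).1 * N f & 5 / 6 * (c n).1 <= N (T n (c n).2)]}.
  apply: (@boolp.choice _ _ (fun n c => [/\ H c.2, N c.2 <= 1, 0 <= c.1,
    forall f, H f -> N (T n f) <= c.1 * N f & 5 / 6 * c.1 <= N (T n c.2)])) => n.
  have [M TM] := Tb n; have [c [y h]] := almost_norming (Tl n) (HT n) TM.
  by exists (c, y).
have [v vP] : {v : nat -> nat & forall k : nat, k%:R * 3 ^+ k < (c (v k)).1}.
  apply: (@boolp.choice _ _ (fun k n => k%:R * 3 ^+ k < (c n).1)) => k.
  apply: contrapT => h; apply: nM; exists (k%:R * 3 ^+ k) => n f Hf.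
  have [_ _ _ h1 _] := cP n; apply: le_trans (h1 f Hf) _.
  by rewrite ler_wpM2r ?nrm_ge0 // leNgt; apply/negP => h2; apply: h; exists n.
pose d k : R := 3^-1 ^+ k.
have d0 k : 0 < d k by rewrite exprn_gt0 // invr_gt0.
have dS k : d k.+1 = d k / 3 by rewrite /d exprS mulrC.
pose y k := d k *: (c (v k)).2.
have Hy k : H (y k) by rewrite /y; have [] := cP (v k); auto.
have yN k : N (y k) <= d k.
  have [h1 h2 _ _ _] := cP (v k).
  by rewrite /y (nrmZ si) // gtr0_norm // ler_piMr // ltW.
pose step k x := if N (T (v k) (y k)) <= N (T (v k) (x + y k)) then x + y k else x - y k.
pose x := nat_rect (fun=> F) 0 step.
have xS k : x k.+1 = step k (x k) by [].
have Hx k : H (x k).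
  by elim: k => [|k IH]; [exact: H0|]; rewrite xS /step; case: ifP => _; auto.
have Tx k : N (T (v k) (y k)) <= N (T (v k) (x k.+1)).
  rewrite xS /step; case: ifPn => //; rewrite -ltNge => h.
  have h1 := nrmB si (HT (v k) _ (HD (Hx k) (Hy k))) (HT (v k) _ (HB (Hx k) (Hy k))).
  have e : T (v k) (x k + y k) - T (v k) (x k - y k) = 2 *: T (v k) (y k).
    rewrite linear_onD // linear_onB // opprD opprK addrACA subrr add0r.
    by rewrite scaler_nat mulr2n.
  rewrite e (nrmZ si) ?ger0_norm // in h1; first lra.
  exact: HT.
have xd k : N (x k.+1 - x k) <= d k.
  rewrite xS /step; case: ifP => _; first by rewrite addrAC subrr add0r.
  by rewrite addrAC subrr add0r (nrmN si).
have xk k j : N (x (j + k)%N - x k) <= 3 / 2 * d k.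
  have h : N (x (j + k)%N - x k) <= 3 / 2 * (d k - d (j + k)%N).
    elim: j => [|j IH]; first by rewrite !subrr mulr0 (nrm0 si).
    have := nrm_tri si (Hx (j.+1 + k)%N) (Hx (j + k)%N) (Hx k).
    have := xd (j + k)%N; have := dS (j + k)%N; rewrite addSn; lra.
  by have := d0 (j + k)%N; lra.
have dcvg : d @ \oo --> (0 : R).
  by apply: cvg_expr; rewrite ger0_norm ?invr_ge0 // invf_lt1 // ltr1n.
have cx : ip_cauchy ip x.
  move=> e e0; have s0 : 0 < Num.sqrt e / 4 by rewrite divr_gt0 // sqrtr_gt0.
  have /cvgr_lt /(_ _ s0) [M _ /(_ M (leqnn M))/= MP] := dcvg.
  exists M => n p Mn Mp.
  rewrite -(sqr_nrm si); auto; rewrite -[ltRHS](sqr_sqrtr (ltW e0)).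
  rewrite ltr_sqr ?nnegrE ?nrm_ge0 ?sqrtr_ge0 //.
  have := nrm_tri si (Hx n) (Hx M) (Hx p).
  have := xk M (n - M)%N; have := xk M (p - M)%N; rewrite !subnK //.
  rewrite (nrmBC si (Hx p) (Hx M)); lra.
have [z Hz xz] := hil_complete hil Hx cx.
have zx k : N (z - x k.+1) <= d k / 2.
  have h : (fun j => N (x j - x k.+1)) @ \oo --> N (z - x k.+1).
    apply: (ip_cvg_nrm si); auto; rewrite /ip_cvg.
    have -> : (fun n => ip (x n - x k.+1 - (z - x k.+1)) (x n - x k.+1 - (z - x k.+1))) =
      (fun n => ip (x n - z) (x n - z)).
      by apply/funext => n; rewrite opprB addrA subrK.
    exact: xz.
  have h' := cvg_comp _ _ (@cvg_addnr k.+1) h.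
  apply: (lim_ler h') => j /=; have := xk k.+1 j; rewrite dS; lra.
have [C CP] := Tp z Hz.
have Cb k : k%:R / 3 <= C.
  apply: le_trans (CP (v k)).
  have [Hc c1 c0 cN c56] := cP (v k).
  have h1 := cN _ (HB Hz (Hx k.+1)); have h2 := Tx k.
  have h3 : 5 / 6 * (d k * (c (v k)).1) <= N (T (v k) (y k)).
    rewrite /y linear_onZ // (nrmZ si) ?(gtr0_norm (d0 k)) //; last exact: HT.
    by rewrite mulrCA ler_wpM2l // ltW.
  have h4 := nrmB si (HT (v k) _ Hz) (HT (v k) _ (HB Hz (Hx k.+1))).
  rewrite -linear_onB // in h4; auto; rewrite subKr in h4.
  have h5 := ler_wpM2l c0 (zx k).
  have h6 : k%:R <= d k * (c (v k)).1.
    rewrite mulrC -ler_pdivrMr // /d -exprVn invrK; exact: ltW (vP k).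
  lra.
have [n nC] : exists n : nat, C < n%:R / 3.
  have := archi_boundP (normr_ge0 (C * 3)); set n := Num.bound _ => h.
  exists n; have := ler_norm (C * 3); lra.
by have := Cb n; lra.
Qed.

End UniformBoundedness.

(** * Semigroups are limits of Euler schemes *)

Section Chernoff.
Context {R : realType} {X : countType} {m : X -> R}.
Hypothesis hil : hilbert (ell2 m) (inner m).
Context {L : (X -> R) -> (X -> R) -> Prop} {P : R -> (X -> R) -> X -> R}.
Hypothesis ma : maccretive (ell2 m) (inner m) L.
Hypothesis sg : is_exp_semigroup m L P.
Let si := hil_si hil.
Local Notation H := (ell2 m).
Local Notation N := (@nrm R (X -> R) (inner m)).
Local Notation J := (resolvent L).

Let HZ a u : H u -> H (a *: u) := @siZ _ _ _ _ si a u.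
Let HD u v : H u -> H v -> H (u + v) := @siD _ _ _ _ si u v.
Let HB u v : H u -> H v -> H (u - v) := @siB _ _ _ _ si u v.
Let JH h f : 0 < h -> H f -> H (J h f) := @resolvent_H _ _ _ _ _ ma h f.
Let PH t f : 0 <= t -> H f -> H (P t f) := @expsg_ell2 _ _ _ _ _ sg t f.
Local Hint Resolve HZ HD HB JH PH : core.

Lemma sg_linear t : 0 <= t -> linear_on (H := H) (P t).
Proof. by move=> t0 a f g Hf Hg; exact: (expsg_linear sg). Qed.

Lemma sg_cont f e : H f -> 0 < e ->
  exists2 d, 0 < d & forall s, 0 <= s < d -> N (P s f - f) < e.
Proof.
move=> Hf e0; have /cvgrPdist_lt /(_ e e0) := expsg_cont sg Hf.
rewrite near_withinE => -[d /= d0 dP]; exists d => // s /andP[s0 sd].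
have [->|sn0] := eqVneq s 0.
  by rewrite (expsg_0 sg) // subrr (nrm0 si).
have sp : 0 < s by rewrite lt_neqAle eq_sym sn0.
have := dP s; rewrite /= sub0r normrN gtr0_norm // => /(_ sd sp).
by rewrite sub0r normrN ger0_norm // nrm_ge0.
Qed.

(** Strong continuity bounds each orbit near time zero. If the operators themselves
    were unbounded there, a sequence of times tending to zero would contradict the
    uniform boundedness principle. *)
Lemma sg_bounded_near0 : exists d M, [/\ 0 < d, 1 <= M &
  forall s f, 0 <= s <= d -> H f -> N (P s f) <= M * N f].
Proof.
apply: contrapT => nb.
have [s sP] : {s : nat -> R & forall n, [/\ 0 <= s n, s n <= n.+1%:R^-1 &
    exists2 f, H f & n.+1%:R * N f < N (P (s n) f)]}.
  apply: (@boolp.choice _ _ (fun n s => [/\ 0 <= s, s <= n.+1%:R^-1 &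
    exists2 f, H f & n.+1%:R * N f < N (P s f)])) => n.
  apply: contrapT => h; apply: nb; exists n.+1%:R^-1, n.+1%:R; split.
  - by rewrite invr_gt0.
  - by rewrite ler1n.
  - move=> s f /andP[s0 s1] Hf; rewrite leNgt; apply/negP => h1.
    by apply: h; exists s; split=> //; exists f.
have [M MP] : exists M, forall n f, H f -> N (P (s n) f) <= M * N f.
  apply: (uniform_boundedness hil).
  - by move=> n; apply: sg_linear; have [] := sP n.
  - by move=> n f Hf; apply: PH => //; have [] := sP n.
  - move=> n; have [s0 _ _] := sP n; have [M MP] := expsg_bounded sg s0.
    by exists M => f Hf; exact: MP.
  - move=> f Hf; have [d d0 dP] := sg_cont Hf ltr01.
    have /cvgr_lt /(_ d d0) [n0 _ n0P] := @cvg_harmonic R.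
    exists (N f + 1 + \sum_(i < n0) N (P (s i) f)) => n.
    have sum0 : 0 <= \sum_(i < n0) N (P (s i) f) by apply: sumr_ge0 => i _; exact: nrm_ge0.
    have [nn0|nn0] := ltnP n n0.
      rewrite (bigD1 (Ordinal nn0)) //= in sum0 *.
      have : 0 <= \sum_(i < n0 | i != Ordinal nn0) N (P (s i) f).
        by apply: sumr_ge0 => i _; exact: nrm_ge0.
      have := nrm_ge0 (ip := inner m) f; lra.
    have [s0 s1 _] := sP n.
    have h1 : 0 <= s n < d by rewrite s0 (le_lt_trans s1) //; exact: n0P.
    have h2 := dP _ h1.
    have h3 := nrmD si (HB (PH s0 Hf) Hf) Hf; rewrite subrK in h3.
    lra.
have [n nM] : exists n : nat, M <= n.+1%:R.
  have := archi_boundP (normr_ge0 M); set n := Num.bound _ => h.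
  by exists n; have := ler_norm M; rewrite -natr1; lra.
have [_ _ [f Hf fn]] := sP n.
have := MP n f Hf; rewrite leNgt => /negP; apply.
by apply: le_lt_trans fn; rewrite ler_wpM2r // nrm_ge0.
Qed.

Lemma sg_bounded t : exists2 M, 0 <= M &
  forall s f, 0 <= s <= t -> H f -> N (P s f) <= M * N f.
Proof.
have [d [M [d0 M1 MP]]] := sg_bounded_near0.
have M0 : 0 <= M by lra.
have key n s f : 0 <= s <= n.+1%:R * d -> H f -> N (P s f) <= M ^+ n.+1 * N f.
  elim: n s f => [|n IH] s f; first by rewrite mul1r expr1; exact: MP.
  move=> /andP[s0 sn] Hf; have [sd|sd] := lerP s d.
    apply: le_trans (MP s f _ Hf) _; first by rewrite s0.
    by rewrite ler_wpM2r ?nrm_ge0 // ler_eXnr.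
  have s1 : 0 <= s - d by lra.
  have d1 : 0 <= d <= d by rewrite lexx ltW.
  rewrite -(subrK d s) (expsg_D sg s1 (ltW d0) Hf).
  have HPd : H (P d f) by apply: PH => //; exact: ltW.
  have sn' : 0 <= s - d <= n.+1%:R * d.
    by rewrite s1 lerBlDr; move: sn; rewrite -natr1 mulrDl mul1r.
  apply: (le_trans (IH _ _ sn' HPd)).
  by rewrite [in leRHS]exprSr -mulrA ler_wpM2l ?exprn_ge0 //; exact: MP.
have [n nt] : exists n : nat, t <= n.+1%:R * d.
  have := archi_boundP (normr_ge0 (t / d)); set n := Num.bound _ => h.
  exists n; rewrite -ler_pdivrMr //; have := ler_norm (t / d); rewrite -natr1; lra.
exists (M ^+ n.+1); first by rewrite exprn_ge0.
by move=> s f /andP[s0 st]; apply: key; rewrite s0 (le_trans st).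
Qed.

Lemma gen_cvg u g e : L u g -> 0 < e -> exists2 d, 0 < d &
  forall h, 0 < h < d -> N (h^-1 *: (P h u - u) + g) < e.
Proof.
move=> Lu e0; have [Hu Hg] := ma_dom ma Lu.
have /cvgrPdist_lt /(_ e e0) := (expsg_generator sg Hu Hg).1 Lu.
rewrite near_withinE => -[d /= d0 dP]; exists d => // h /andP[h0 hd].
have := dP h; rewrite /= sub0r normrN gtr0_norm // => /(_ hd h0).
by rewrite sub0r normrN ger0_norm // nrm_ge0.
Qed.

(** [P t] is bounded and commutes with the difference quotients that define the
    generator. *)
Lemma sg_gen t u g : 0 <= t -> L u g -> L (P t u) (P t g).
Proof.
move=> t0 Lu; have [Hu Hg] := ma_dom ma Lu.
apply/(expsg_generator sg); auto.
have [M [MP]] : exists M : R, 0 <= M /\ forall f, H f -> N (P t f) <= M * N f.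
  have [M M0 MP] := sg_bounded t; exists M; split=> // f Hf.
  by apply: MP => //; rewrite t0 lexx.
move=> MN; apply/cvgrPdist_le => e e0.
have e1 : 0 < e / (M + 1) by rewrite divr_gt0 //; lra.
have [d d0 dP] := gen_cvg Lu e1.
rewrite near_withinE; exists d => //= h /=; rewrite sub0r normrN => hd h0.
rewrite gtr0_norm // in hd.
rewrite sub0r normrN ger0_norm ?sqrtr_ge0 //.
have hP : 0 < h < d by rewrite h0.
have h0' := ltW h0; have HPh := PH h0' Hu.
have -> : (fun x => h^-1 * (P h (P t u) x - P t u x) + P t g x) =
    P t (h^-1 *: (P h u - u) + g).
  rewrite (sg_linear t0 _ (HB HPh Hu) Hg) (linear_onB (sg_linear t0) HPh Hu).
  by rewrite -(expsg_D sg t0 h0' Hu) [t + h]addrC (expsg_D sg h0' t0 Hu).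
apply: (le_trans (MN _ (HD (HZ _ (HB HPh Hu)) Hg))).
apply: le_trans (ler_wpM2l MP (ltW (dP h hP))) _.
by rewrite mulrA ler_pdivrMr; [nra|lra].
Qed.

Lemma sg_resolvent t h f : 0 <= t -> 0 < h -> H f -> P t (J h f) = J h (P t f).
Proof.
move=> t0 h0 Hf; apply/esym/(resolvent_eq hil ma) => //.
have := sg_gen t0 (resolventP ma h0 Hf).
by rewrite (linear_onZ hil _ (sg_linear t0)) ?(linear_onB (sg_linear t0)); auto.
Qed.

(** On the domain of the generator, [P h u] and [J h u] differ by [o(h)], since both
    are [u - h L u] up to [o(h)]. By telescoping, [n] steps of length [t / n] differ
    by [o(1)], using the bound on [P] over the whole interval. *)
Lemma sg_expsg t f : 0 < t -> H f -> expsg (ell2 m) (inner m) L t f = P t f.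
Proof.
move=> t0 Hf; have [M M0 MP] := sg_bounded t.
have dom u g : L u g -> expsg H (inner m) L t u = P t u.
  move=> Lu; have [Hu Hg] := ma_dom ma Lu.
  have HP : H (P t u) by apply: PH => //; exact: ltW.
  have He n : H (euler L t n u) by exact: (euler_H ma).
  apply: (expsg_eq hil ma) => //; apply/(ip_cvgP si He HP).
  apply/cvgrPdist_le => e e0.
  (* The telescoped error is [M t] times [2 e1]. *)
  pose e1 := e / (M * t + 1) / 2.
  have Mt : 0 <= M * t by rewrite mulr_ge0 // ltW.
  have e10 : 0 < e1 by rewrite !divr_gt0 //; lra.
  have [d1 d10 d1P] := gen_cvg Lu e10.
  have [d2 d20 d2P] := resolvent_cvg0 hil ma Hg e10.
  have d0 : 0 < Num.min d1 d2 by rewrite lt_min d10.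
  have /cvgr_lt /(_ _ d0) := cvg_inv_nat t.
  apply: filterS => n /=; rewrite lt_min => /andP[hd1 hd2].
  pose h := t / n.+1%:R; rewrite -/h in hd1 hd2.
  have h0 : 0 < h by rewrite divr_gt0 // ltr0n.
  have h0' := ltW h0.
  have nh : n.+1%:R * h = t by rewrite /h mulrC divfK // pnatr_eq0.
  have iterP j g' : H g' -> iter j (P h) g' = P (j%:R * h) g'.
    move=> Hg'; elim: j => [|j IH]; first by rewrite mul0r (expsg_0 sg).
    by rewrite iterS IH -(expsg_D sg h0' (mulr_ge0 (ler0n _ _) h0') Hg') -natr1 mulrDl mul1r addrC.
  rewrite sub0r normrN ger0_norm ?nrm_ge0 // (nrmBC si) //.
  rewrite /euler -/h -{1}nh -(iterP n.+1) //.
  apply: le_trans (telescope hil (S := P h) (T := J h) (n := n.+1) M0 _ _ _ _ _ _ _ Hu) _.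
  - by move=> f' Hf'; exact (PH h0' Hf').
  - by move=> f' Hf'; exact (JH h0 Hf').
  - by move=> f' g' Hf' Hg'; exact: (linear_onB (sg_linear h0')).
  - by move=> f' g' Hf' Hg'; exact: (resolventB hil ma).
  - by move=> f' Hf'; exact: sg_resolvent.
  - by move=> f' Hf'; exact: (resolvent_le hil ma).
  - move=> j f' jn Hf'; rewrite iterP //; apply: MP => //.
    by rewrite mulr_ge0 //= -nh ler_wpM2r // ler_nat ltnW.
  have HPu := PH h0' Hu; have HJg := JH h0 Hg.
  have q1 : N (P h u - J h u) <= h * (2 * e1).
    have -> : P h u - J h u = h *: ((h^-1 *: (P h u - u) + g) + (J h g - g)).
      rewrite [J h g - g]addrC addrA addrK scalerDr scalerA mulfV ?gt_eqF // scale1r.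
      have -> : h *: J h g = - (J h u - u) by rewrite (resolvent_diff hil ma h0 Lu) scaleNr opprK.
      by rewrite opprB addrA subrK.
    rewrite (nrmZ si); auto; rewrite gtr0_norm // ler_wpM2l //.
    have := nrmD si (HD (HZ h^-1 (HB HPu Hu)) Hg) (HB HJg Hg).
    have := d1P h; have := d2P h; rewrite !h0 => /(_ hd2) r1 /(_ hd1) r2; lra.
  apply: le_trans (_ : n.+1%:R * (M * (h * (2 * e1))) <= _).
    by rewrite ler_wpM2l // ler_wpM2l.
  have -> : n.+1%:R * (M * (h * (2 * e1))) = (M * t) * (2 * e1) by rewrite -nh; ring.
  have -> : 2 * e1 = e / (M * t + 1) by rewrite /e1 mulrC divfK.
  rewrite mulrA ler_pdivrMr; last lra.
  by rewrite mulrC ler_wpM2l ?(ltW e0) //; lra.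
have HP := PH (ltW t0) Hf; have HS := expsg_H hil ma t0 Hf.
apply/eqP; rewrite -subr_eq0; apply/eqP; apply: (nrm0_eq hil); auto.
apply/ler_addgt0Pr => e e0; rewrite add0r.
have e1 : 0 < e / (M + 1) by rewrite divr_gt0 //; lra.
have [u [g [Lu fu]]] := ma_dense ma Hf e1; have [Hu Hg] := ma_dom ma Lu.
have HPu := PH (ltW t0) Hu; have HSu := expsg_H hil ma t0 Hu.
have h1 := nrm_tri si HS HSu HP; rewrite {2}(dom u g Lu) in h1.
have h2 := expsg_le hil ma t0 (HB Hf Hu); rewrite (expsgB hil ma) // in h2.
have tt : 0 <= t <= t by rewrite ltW /=.
have h3 := MP t _ tt (HB Hu Hf).
rewrite (linear_onB (sg_linear (ltW t0))) // (nrmBC si Hu Hf) in h3.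
have h4 : (1 + M) * N (f - u) <= e.
  rewrite -[leRHS](divfK (lt0r_neq0 (_ : 0 < M + 1))); last lra.
  by rewrite mulrC [1 + M]addrC ler_wpM2r ?ltW //; lra.
lra.
Qed.

End Chernoff.

(** * Closed forms and their operators *)

Record closed_form (R : realType) (F : lmodType R) (H : set F)
    (ip : F -> F -> R) (V : set F) (q : F -> F -> R) : Prop := ClosedForm {
  cf_sub : forall u, V u -> H u;
  cf_si : semi_inner V q;
  cf_complete : forall u, (forall n, V (u n)) -> ip_cauchy ip u ->
    ip_cauchy q u -> exists v, [/\ V v, ip_cvg ip u v & ip_cvg q u v] }.

Definition form_op (R : realType) (F : Type) (H : set F) (ip : F -> F -> R)
    (V : set F) (q : F -> F -> R) (u g : F) : Prop :=
  [/\ V u, H g & forall v, V v -> q u v = ip g v].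

Definition form_plus (R : realType) (F : Type) (ip : F -> F -> R)
    (q : F -> F -> R) (h : R) : F -> F -> R := fun u v => ip u v + h * q u v.

Section ClosedForm.
Context {R : realType} {F : lmodType R} {H : set F} {ip : F -> F -> R}.
Hypothesis hil : hilbert H ip.
Let si := hil_si hil.
Local Notation N := (@nrm R F ip).

Section OneForm.
Context {V : set F} {q : F -> F -> R}.
Hypothesis cf : closed_form H ip V q.
Let siq := cf_si cf.
Let VH u : V u -> H u := @cf_sub _ _ _ _ _ _ cf u.
Local Hint Resolve VH : core.
Local Notation L := (form_op H ip V q).
Local Notation J := (resolvent L).

Lemma form_plus_si h : 0 <= h -> semi_inner V (form_plus ip q h).
Proof.
move=> h0; split.
- exact: (si_0 siq).
- by move=> a u v; exact: (si_lin siq).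
- by move=> u v Vu Vv; rewrite /form_plus (si_sym si (VH Vu) (VH Vv)) (si_sym siq Vu Vv).
- move=> a u v w Vu Vv Vw; rewrite /form_plus (si_linl si) ?(si_linl siq); auto; ring.
- move=> u Vu; rewrite addr_ge0 ?(si_ge0 si); auto.
  by rewrite mulr_ge0 // (si_ge0 siq).
Qed.

Lemma form_plus_complete h : 0 < h -> ip_complete V (form_plus ip q h).
Proof.
move=> h0 u Vu cu; have VB n p := siB siq (Vu n) (Vu p).
have c1 : ip_cauchy ip u.
  move=> e e0; have [M MP] := cu e e0; exists M => n p Mn Mp.
  apply: le_lt_trans (MP n p Mn Mp); rewrite lerDl mulr_ge0 ?(ltW h0) //.
  by rewrite (si_ge0 siq).
have c2 : ip_cauchy q u.
  move=> e e0; have he : 0 < h * e by rewrite mulr_gt0.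
  have [M MP] := cu _ he; exists M => n p Mn Mp.
  rewrite -(ltr_pM2l h0); apply: le_lt_trans (MP n p Mn Mp).
  by rewrite lerDr (si_ge0 si) //; auto.
have [v [Vv v1 v2]] := cf_complete cf Vu c1 c2.
by exists v => //; apply: cvg0D => //; exact: cvg0Z.
Qed.

Lemma form_solve h f : 0 < h -> H f ->
  exists2 u, V u & forall v, V v -> form_plus ip q h u v = ip f v.
Proof.
move=> h0 Hf; apply: (riesz (form_plus_si (ltW h0)) (C := ip f f)).
- exact: form_plus_complete.
- move=> a u v Vu Vv; rewrite !(si_sym si (u := f)); auto; last by apply/VH/(si_lin siq).
  by rewrite (si_linl si); auto.
- move=> u Vu; apply: le_trans (cauchy_schwarz si Hf (VH Vu)) _.
  rewrite ler_wpM2l ?(si_ge0 si) // lerDl mulr_ge0 ?(ltW h0) //.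
  by rewrite (si_ge0 siq).
Qed.

(** [u] minimizes [ip (v - f) (v - f) + h q v v]; compare it with [v = f]. *)
Lemma form_solve_close h f u : 0 < h -> V f -> V u ->
  (forall v, V v -> form_plus ip q h u v = ip f v) ->
  ip (u - f) (u - f) <= h * q f f.
Proof.
move=> h0 Vf Vu uP; have Vuf := siB siq Vu Vf.
have := uP _ Vuf; rewrite /form_plus (ipBr siq) // => e.
have -> : ip (u - f) (u - f) = h * (q u f - q u u).
  rewrite (ipBl si); auto; lra.
rewrite ler_wpM2l ?(ltW h0) //.
have := si_ge0 siq (siB siq Vu Vf); rewrite (ipBB siq) //.
have := si_ge0 siq Vu; have := si_ge0 siq Vf; lra.
Qed.

Hypothesis dense : forall f e, H f -> 0 < e -> exists2 u, V u & N (f - u) < e.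

(** Solving [u + h L u = f] is the Riesz representation of [ip f] for the inner
    product [ip + h q]. Letting [h] tend to zero shows that the domain of the operator
    is dense in that of the form. *)
Lemma form_op_maccretive : maccretive H ip L.
Proof.
split.
- by move=> u g [Vu Hg _]; auto.
- move=> a u g v k [Vu Hg ug] [Vv Hk vk]; split; [exact: (si_lin siq)|exact: (si_lin si)|].
  by move=> w Vw; rewrite (si_linl siq) // (si_linl si) ?ug ?vk; auto.
- by move=> u g [Vu Hg ug]; rewrite -ug // (si_ge0 siq).
- move=> h f h0 Hf; have [u Vu uP] := form_solve h0 Hf; exists u; split=> //.
    by apply: (siZ si); apply: (siB si); auto.
  move=> v Vv; have := uP v Vv; rewrite /form_plus => e.
  rewrite (ipZl si) ?(ipBl si); auto; last by apply: (siB si); auto.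
  by rewrite -e addrC addKr mulKf // gt_eqF.
- move=> f e Hf e0; have e2 : 0 < e / 2 by lra.
  have [v Vv fv] := dense Hf e2.
  have qv := si_ge0 siq Vv.
  (* Chosen so that [h q v v <= (e / 2)^2]. *)
  pose h := (e / 2) ^+ 2 / (q v v + 1).
  have h0 : 0 < h by rewrite divr_gt0 ?exprn_gt0 //; lra.
  have [u Vu uP] := form_solve h0 (VH Vv).
  exists u, (h^-1 *: (v - u)); split.
    split=> //; first by apply: (siZ si); apply: (siB si); auto.
    move=> w Vw; have := uP w Vw; rewrite /form_plus => e'.
    rewrite (ipZl si) ?(ipBl si); auto; last by apply: (siB si); auto.
    by rewrite -e' addrC addKr mulKf // gt_eqF.
  have h1 : N (v - u) <= e / 2.
    rewrite -ler_sqr ?nnegrE ?nrm_ge0 ?(ltW e2) // (sqr_nrm si); last by apply: (siB si); auto.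
    rewrite (ipBC si); auto; apply: le_trans (form_solve_close h0 Vv Vu uP) _.
    rewrite /h mulrAC ler_pdivrMr; last lra.
    by rewrite ler_wpM2l ?sqr_ge0 //; lra.
  by have := nrm_tri si Hf (VH Vv) (VH Vu); lra.
Qed.

Lemma form_resolventP h f : 0 < h -> H f ->
  V (J h f) /\ forall v, V v -> form_plus ip q h (J h f) v = ip f v.
Proof.
move=> h0 Hf; have ma := form_op_maccretive.
have [Vu _ uP] := resolventP ma h0 Hf; split=> // v Vv.
rewrite /form_plus uP // (ipZl si) ?(ipBl si); auto; last by apply: (siB si); auto.
by rewrite mulrA mulfV ?gt_eqF // mul1r addrC subrK.
Qed.

Lemma form_resolvent_uniq h f u : 0 < h -> H f -> V u ->
  (forall v, V v -> form_plus ip q h u v = ip f v) -> J h f = u.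
Proof.
move=> h0 Hf Vu uP; apply: (resolvent_eq hil form_op_maccretive) => //; split=> //.
  by apply: (siZ si); apply: (siB si); auto.
move=> v Vv; have := uP v Vv; rewrite /form_plus => e.
rewrite (ipZl si) ?(ipBl si); auto; last by apply: (siB si); auto.
by rewrite -e addrC addKr mulKf // gt_eqF.
Qed.

Lemma form_resolvent_sym h f g : 0 < h -> H f -> H g -> ip (J h f) g = ip f (J h g).
Proof.
move=> h0 Hf Hg.
have [Vf fP] := form_resolventP h0 Hf; have [Vg gP] := form_resolventP h0 Hg.
rewrite (si_sym si (VH Vf) Hg) -(gP _ Vf) -(fP _ Vg) /form_plus.
by rewrite (si_sym si (VH Vf) (VH Vg)) (si_sym siq Vf Vg).
Qed.

Lemma form_resolvent_inj h z : 0 < h -> H z -> J h z = 0 -> z = 0.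
Proof.
move=> h0 Hz Jz; have [Vz zP] := form_resolventP h0 Hz; rewrite Jz in zP.
have zv v : V v -> ip z v = 0.
  move=> Vv; rewrite -zP // /form_plus (ip0l si) ?(ip0l siq) ?mulr0 ?addr0 //; auto.
apply: (nrm0_eq hil) => //; apply/ler_addgt0Pr => e e0; rewrite add0r.
have [->|n0] := eqVneq (N z) 0; first exact: ltW.
have np : 0 < N z by rewrite lt_neqAle eq_sym n0 nrm_ge0.
have [v Vv zve] := dense Hz e0.
rewrite -(ler_pM2l np) -expr2 (sqr_nrm si) //.
have -> : ip z z = ip z (z - v) by rewrite (ipBr si Hz (VH Vv) Hz) (zv v Vv) subr0.
apply: le_trans (le_trans (ler_norm _) (ip_le si Hz (siB si Hz (VH Vv)))) _.
by rewrite ler_wpM2l // ltW.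
Qed.

End OneForm.

(** Let [u k] be the minimizer of [ip v v + h qk k v v - 2 ip f v]; the minimum is
    [- ip f (u k)], and it increases with [k]. The gain between [k] and [l] bounds the
    distance of [u k] to [u l] in the form with index [k]. So [u k] converges, and the
    limit solves the equation of the limiting form. *)
Lemma form_lim_resolvent (W : set F) (q : F -> F -> R) (qk : nat -> F -> F -> R)
    (h : R) (f : F) :
  form_lim W q qk -> closed_form H ip (W `&` H) q ->
  (forall f e, H f -> 0 < e -> exists2 u, (W `&` H) u & N (f - u) < e) ->
  (forall k u v, (forall n, H (u n)) -> H v -> ip_cvg ip u v -> ip_cvg (qk k) u v) ->
  (forall k, closed_form H ip H (qk k)) ->
  0 < h -> H f ->
  ip_cvg ip (fun k => resolvent (form_op H ip H (qk k)) h f)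
    (resolvent (form_op H ip (W `&` H) q) h f).
Proof.
move=> fl cf dense qc cfk h0 Hf.
have densek g e : H g -> 0 < e -> exists2 u, H u & N (g - u) < e.
  by move=> Hg e0; exists g => //; rewrite subrr (nrm0 si).
pose u k := resolvent (form_op H ip H (qk k)) h f.
have uP k := form_resolventP (cfk k) densek h0 Hf.
have Hu k : H (u k) := (uP k).1.
have sik k := fl_si fl k.
have uE k v : H v -> ip (u k) v + h * qk k (u k) v = ip f v := (uP k).2 v.
have mono k l : (k <= l)%N ->
    ip (u k - u l) (u k - u l) + h * qk k (u k - u l) (u k - u l) <= ip f (u k) - ip f (u l).
  move=> kl; rewrite (ipBB si) // (ipBB (sik k)) //.
  have := uE k _ (Hu k); have := uE k _ (Hu l); have := uE l _ (Hu l).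
  have := ler_wpM2l (ltW h0) (fl_le fl (u l) kl).
  lra.
have hq k v : 0 <= h * qk k v v by rewrite mulr_ge0 ?(ltW h0) ?(si_ge0 (sik k)).
have ip0 v : H v -> 0 <= ip v v by exact: (si_ge0 si).
pose a k := ip f (u k).
have a0 k : 0 <= a k by rewrite /a -(uE k) // addr_ge0 ?ip0.
have am k l : (k <= l)%N -> a l <= a k.
  move=> kl; have := mono k l kl; have := ip0 _ (siB si (Hu k) (Hu l)).
  have := hq k (u k - u l); rewrite /a; lra.
have ca : cvgn a.
  by apply: nonincreasing_is_cvgn => //; exists 0 => _ [k _ <-].
pose al := limn a.
have aal k : al <= a k by apply: nonincreasing_cvgn_ge.
have cu : ip_cauchy ip u.
  move=> e e0.
  have /cvgr_lt /(_ (al + e)) := ca; rewrite ltrDl => /(_ e0) [M _ MP].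
  exists M; suff key n p : (n <= p)%N -> (M <= n)%N -> ip (u n - u p) (u n - u p) < e.
    move=> n p Mn Mp; have [np|pn] := leqP n p; first exact: key.
    by rewrite (ipBC si) //; apply: key => //; exact: ltnW.
  move=> np Mn; have := mono n p np; have := hq n (u n - u p).
  have := MP n Mn; have := aal p; rewrite /= -/(a n) -/(a p); lra.
have [w Hw uw] := hil_complete hil Hu cu.
have wE k : h * qk k (u k - w) (u k - w) <= a k - al.
  have c1 : ip_cvg (qk k) (fun l => u k - u l) (u k - w).
    apply: (qc k _ _ (fun n => siB si (Hu k) (Hu n)) (siB si (Hu k) Hw)).
    have e : (fun n => ip (u k - u n - (u k - w)) (u k - u n - (u k - w))) =
      (fun n => ip (u n - w) (u n - w)).
      apply/funext => n; rewrite -(ipNN si (siB si (Hu n) Hw)).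
      by rewrite opprD opprK addrACA subrr add0r opprB [_ + w]addrC.
    by rewrite /ip_cvg e.
  have c5 := cvg_scale h (ip_cvg_sqr (sik k) (fun=> I) I c1).
  have c6 := cvg_comp _ _ (@cvg_addnr k) c5.
  apply: (lim_ler c6) => l /=.
  have kl : (k <= l + k)%N by rewrite leq_addl.
  have := mono k _ kl; have := ip0 _ (siB si (Hu k) (Hu (l + k)%N)).
  by have := aal (l + k)%N; rewrite /a; lra.
have qw k : h * qk k w w <= 4 * a 0%N.
  have e1 := uE k _ (Hu k); have e2 := wE k; have e3 := ip0 _ (Hu k).
  have e4 := am 0%N k (leq0n k); have e5 := hq k (u k + (u k - w)).
  have e6 : qk k w w = 2 * qk k (u k) (u k) + 2 * qk k (u k - w) (u k - w) -
      qk k (u k + (u k - w)) (u k + (u k - w)).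
    rewrite -[in LHS](subKr (u k) w) (ipBB (sik k) (v := u k - w)) //.
    by rewrite (ipDD (sik k) (v := u k - w)) //; ring.
  have e7 : al >= 0 by apply: limr_ge => //; exact: nearW.
  rewrite e6; rewrite /a in e1 e2 e4 *; lra.
have Ww : W w.
  apply/(fl_dom fl); exists (h^-1 * (4 * a 0%N)) => k.
  by rewrite ler_pdivlMl.
suff -> : resolvent (form_op H ip (W `&` H) q) h f = w by [].
apply: (form_resolvent_uniq cf dense h0 Hf) => [|v [Wv Hv]]; first by split.
have l1 := ip_cvg_ip si Hu Hw Hv uw.
have l2 := fl_cvg fl Ww Wv.
have l3 : (fun k => h * qk k (u k - w) v) @ \oo --> (0 : R).
  apply/norm_cvg0P.
  have d1 : (fun k => a k - al) @ \oo --> (0 : R).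
    by rewrite -(subrr al); apply: cvgB => //; exact: cvg_cst.
  have d2 := sqrt_cvg0 (cvg0Z h d1).
  have d3 := cvg0Z (nrm (ip := q) v) d2.
  apply: cvg0_le d3 => k; rewrite normr_ge0 /=.
  have r1 : 0 <= a k - al by rewrite subr_ge0.
  rewrite -ler_sqr ?nnegrE ?mulr_ge0 ?sqrtr_ge0 ?nrm_ge0 ?normr_ge0 ?(ltW h0) //.
  rewrite real_normK ?num_real // !exprMn (sqr_nrm (fl_semi_inner fl)) //.
  rewrite sqr_sqrtr ?mulr_ge0 ?(ltW h0) // [leRHS]mulrC.
  have r2 := cauchy_schwarz (sik k) (I : setT (u k - w)) (I : setT v).
  have r3 := fl_le_lim fl k Wv.
  have r4 := wE k; have r5 := si_ge0 (sik k) (I : setT v).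
  have r6 := si_ge0 (sik k) (I : setT (u k - w)).
  apply: (@le_trans _ _ (h * (h * qk k (u k - w) (u k - w)) * qk k v v)).
    rewrite expr2 -!mulrA ler_wpM2l ?(ltW h0) // ler_wpM2l ?(ltW h0) //.
  apply: ler_pM => //; first by rewrite mulr_ge0 ?(ltW h0).
  by rewrite ler_wpM2l ?(ltW h0).
have l4 : (fun k => ip (u k) v + (h * qk k w v + h * qk k (u k - w) v)) @ \oo -->
    ip w v + (h * q w v + 0).
  by apply: cvgD => //; apply: cvgD => //; exact: cvg_scale.
rewrite addr0 in l4; apply: (cvg_unique _ l4) => //.
rewrite (_ : (fun k => _) = fun=> ip f v); first exact: cvg_cst.
apply/funext => k; rewrite -(uE k) // -mulrDr -(ipDl (sik k)) //.
by rewrite [w + _]addrC subrK.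
Qed.

End ClosedForm.

(** * The forms of a graph *)

Section GraphForms.
Context {R : realType} {X : countType} {m : X -> R} (G : graph R X).
Context {A : nat -> {fset X}}.
Hypothesis m_gt0 : forall x, 0 < m x.
Hypothesis exA : exhausts A.
Implicit Types f g u v : X -> R.

Let m_ge0 x : 0 <= m x := ltW (m_gt0 x).
Local Notation H := (ell2 m).
Local Notation N := (@nrm R (X -> R) (inner m)).

Lemma ell2_hilbert : hilbert H (inner m).
Proof.
split; [exact: (ell2_si m_ge0 exA)| |exact: (ell2_complete m_gt0 exA)].
move=> u Hu u0; apply/funext => x; apply/eqP; rewrite -sqrf_eq0.
have := ell2_coord m_ge0 exA x Hu; rewrite u0 pmulr_lle0 // => h.
by rewrite eq_le h sqr_ge0.
Qed.
Let hil := ell2_hilbert.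
Let si := hil_si hil.
Let fl := energy_form_lim G exA.

Lemma Cc_lin a f g : Cc f -> Cc g -> Cc (a *: f + g).
Proof.
move=> hf hg; apply: (@sub_finite_set _ _ ([set x | f x != 0] `|` [set x | g x != 0])).
  move=> x /=; have [f0|fn0] := eqVneq (f x) 0; last by left.
  have [g0|gn0] := eqVneq (g x) 0; last by right.
  rewrite !fctE; change (a *: f x) with (a * f x).
  by rewrite f0 g0 mulr0 addr0 eqxx.
by rewrite finite_setU.
Qed.

Lemma Cc_delta (x : X) : Cc ((fun y => (y == x)%:R) : X -> R).
Proof.
apply: (@sub_finite_set _ _ [set x]); last exact: finite_set1.
by move=> y /=; have [->|_] := eqVneq y x; rewrite ?mulr0n ?eqxx.
Qed.

Lemma restrict0_Cc B f : Cc (restrict0 B f).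
Proof.
apply: (@sub_finite_set _ _ [set` B]); last exact: finite_fset.
by move=> y; rewrite /restrict0 /=; case: ifP => // _; rewrite eqxx.
Qed.

Lemma Cc_dense f e : H f -> 0 < e -> exists2 u, Cc u & N (f - u) < e.
Proof.
move=> Hf e0; have h := ell2_trunc m_gt0 exA Hf.
have /cvgr_lt /(_ _ e0) [k _ /(_ k (leqnn k))/= kP] := sqrt_cvg0 h.
exists (restrict0 (A k) f); first exact: restrict0_Cc.
have Hr : H (restrict0 (A k) f) by apply: (Cc_ell2 m_ge0 exA); exact: restrict0_Cc.
by rewrite (nrmBC si Hf Hr).
Qed.

(** From [(a - b)^2 <= 2 a^2 + 2 b^2], by symmetry of the weights. *)
Lemma fin_energy_le (B : {fset X}) f : fin_energy G B f f <=
  \sum_(x <- B) (2 * (\sum_(y <- B) edge G x y) + killing G x) * f x ^+ 2.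
Proof.
rewrite /fin_energy.
have -> : \sum_(x <- B) (2 * (\sum_(y <- B) edge G x y) + killing G x) * f x ^+ 2 =
    2^-1 * (4 * \sum_(x <- B) \sum_(y <- B) f x ^+ 2 * edge G x y) +
    fin_inner (killing G) B f f.
  rewrite mulrA [2^-1 * 4](_ : _ = 2); last by field.
  rewrite mulr_sumr /fin_inner -big_split /=; apply: eq_bigr => x _.
  by rewrite -mulr_sumr; ring.
rewrite lerD2r ler_wpM2l ?invr_ge0 //.
pose s := \sum_(x <- B) \sum_(y <- B) f x ^+ 2 * edge G x y; rewrite -/s.
have s' : \sum_(x <- B) \sum_(y <- B) f y ^+ 2 * edge G x y = s.
  rewrite exchange_big /=; apply: eq_bigr => x _; apply: eq_bigr => y _.
  by rewrite edge_sym.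
have -> : 4 * s = 2 * (s + s) by ring.
rewrite -{2}s' /s /fin_inner big_fsetM -big_split /= mulr_sumr; apply: ler_sum => x _.
rewrite -big_split /= mulr_sumr; apply: ler_sum => y _.
rewrite /grad /edge2 /= -mulrDl mulrA ler_wpM2r ?edge_ge0 //.
have := sqr_ge0 (f x + f y); rewrite -expr2 sqrrD sqrrB; lra.
Qed.

Definition degree x : R := fine (\esum_(y in [set: X]) (edge G x y)%:E).

Lemma degree_le x (B : {fset X}) : \sum_(y <- B) edge G x y <= degree x.
Proof.
have es0 : (0 <= \esum_(y in [set: X]) (edge G x y)%:E)%E.
  by apply: esum_ge0 => y _; rewrite lee_fin edge_ge0.
rewrite -lee_fin /degree fineK; last by rewrite ge0_fin_numE // edge_summable.
by apply: esum_fin_le => y; exact: edge_ge0.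
Qed.

Lemma degree_ge0 x : 0 <= degree x.
Proof. by apply: le_trans (degree_le x fset0); rewrite big_seq_fset0. Qed.

(** Summability of the edge weights makes the weighted degrees finite, and these control
    the energy of [f]. *)
Lemma Cc_finite_energy f : Cc f -> finite_energy G f.
Proof.
move=> Cf; pose w x := 2 * degree x + killing G x.
have w0 x : 0 <= w x by rewrite addr_ge0 ?killing_ge0 // mulr_ge0 // degree_ge0.
have [M MP] := (fl_dom (ell2_form_lim w0 exA) f).1 (Cc_ell2 w0 exA Cf).
apply/(fl_dom fl); exists M => k; apply: le_trans (fin_energy_le (A k) f) _.
apply: le_trans (MP k); apply: ler_sum => x _.
rewrite -expr2 mulrC ler_wpM2l ?sqr_ge0 // lerD2r ler_pM2l //.
exact: degree_le.
Qed.

Lemma Cc_domN f : Cc f -> domN G m f.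
Proof. by move=> Cf; split; [exact: Cc_finite_energy|exact: (Cc_ell2 m_ge0 exA)]. Qed.

Lemma ip_cvg_fin_energy (B : {fset X}) (u : nat -> X -> R) v :
  (forall n, H (u n)) -> H v -> ip_cvg (inner m) u v -> ip_cvg (fin_energy G B) u v.
Proof.
move=> Hu Hv uv.
have c x : (fun n => (u n - v) x) @ \oo --> (0 : R).
  have := ell2_cvg_coord m_gt0 exA (x := x) Hu Hv uv => h.
  by rewrite -(subrr (v x)); apply: cvgB => //; exact: cvg_cst.
rewrite /ip_cvg; have -> : (0 : R) = 2^-1 * (\sum_(xy <- (B `*` B)%fset) (0 : R)) + \sum_(x <- B) (0 : R).
  by rewrite !big1 // mulr0 addr0.
apply: cvgD.
  apply: cvg_scale; apply: cvg_fsum => -[x y].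
  rewrite -[X in _ --> X](mul0r (edge2 G (x, y))); apply: cvgM; last exact: cvg_cst.
  have d : (fun n => grad (u n - v) (x, y)) @ \oo --> (0 : R).
    by rewrite -(subrr 0); apply: cvgB; exact: c.
  by rewrite -(mul0r 0); apply: cvgM.
apply: cvg_fsum => x; rewrite -[X in _ --> X](mul0r (killing G x)).
apply: cvgM; last exact: cvg_cst.
by rewrite -(mul0r 0); apply: cvgM.
Qed.

(** A Cauchy sequence converges in ell2, hence at every vertex, hence in the energy of
    every finite piece. *)
Lemma domN_closed : closed_form H (inner m) (domN G m) (energy G).
Proof.
have se := fl_semi_inner fl.
split.
- by move=> u [].
- split.
  + by split; [exact: (si_0 se)|exact: (si_0 si)].
  + by move=> a u v [u1 u2] [v1 v2]; split; [exact: (si_lin se)|exact: (si_lin si)].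
  + by move=> u v [u1 _] [v1 _]; exact: (si_sym se).
  + by move=> a u v w [u1 _] [v1 _] [w1 _]; exact: (si_linl se).
  + by move=> u [u1 _]; exact: (si_ge0 se).
- move=> u Vu c1 c2.
  have Hu n : H (u n) := (Vu n).2.
  have [v Hv uv] := hil_complete hil Hu c1.
  have [|v1 v2] := fl_complete fl (fun n => (Vu n).1) c2 (v := v).
    by move=> k; exact: ip_cvg_fin_energy.
  by exists v.
Qed.

Lemma domN_dense f e : H f -> 0 < e -> exists2 u, domN G m u & N (f - u) < e.
Proof.
by move=> Hf e0; have [u Cu fu] := Cc_dense Hf e0; exists u => //; exact: Cc_domN.
Qed.

Let sE := form_plus_si hil domN_closed ler01.

Lemma form_normE f : domN G m f ->
  form_norm G m f = nrm (ip := form_plus (inner m) (energy G) 1) f.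
Proof.
move=> [_ Hf]; rewrite /form_norm /nrm /form_plus mul1r addrC.
by congr (Num.sqrt (_ + _)); exact: (sqr_nrm si Hf).
Qed.

Lemma domD_domN f : domD G m f -> domN G m f. Proof. by case. Qed.

Lemma Cc_domD f : Cc f -> domD G m f.
Proof.
move=> Cf; split; first exact: Cc_domN.
move=> e e0; exists f => //; rewrite subrr form_normE; last exact: (si_0 sE).
by rewrite (nrm0 sE).
Qed.

Lemma domD_lin a f g : domD G m f -> domD G m g -> domD G m (a *: f + g).
Proof.
move=> [Vf fP] [Vg gP]; split; first exact: (si_lin sE).
move=> e e0; have e1 : 0 < e / 2 / (`|a| + 1).
  by rewrite !divr_gt0 // ltr_wpDl.
have e2 : 0 < e / 2 by lra.
have [phi Cp fp] := fP _ e1; have [psi Cq gq] := gP _ e2.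
exists (a *: phi + psi); first exact: Cc_lin.
have Vp := Cc_domN Cp; have Vq := Cc_domN Cq.
rewrite form_normE in fp; last exact: (siB sE).
rewrite form_normE in gq; last exact: (siB sE).
have -> : a *: f + g - (a *: phi + psi) = a *: (f - phi) + (g - psi).
  by rewrite opprD addrACA scalerBr.
rewrite form_normE; last by apply: (si_lin sE); exact: (siB sE).
apply: le_lt_trans (nrmD sE _ _) _.
- by apply: (siZ sE); exact: (siB sE).
- exact: (siB sE).
rewrite (nrmZ sE); last exact: (siB sE).
move: fp; rewrite ltr_pdivlMr; last by rewrite ltr_wpDl.
move: gq; have := nrm_ge0 (ip := form_plus (inner m) (energy G) 1) (f - phi).
set x := nrm _; set y := nrm _; rewrite mulrDr mulr1 mulrC; lra.
Qed.

(** The Dirichlet domain is closed in the complete space [domN]. *)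
Lemma domD_closed : closed_form H (inner m) (domD G m) (energy G).
Proof.
have sN := cf_si domN_closed.
split.
- by move=> u [[]].
- split.
  + have C0 : @Cc R X 0 by apply: (@sub_finite_set _ _ set0) => // x /=; rewrite eqxx.
    exact: Cc_domD C0.
  + exact: domD_lin.
  + by move=> u v [u1 _] [v1 _]; exact: (si_sym sN).
  + by move=> a u v w [u1 _] [v1 _] [w1 _]; exact: (si_linl sN).
  + by move=> u [u1 _]; exact: (si_ge0 sN).
- move=> u Vu c1 c2.
  have Nu n : domN G m (u n) := (Vu n).1.
  have [v [Vv v1 v2]] := cf_complete domN_closed Nu c1 c2.
  exists v; split=> //; split=> // e e0.
  have e2 : 0 < e / 2 by lra.
  have vE : ip_cvg (form_plus (inner m) (energy G) 1) u v.
    by apply: cvg0D => //; exact: cvg0Z.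
  have /cvgr_lt /(_ _ e2) [k _ /(_ k (leqnn k))/= kP] := (ip_cvgP sE Nu Vv).1 vE.
  have [phi Cp up] := (Vu k).2 _ e2; have Vp := Cc_domN Cp.
  exists phi => //; rewrite form_normE; last exact: (siB sE).
  rewrite form_normE in up; last exact: (siB sE).
  have := nrm_tri sE Vv (Nu k) Vp; rewrite (nrmBC sE Vv (Nu k)).
  move: kP up; set x := nrm _; set y := nrm _; set z := nrm _; lra.
Qed.

Lemma domD_dense f e : H f -> 0 < e -> exists2 u, domD G m u & N (f - u) < e.
Proof.
by move=> Hf e0; have [u Cu fu] := Cc_dense Hf e0; exists u => //; exact: Cc_domD.
Qed.

Lemma fin_energy_closed (B : {fset X}) : closed_form H (inner m) H (fin_energy G B).
Proof.
have sB := fin_energy_si G B.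
split=> //.
- split.
  + exact: (si_0 si).
  + by move=> a u v; exact: (si_lin si).
  + by move=> u v _ _; exact: (si_sym sB).
  + by move=> a u v w _ _ _; exact: (si_linl sB).
  + by move=> u _; exact: (si_ge0 sB).
- move=> u Hu c1 _; have [v Hv uv] := hil_complete hil Hu c1.
  by exists v; split=> //; exact: ip_cvg_fin_energy.
Qed.

Lemma ell2_dense f e : H f -> 0 < e -> exists2 u, H u & N (f - u) < e.
Proof. by move=> Hf e0; exists f => //; rewrite subrr (nrm0 si). Qed.

Definition neumann_op := form_op H (inner m) (domN G m) (energy G).
(** The form of a finite piece is taken on all of ell2, so that its semigroup is the
    identity away from the piece and all forms live on the same space. *)
Definition piece_op (B : {fset X}) := form_op H (inner m) H (fin_energy G B).

Lemma neumann_op_maccretive : maccretive H (inner m) neumann_op.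
Proof. exact: (form_op_maccretive hil domN_closed domN_dense). Qed.

Lemma opD_maccretive : maccretive H (inner m) (opD G m).
Proof. exact: (form_op_maccretive hil domD_closed domD_dense). Qed.

Lemma piece_op_maccretive B : maccretive H (inner m) (piece_op B).
Proof. exact: (form_op_maccretive hil (fin_energy_closed B) ell2_dense). Qed.

Lemma piece_resolvent_cvg h f : 0 < h -> H f ->
  ip_cvg (inner m) (fun k => resolvent (piece_op (A k)) h f) (resolvent neumann_op h f).
Proof.
move=> h0 Hf; apply: (form_lim_resolvent hil fl domN_closed domN_dense) => //.
- by move=> k u v; exact: ip_cvg_fin_energy.
- by move=> k; exact: fin_energy_closed.
Qed.

(** The forms of the pieces increase to the Neumann form, so their resolvents converge,
    and resolvent convergence passes to the semigroups. *)
Lemma piece_expsg_cvg t f : 0 < t -> H f ->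
  ip_cvg (inner m) (fun k => expsg H (inner m) (piece_op (A k)) t f)
    (expsg H (inner m) neumann_op t f).
Proof.
move=> t0 Hf; apply: (trotter_kato hil (fun k => piece_op_maccretive (A k)) neumann_op_maccretive) => //.
exact: piece_resolvent_cvg.
Qed.

End GraphForms.

Arguments neumann_op {R X} m G.
Arguments piece_op {R X} m G B.

(** * Semigroups of bounded generators *)

Lemma iter_binomial (R : realType) (F : lmodType R) (A : F -> F) (h : R) (n : nat) (f : F) :
  (forall a u v, A (a *: u + v) = a *: A u + A v) ->
  iter n (fun u => u - h *: A u) f =
  \sum_(j < n.+1) ('C(n, j)%:R * (- h) ^+ j) *: iter j A f.
Proof.
move=> Al; elim: n f => [|n IH] f.
  by rewrite big_ord1 /= bin0 expr0 mulr1 scale1r.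
rewrite iterSr IH.
have A0 : A 0 = 0.
  by have := Al (-1) 0 0; rewrite scaler0 addr0 scaleN1r addNr.
have iA j u v : iter j A (u - h *: v) = iter j A u - h *: iter j A v.
  elim: j => //= j ->; rewrite addrC -scaleNr Al scaleNr addrC //.
under eq_bigr do rewrite iA -iterSr scalerBr scalerA.
rewrite sumrB.
have -> : \sum_(j < n.+1) ('C(n, j)%:R * (- h) ^+ j) *: iter j A f =
    \sum_(j < n.+2) ('C(n, j)%:R * (- h) ^+ j) *: iter j A f.
  by rewrite [RHS]big_ord_recr /= bin_small // mulr0n mul0r scale0r addr0.
rewrite big_ord_recl [in RHS]big_ord_recl !bin0 -addrA -sumrB; congr (_ + _).
apply: eq_bigr => i _; rewrite lift0 binS natrD mulrDl scalerDl; congr (_ + _).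
by rewrite -scaleNr; congr (_ *: _); rewrite exprS; ring.
Qed.

Lemma expR_partial_le (R : realType) (x : R) n : 0 <= x ->
  \sum_(j < n) x ^+ j / j`!%:R <= expR x.
Proof.
move=> x0.
have cv := is_cvg_series_exp_coeff x.
have nd : nondecreasing_seq (series (exp_coeff x)).
  apply/nondecreasing_seqP => k; rewrite /series /= big_nat_recr //= lerDl.
  by rewrite /exp_coeff mulr_ge0 ?exprn_ge0 ?invr_ge0.
have := nondecreasing_cvgn_le nd cv n.
by rewrite /series /= big_mkord.
Qed.

(** [n ^_ j / n^j] is the product of the [1 - i / n] for [i < j], hence at least
    [1 - j^2 / n]. *)
Lemma binomial_ratio (R : realType) (n j : nat) : (0 < n)%N -> (j <= n)%N ->
  0 <= (j`!%:R^-1 - 'C(n, j)%:R / n%:R ^+ j : R) <= j%:R ^+ 2 / n%:R / j`!%:R.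
Proof.
move=> n0 jn.
have nR : 0 < n%:R :> R by rewrite ltr0n.
have fR : 0 < j`!%:R :> R by rewrite ltr0n fact_gt0.
have -> : 'C(n, j)%:R / n%:R ^+ j = (n ^_ j)%:R / n%:R ^+ j / j`!%:R :> R.
  by rewrite -bin_ffact natrM mulrAC mulfK // gt_eqF.
have -> : j`!%:R^-1 - (n ^_ j)%:R / n%:R ^+ j / j`!%:R =
    (1 - (n ^_ j)%:R / n%:R ^+ j) / j`!%:R :> R by rewrite mulrBl mul1r.
have key : 0 <= (1 - (n ^_ j)%:R / n%:R ^+ j : R) <= j%:R ^+ 2 / n%:R.
  elim: j jn {fR} => [|j IH] jn.
    by rewrite ffactn0 expr0 divr1 subrr expr0n mul0r lexx.
  have /andP[h1 h2] := IH (ltnW jn).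
  have -> : (n ^_ j.+1)%:R / n%:R ^+ j.+1 = (n ^_ j)%:R / n%:R ^+ j * (1 - j%:R / n%:R) :> R.
    rewrite ffactnSr natrM natrB ?(ltnW jn) // exprSr invfM mulrACA; congr (_ * _).
    by rewrite mulrBl mulfV ?gt_eqF.
  have a0 : 0 <= (n ^_ j)%:R / n%:R ^+ j :> R by rewrite mulr_ge0 ?invr_ge0 ?exprn_ge0.
  have b0 : 0 <= j%:R / n%:R :> R by rewrite mulr_ge0 ?invr_ge0.
  have b1 : j%:R / n%:R <= 1 :> R by rewrite ler_pdivrMr // mul1r ler_nat ltnW.
  have -> : j.+1%:R ^+ 2 / n%:R = j%:R ^+ 2 / n%:R + j%:R / n%:R + j%:R / n%:R + n%:R^-1 :> R.
    by rewrite -natr1; field; rewrite gt_eqF.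
  have i0 : 0 <= n%:R^-1 :> R by rewrite invr_ge0.
  move: h1 h2 a0 b0 b1 i0; set a := _ / n%:R ^+ j; set b := j%:R / n%:R; set c := _ / n%:R.
  set d := n%:R^-1; move=> *; apply/andP; split; nra.
move: key => /andP[k1 k2]; apply/andP; split; first by rewrite mulr_ge0 ?invr_ge0.
by rewrite ler_pM2r ?invr_gt0.
Qed.

Section BoundedGenerator.
Context {R : realType} {F : lmodType R} {H : set F} {ip : F -> F -> R}.
Hypothesis hil : hilbert H ip.
Let si := hil_si hil.
Local Notation N := (@nrm R F ip).
Context {L : F -> F -> Prop} {A : F -> F} {K : R}.
Hypothesis ma : maccretive H ip L.
Hypothesis LA : forall u g, H u -> L u g <-> g = A u.
Hypothesis A_lin : forall a u v, A (a *: u + v) = a *: A u + A v.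
Hypothesis A_le : forall u, H u -> N (A u) <= K * N u.
Hypothesis K0 : 0 <= K.
Local Notation J := (resolvent L).

Let HZ a u : H u -> H (a *: u) := @siZ _ _ _ _ si a u.
Let HD u v : H u -> H v -> H (u + v) := @siD _ _ _ _ si u v.
Let HB u v : H u -> H v -> H (u - v) := @siB _ _ _ _ si u v.
Let HA u : H u -> H (A u).
Proof. by move=> Hu; have [] := ma_dom ma ((LA _ Hu).2 erefl). Qed.
Let JH h f : 0 < h -> H f -> H (J h f) := @resolvent_H _ _ _ _ _ ma h f.
Local Hint Resolve HZ HD HB HA JH : core.

Let iAH j u : H u -> H (iter j A u).
Proof. by move=> Hu; elim: j => //= j; exact: HA. Qed.

Lemma A_resolvent h u : 0 < h -> H u -> A (J h u) = J h (A u).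
Proof.
move=> h0 Hu; apply/esym/(LA _ (JH h0 Hu)).
by apply: (L_resolvent hil ma) => //; apply/(LA _ Hu).
Qed.

Lemma iterA_le j u : H u -> N (iter j A u) <= K ^+ j * N u.
Proof.
move=> Hu; elim: j => [|j IH]; first by rewrite mul1r.
by rewrite iterS exprS -mulrA; apply: le_trans (A_le (iAH j Hu)) _; rewrite ler_wpM2l.
Qed.

Lemma AB u v : A (u - v) = A u - A v.
Proof. by rewrite addrC -scaleN1r A_lin scaleN1r addrC. Qed.

Lemma explicit_euler_le h j u : 0 < h -> H u ->
  N (iter j (fun v => v - h *: A v) u) <= (1 + h * K) ^+ j * N u.
Proof.
move=> h0 Hu.
have Hi i : H (iter i (fun v => v - h *: A v) u).
  by elim: i => //= i Hi; auto.
elim: j => [|j IH]; first by rewrite mul1r.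
rewrite iterS; apply: le_trans (nrmB si (Hi j) (HZ h (HA (Hi j)))) _.
rewrite (nrmZ si) ?gtr0_norm //; auto.
have := ler_wpM2l (ltW h0) (A_le (Hi j)).
have hK : 0 <= 1 + h * K by rewrite addr_ge0 // mulr_ge0 // ltW.
have := ler_wpM2l hK IH.
rewrite exprS; set x := N _; set y := N _; set z := N _; nra.
Qed.

(** One explicit and one implicit step agree up to [h^2 A (A u)]; the factor [e^(tK)]
    bounds the powers of the explicit step. *)
Lemma explicit_implicit t n u : 0 < t -> H u ->
  N (iter n.+1 (fun v => v - (t / n.+1%:R) *: A v) u - euler L t n u) <=
  expR (t * K) * t ^+ 2 * N (A (A u)) / n.+1%:R.
Proof.
move=> t0 Hu; set h := t / n.+1%:R.
have h0 : 0 < h by rewrite divr_gt0 // ltr0n.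
have hK : 0 <= h * K by rewrite mulr_ge0 // ltW.
have e0 := expR_ge0 (t * K).
pose S v := v - h *: A v.
have SB f g : S (f - g) = S f - S g.
  by rewrite /S AB scalerBr !opprD opprK addrACA.
apply: le_trans (telescope hil (S := S) (T := J h) (n := n.+1) e0 _ _ _ _ _ _ _ Hu) _.
- by move=> f Hf; rewrite /S; auto.
- by move=> f Hf; auto.
- by move=> f g _ _; exact: SB.
- by move=> f g Hf Hg; exact: (resolventB hil ma).
- move=> f Hf; rewrite /S A_resolvent // (resolventB hil ma) ?(resolventZ hil ma) //; auto.
- by move=> f Hf; exact: (resolvent_le hil ma).
- move=> j f jn Hf; apply: le_trans (explicit_euler_le j h0 Hf) _.
  rewrite ler_wpM2r ?nrm_ge0 //.
  have h1 : (1 + h * K) ^+ j <= expR (h * K) ^+ j.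
    by rewrite lerXn2r ?nnegrE ?expR_ge0 ?expR_ge1Dx ?addr_ge0.
  apply: le_trans h1 _; rewrite -expRM_natl ler_expR.
  have -> : t * K = n.+1%:R * (h * K) by rewrite mulrA [n.+1%:R * _]mulrC divfK // pnatr_eq0.
  by rewrite ler_wpM2r // ler_nat ltnW.
have -> : S u - J h u = - h *: (A u - J h (A u)).
  have := resolvent_diff hil ma h0 ((LA _ Hu).2 erefl) => e.
  by rewrite /S scalerBr -e scaleNr opprB [RHS]addrC addrAC.
rewrite (nrmZ si) ?normrN ?gtr0_norm //; auto.
have Lg := (LA _ (HA Hu)).2 erefl.
have := iter_resolvent_sub hil ma 1 h0 Lg; rewrite /= mul1r.
rewrite (nrmBC si); auto => q.
have q2 := ler_wpM2l (ltW h0) q.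
apply: le_trans (ler_wpM2l (ler0n _ _) (ler_wpM2l e0 q2)) _.
rewrite le_eqVlt; apply/orP; left; apply/eqP.
rewrite /h; set x := n.+1%:R; have x0 : x != 0 by rewrite pnatr_eq0.
by field.
Qed.

Lemma nrm_sum (I : Type) (s : seq I) (f : I -> F) : (forall i, H (f i)) ->
  H (\sum_(i <- s) f i) /\ N (\sum_(i <- s) f i) <= \sum_(i <- s) N (f i).
Proof.
move=> Hf; elim: s => [|i s [IH1 IH2]].
  by rewrite !big_nil (nrm0 si) lexx; split=> //; exact: (si_0 si).
rewrite !big_cons; split; first by auto.
by apply: le_trans (nrmD si _ _) _; auto; rewrite lerD2l.
Qed.

(** Expand the explicit scheme by the binomial formula and compare coefficients with
    those of the exponential. *)
Lemma explicit_series t n u : 0 < t -> H u ->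
  N (\sum_(j < n.+2) ((- t) ^+ j / j`!%:R) *: iter j A u -
     iter n.+1 (fun v => v - (t / n.+1%:R) *: A v) u) <=
  expR (4 * (t * K)) * N u / n.+1%:R.
Proof.
move=> t0 Hu; set h := t / n.+1%:R.
rewrite iter_binomial // -sumrB.
have [_ h1] := nrm_sum (index_enum 'I_n.+2) (f := fun j : 'I_n.+2 =>
  ((- t) ^+ j / j`!%:R) *: iter j A u - ('C(n.+1, j)%:R * (- h) ^+ j) *: iter j A u)
  (fun j => HB (HZ _ (iAH j Hu)) (HZ _ (iAH j Hu))).
apply: le_trans h1 _.
apply: (@le_trans _ _ (\sum_(j < n.+2) (4 * (t * K)) ^+ j / j`!%:R * (N u / n.+1%:R))); last first.
  rewrite -mulr_suml -mulrA ler_wpM2r ?mulr_ge0 ?nrm_ge0 ?invr_ge0 //.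
  by apply: expR_partial_le; rewrite !mulr_ge0 // ltW.
apply: ler_sum => j _; rewrite -scalerBl (nrmZ si); auto.
have jn : (j <= n.+1)%N by rewrite -ltnS.
have /andP[b0 b1] := @binomial_ratio R n.+1 j isT jn.
have e : (- t) ^+ j / j`!%:R - 'C(n.+1, j)%:R * (- h) ^+ j =
    (- t) ^+ j * (j`!%:R^-1 - 'C(n.+1, j)%:R / n.+1%:R ^+ j).
  have -> : - h = - t * n.+1%:R^-1 by rewrite /h mulNr.
  by rewrite exprMn exprVn; ring.
rewrite e normrM (ger0_norm b0) normrX normrN (gtr0_norm t0).
have p1 : `|(- t) ^+ j| <= t ^+ j by rewrite normrX normrN gtr0_norm.
apply: le_trans (ler_pM _ _ _ (iterA_le j Hu)) _.
- by rewrite mulr_ge0 // exprn_ge0 // ltW.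
- exact: nrm_ge0.
- by apply: ler_wpM2l b1; rewrite exprn_ge0 // ltW.
(* The factor [j^2] of the coefficient bound is absorbed into [4^j]. *)
have j4 : j%:R ^+ 2 <= 4 ^+ j :> R.
  have : (j ^ 2 <= 4 ^ j)%N.
    by rewrite (_ : 4 = 2 ^ 2)%N // expnAC leq_exp2r // ltnW // ltn_expl.
  by rewrite -(ler_nat R) !natrX.
have tK : 0 <= t ^+ j * K ^+ j by rewrite mulr_ge0 // exprn_ge0 // ltW.
have c0 : 0 <= t ^+ j * K ^+ j * (N u / n.+1%:R) / j`!%:R.
  by rewrite !mulr_ge0 ?invr_ge0 ?nrm_ge0 ?exprn_ge0 // ltW.
apply: le_trans (_ : j%:R ^+ 2 * (t ^+ j * K ^+ j * (N u / n.+1%:R) / j`!%:R) <= _).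
  by rewrite le_eqVlt; apply/orP; left; apply/eqP; ring.
apply: le_trans (ler_wpM2r c0 j4) _.
by rewrite !exprMn le_eqVlt; apply/orP; left; apply/eqP; ring.
Qed.

(** Explicit and implicit Euler schemes have the same limit, and the binomial
    expansion of the explicit one tends to the exponential series. *)
Lemma expsg_series t u : 0 < t -> H u ->
  ip_cvg ip (fun n => \sum_(j < n) ((- t) ^+ j / j`!%:R) *: iter j A u)
    (expsg H ip L t u).
Proof.
move=> t0 Hu; have HS := expsg_H hil ma t0 Hu.
have Hp n : H (\sum_(j < n) ((- t) ^+ j / j`!%:R) *: iter j A u).
  by have [] := nrm_sum (index_enum 'I_n) (f := fun j : 'I_n =>
     ((- t) ^+ j / j`!%:R) *: iter j A u) (fun j => HZ _ (iAH j Hu)).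
apply/(ip_cvgP si Hp HS); rewrite -(cvg_shiftn 2) /=.
have Hi n : H (iter n.+1 (fun v => v - (t / n.+1%:R) *: A v) u).
  by elim: {1}n.+1 => //= i Hi; auto.
have He n := euler_H ma n t0 Hu.
have c1 := cvg_inv_nat (expR (4 * (t * K)) * N u).
have c2 := cvg_inv_nat (expR (t * K) * t ^+ 2 * N (A (A u))).
have c3 := (ip_cvgP si He HS).1 (expsg_cvg hil ma t0 Hu).
apply: cvg0_le (cvg0D c1 (cvg0D c2 c3)) => n; rewrite nrm_ge0 /= addn2.
apply: le_trans (nrm_tri si (Hp n.+2) (Hi n) HS) _.
apply: lerD; first exact: explicit_series.
apply: le_trans (nrm_tri si (Hi n) (He n) HS) _.
by rewrite lerD2r; exact: explicit_implicit.
Qed.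

End BoundedGenerator.

(** * The matrix exponential of a finite piece *)

Section Neumann.
Context {R : realType} {X : countType} {m : X -> R} (G : graph R X).
Context {A : nat -> {fset X}}.
Hypothesis m_gt0 : forall x, 0 < m x.
Hypothesis exA : exhausts A.
Implicit Types f g u v : X -> R.

Let m_ge0 x : 0 <= m x := ltW (m_gt0 x).
Local Notation H := (ell2 m).
Local Notation N := (@nrm R (X -> R) (inner m)).
Let hil := ell2_hilbert m_gt0 exA.
Let si := hil_si hil.

Lemma restrict0_ell2 B f : H (restrict0 B f).
Proof. by apply: (Cc_ell2 m_ge0 exA); exact: restrict0_Cc. Qed.

Lemma neumannL_lin B a u v :
  neumannL G m B (a *: u + v) = a *: neumannL G m B u + neumannL G m B v.
Proof.
apply/funext => x; rewrite !fctE; change (a *: neumannL G m B u x) with (a * neumannL G m B u x).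
rewrite /neumannL /restrict0; case: ifP => xB; last by rewrite mulr0 addr0.
have -> : \sum_(y <- B) edge G x y * ((a *: u + v) x - (a *: u + v) y) =
  a * (\sum_(y <- B) edge G x y * (u x - u y)) + \sum_(y <- B) edge G x y * (v x - v y).
  rewrite mulr_sumr -big_split /=; apply: eq_bigr => y _.
  change ((a *: u + v) x) with (a * u x + v x).
  change ((a *: u + v) y) with (a * u y + v y); ring.
change (a *: u x) with (a * u x); ring.
Qed.

(** Exchanging the two endpoints in half of the double sum symmetrizes it. *)
Lemma fin_green B u v : fin_inner m B (neumannL G m B u) v = fin_energy G B u v.
Proof.
rewrite /fin_energy.
pose s := \sum_(x <- B) \sum_(y <- B) edge G x y * (u x - u y) * v x.
have -> : fin_inner (edge2 G) (B `*` B)%fset (grad u) (grad v) = 2 * s.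
  have s' : \sum_(x <- B) \sum_(y <- B) edge G x y * (u y - u x) * v y = s.
    rewrite exchange_big /=; apply: eq_bigr => x _; apply: eq_bigr => y _.
    by rewrite edge_sym.
  have -> : 2 * s = s + s by ring.
  rewrite -{2}s' /s /fin_inner big_fsetM -big_split /=; apply: eq_bigr => x _.
  rewrite -big_split /=; apply: eq_bigr => y _.
  rewrite /grad /edge2 /=; ring.
rewrite mulrA mulVf // mul1r /s /fin_inner -big_split /=.
apply: eq_big_seq => x xB; rewrite /neumannL /restrict0 xB.
have mx : m x != 0 by rewrite gt_eqF.
rewrite -mulr_suml; set w := \sum_(y <- B) _.
by field.
Qed.

Lemma piece_opP B u g : H u -> piece_op m G B u g <-> g = neumannL G m B u.
Proof.
move=> Hu.
have HA : H (neumannL G m B u) by exact: restrict0_ell2.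
have gr v : H v -> inner m (neumannL G m B u) v = fin_energy G B u v.
  move=> Hv; rewrite -fin_green (inner_fin m_ge0 exA (B := B)) // => x xB.
  by rewrite /neumannL /restrict0 (negbTE xB) !mul0r.
split=> [[_ Hg gP]|->]; last by split=> // v Hv; rewrite gr.
apply/eqP; rewrite -subr_eq0; apply/eqP.
have Hd : H (g - neumannL G m B u) by exact: (siB si).
apply: (hil_def hil) => //.
by rewrite (ipBl si) // -gP // gr // subrr.
Qed.

(** With [A] the operator of the piece, [N (A u) ^ 2 = E u (A u)] and
    the energy [E] of the piece is bounded by [K] times the squared norm; conclude with the
    Cauchy-Schwarz inequality for [E]. *)
Lemma neumannL_bounded B : exists2 K, 0 <= K &
  forall u, H u -> N (neumannL G m B u) <= K * N u.
Proof.
pose w x := 2 * (\sum_(y <- B) edge G x y) + killing G x.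
have w0 x : 0 <= w x.
  by rewrite addr_ge0 ?killing_ge0 // mulr_ge0 // sumr_ge0 // => y _; exact: edge_ge0.
pose K := \sum_(x <- B) w x / m x.
have K0 : 0 <= K by apply: sumr_ge0 => x _; rewrite divr_ge0.
have qK u : H u -> fin_energy G B u u <= K * inner m u u.
  move=> Hu; apply: le_trans (fin_energy_le G B u) _.
  rewrite /K mulr_suml; apply: ler_sum => x _; rewrite -/(w x).
  rewrite -mulrA ler_wpM2l // ler_pdivlMl // mulrC.
  exact: (ell2_coord m_ge0 exA x Hu).
exists K => // u Hu; have HA : H (neumannL G m B u) by exact: restrict0_ell2.
have n0 := nrm_ge0 (ip := inner m) (neumannL G m B u).
have [->|nn0] := eqVneq (N (neumannL G m B u)) 0.
  by rewrite mulr_ge0 // nrm_ge0.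
have np : 0 < N (neumannL G m B u) by rewrite lt_neqAle eq_sym nn0.
rewrite -(ler_pM2r np) -expr2 (sqr_nrm si) //.
have -> : inner m (neumannL G m B u) (neumannL G m B u) =
    fin_energy G B u (neumannL G m B u).
  rewrite -fin_green (inner_fin m_ge0 exA (B := B)) // => x xB.
  by rewrite /neumannL /restrict0 (negbTE xB) !mul0r.
have sB := fin_energy_si G B.
have c := cauchy_schwarz sB (I : setT u) (I : setT (neumannL G m B u)).
apply: (le_trans (ler_norm _)).
rewrite -ler_sqr ?nnegrE ?mulr_ge0 ?nrm_ge0 ?normr_ge0 // real_normK ?num_real //.
apply: (le_trans c); rewrite !exprMn !(sqr_nrm si) //.
have := ler_pM (si_ge0 sB (I : setT u)) (si_ge0 sB (I : setT (neumannL G m B u))) (qK u Hu) (qK _ HA).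
by rewrite mulrACA -expr2 mulrA.
Qed.

(** All powers in the series vanish outside the piece, so it may be read in ell2, where
    the generator is bounded. *)
Lemma neumannP_expsg B t f : 0 < t -> H f ->
  neumannP G m B t f = expsg H (inner m) (piece_op m G B) t (restrict0 B f).
Proof.
move=> t0 Hf; have [K K0 KP] := neumannL_bounded B.
have Hr := restrict0_ell2 B f.
have ma := piece_op_maccretive G m_gt0 exA B.
have Hit j : H (iter j (neumannL G m B) (restrict0 B f)).
  by case: j => // j; exact: restrict0_ell2.
have c := expsg_series hil ma (piece_opP B) (neumannL_lin B) KP K0 t0 Hr.
apply/funext => x; apply: (cvg_lim (@Rhausdorff R)).
have Hs n : H (\sum_(j < n) ((- t) ^+ j / j`!%:R) *: iter j (neumannL G m B) (restrict0 B f)).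
  apply: big_ind => [|u v|j _]; first exact: (si_0 si).
    exact: (siD si).
  exact: (siZ si).
have := ell2_cvg_coord m_gt0 exA (x := x) Hs (expsg_H hil ma t0 Hr) c.
have -> : (fun n => (\sum_(j < n) ((- t) ^+ j / j`!%:R) *: iter j (neumannL G m B) (restrict0 B f)) x) =
  (fun n => \sum_(j < n) (- t) ^+ j / j`!%:R * iter j (neumannL G m B) (restrict0 B f) x).
  by apply/funext => n; rewrite fct_sumE.
by [].
Qed.

(** Restriction to the pieces converges strongly to the identity, and the semigroups of
    the pieces are contractions. *)
Lemma neumannP_cvg t f : 0 < t -> H f ->
  (forall k, H (neumannP G m (A k) t f)) /\
  ip_cvg (inner m) (fun k => neumannP G m (A k) t f) (expsg H (inner m) (neumann_op m G) t f).
Proof.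
move=> t0 Hf; have Hr k := restrict0_ell2 (A k) f.
have ma k := piece_op_maccretive G m_gt0 exA (A k).
have maN := neumann_op_maccretive G m_gt0 exA.
have HN k : H (neumannP G m (A k) t f) by rewrite neumannP_expsg //; exact: (expsg_H hil (ma k)).
split=> //.
have HK k := expsg_H hil (ma k) t0 Hf; have HS := expsg_H hil maN t0 Hf.
apply/(ip_cvgP si HN HS).
have c1 := (ip_cvgP si HK HS).1 (piece_expsg_cvg G m_gt0 exA t0 Hf).
have c2 := (ip_cvgP si Hr Hf).1 (ell2_trunc m_gt0 exA Hf).
apply: cvg0_le (cvg0D c2 c1) => k; rewrite nrm_ge0 /=.
apply: le_trans (nrm_tri si (HN k) (HK k) HS) _.
rewrite lerD2r neumannP_expsg // -(expsgB hil (ma k)) //.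
by apply: (expsg_le hil (ma k)) => //; exact: (siB si).
Qed.

End Neumann.

(** * Positivity *)

Section Positivity.
Context {R : realType} {X : countType} {m : X -> R} (G : graph R X).
Context {A : nat -> {fset X}}.
Hypothesis m_gt0 : forall x, 0 < m x.
Hypothesis exA : exhausts A.
Implicit Types f g u v z : X -> R.

Let m_ge0 x : 0 <= m x := ltW (m_gt0 x).
Local Notation H := (ell2 m).
Local Notation N := (@nrm R (X -> R) (inner m)).
Let hil := ell2_hilbert m_gt0 exA.
Let si := hil_si hil.
Let fl := energy_form_lim G exA.
Let cfN := domN_closed G m_gt0 exA.
Let cfD := domD_closed G m_gt0 exA.
Local Notation E := (form_plus (inner m) (energy G)).

Definition pos_part z : X -> R := fun x => Num.max (z x) 0.

Lemma pos_part_ge0 z x : 0 <= pos_part z x.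
Proof. by rewrite le_max lexx orbT. Qed.

Lemma pos_part_contract (a b : R) : `|Num.max a 0 - Num.max b 0| <= `|a - b|.
Proof.
rewrite ler_norml; have := ler_norm (a - b); have := ler_norm (b - a); rewrite (distrC b a).
move=> h1 h2; have h3 := normr_ge0 (a - b); move: h1 h2 h3; set c := `|a - b|.
by rewrite /Num.max; case: ltP => a0; case: ltP => b0 *; lra.
Qed.

Lemma domN_contract f g : domN G m f ->
  (forall x y, `|g x - g y| <= `|f x - f y|) -> (forall x, `|g x| <= `|f x|) ->
  domN G m g.
Proof.
move=> [f1 f2] h1 h2; split; first exact: (finite_energy_contract exA f1).
apply: le_lt_trans f2; apply: le_esum => x _; rewrite lee_fin ler_wpM2r //.
by rewrite -(real_normK (num_real (f x))) -(real_normK (num_real (g x))) ler_sqr ?nnegrE.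
Qed.

Lemma domN_pos z : domN G m z -> domN G m (pos_part z).
Proof.
move=> Vz; apply: (domN_contract Vz) => [x y|x]; first exact: pos_part_contract.
by have := pos_part_contract (z x) 0; rewrite maxxx !subr0.
Qed.

Lemma inner_ge0 f g : H f -> H g -> (forall x, 0 <= f x) -> (forall x, 0 <= g x) ->
  0 <= inner m f g.
Proof.
move=> Hf Hg f0 g0; apply: (lim_ger (fl_cvg (ell2_form_lim m_ge0 exA) Hf Hg)) => k.
by apply: sumr_ge0 => x _; rewrite !mulr_ge0.
Qed.

(** The Markov property, checked term by term: [(a^+ - b^+)^2 <= (a - b) (a^+ - b^+)]. *)
Lemma form_pos_part h z : 0 <= h -> domN G m z ->
  E h (pos_part z) (pos_part z) <= E h z (pos_part z).
Proof.
move=> h0 Vz; have Vp := domN_pos Vz.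
have p2 (a b : R) : (Num.max a 0 - Num.max b 0) * (Num.max a 0 - Num.max b 0) <=
    (a - b) * (Num.max a 0 - Num.max b 0).
  by rewrite /Num.max; case: ltP => a0; case: ltP => b0; nra.
have p1 (a : R) : Num.max a 0 * Num.max a 0 <= a * Num.max a 0.
  by have := p2 a 0; rewrite maxxx !subr0.
apply: lerD.
  apply: (ler_lim_seq (fl_cvg (ell2_form_lim m_ge0 exA) Vp.2 Vp.2)
    (fl_cvg (ell2_form_lim m_ge0 exA) Vz.2 Vp.2)) => k.
  by apply: ler_sum => x _; rewrite ler_wpM2r // p1.
rewrite ler_wpM2l //.
apply: (ler_lim_seq (fl_cvg fl Vp.1 Vp.1) (fl_cvg fl Vz.1 Vp.1)) => k.
apply: lerD.
  rewrite ler_wpM2l ?invr_ge0 //; apply: ler_sum => -[x y] _.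
  by rewrite ler_wpM2r ?edge_ge0 // p2.
by apply: ler_sum => x _; rewrite ler_wpM2r ?killing_ge0 // p1.
Qed.

Lemma form_plus_ge_inner h u : 0 <= h -> domN G m u -> inner m u u <= E h u u.
Proof. by move=> h0 Vu; rewrite lerDl mulr_ge0 // (si_ge0 (cf_si cfN)). Qed.

Lemma min_principle h z : 0 <= h -> domN G m z -> E h z (pos_part z) <= 0 ->
  forall x, z x <= 0.
Proof.
move=> h0 Vz Ez x; have Vp := domN_pos Vz.
have p0 : pos_part z = 0.
  apply: (hil_def hil); first exact: Vp.2.
  apply/eqP; rewrite eq_le (si_ge0 si Vp.2) andbT.
  apply: le_trans Ez; apply: le_trans (form_pos_part h0 Vz).
  exact: form_plus_ge_inner.
have : pos_part z x = 0 by rewrite p0.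
by rewrite /pos_part => /eqP; rewrite eq_maxr.
Qed.

Local Notation JN := (resolvent (neumann_op m G)).
Local Notation JD := (resolvent (opD G m)).
Let JNP h f := @form_resolventP _ _ _ _ hil _ _ cfN (domN_dense G m_gt0 exA) h f.
Let JDP h f := @form_resolventP _ _ _ _ hil _ _ cfD (domD_dense G m_gt0 exA) h f.

Lemma resolventN_ge0 h f : 0 < h -> H f -> (forall x, 0 <= f x) ->
  forall x, 0 <= JN h f x.
Proof.
move=> h0 Hf f0 x; have [Vu uP] := JNP h0 Hf.
have sE := form_plus_si hil cfN (ltW h0).
have Vz : domN G m (- JN h f) by exact: (siN sE).
have Vp := domN_pos Vz.
rewrite -oppr_le0; apply: (min_principle (ltW h0) Vz).
rewrite (ipNl sE) // uP // oppr_le0; apply: inner_ge0 => //; first exact: Vp.2.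
exact: pos_part_ge0.
Qed.

(** Testing with the positive part of [u - v] would require it to lie in [domD].
    Instead, take [phi] finitely supported and close to [u]: since [v >= 0], the
    positive part of [phi - v] is finitely supported, and testing with it shows that
    its form norm is at most that of [u - phi]. *)
Lemma domD_comparison h u v : 0 < h -> domD G m u -> domN G m v ->
  (forall x, 0 <= v x) ->
  (forall psi, Cc psi -> (forall x, 0 <= psi x) -> E h (u - v) psi <= 0) ->
  forall x, u x <= v x.
Proof.
move=> h0 Du Vv v0 uv x.
have sE := form_plus_si hil cfN (ltW h0).
have s1 := form_plus_si hil cfN (@ler01 R).
have Vu := domD_domN Du.
apply/ler_addgt0Pr => e e0.
(* The factors convert [form_norm], which is the case [h = 1], to the norm of
   [E h], and that norm to the value at [x]. *)
pose d := e / 2 * Num.sqrt (m x) / (1 + h).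
have sm : 0 < Num.sqrt (m x) by rewrite sqrtr_gt0.
have h1 : 0 < 1 + h by rewrite addr_gt0.
have d0 : 0 < d by rewrite /d !divr_gt0 // mulr_gt0 // divr_gt0.
have [phi Cp up] := Du.2 d d0; have Vphi := Cc_domN G m_gt0 exA Cp.
rewrite (form_normE m_gt0 exA) in up; last exact: (siB s1).
have Eup : nrm (ip := E h) (u - phi) <= (1 + h) * d.
  have Vup := siB s1 Vu Vphi.
  have hd : 0 <= (1 + h) * d := mulr_ge0 (ltW h1) (ltW d0).
  rewrite -ler_sqr ?nnegrE ?nrm_ge0 ?hd // exprMn.
  have : nrm (ip := E 1) (u - phi) ^+ 2 <= d ^+ 2.
    by rewrite ler_sqr ?nnegrE ?nrm_ge0 ?(ltW d0) // ltW.
  rewrite (sqr_nrm s1) // (sqr_nrm sE) // /form_plus.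
  have := si_ge0 si Vup.2; have := si_ge0 (cf_si cfN) Vup.
  set a := energy G _ _; set b := inner m _ _; move=> a0 b0 ab.
  apply: (@le_trans _ _ ((1 + h) * (b + 1 * a))).
    have := mulr_ge0 (ltW h0) b0; lra.
  apply: (@le_trans _ _ ((1 + h) * d ^+ 2)); first by rewrite ler_wpM2l // ltW.
  rewrite ler_wpM2r ?sqr_ge0 // expr2 ler_peMr ?(ltW h1) //; lra.
pose z := phi - v; pose p := pos_part z.
have Vz : domN G m z by exact: (siB sE).
have Vp : domN G m p by exact: domN_pos.
have Cpp : Cc p.
  apply: sub_finite_set Cp => y /=; apply: contraNN => /eqP py.
  rewrite /p /pos_part /z; change ((phi - v) y) with (phi y - v y).
  by rewrite py sub0r max_r // oppr_le0.
have Ep : nrm (ip := E h) p <= nrm (ip := E h) (u - phi).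
  have e1 := form_pos_part (ltW h0) Vz.
  have e2 := uv p Cpp (pos_part_ge0 z).
  have e3 : E h z p = E h (u - v) p - E h (u - phi) p.
    rewrite -(ipBl sE) //; try exact: (siB sE).
    by congr (E h _ p); rewrite opprB addrC addrA subrK.
  have e4 := ip_le sE (siB sE Vu Vphi) Vp.
  have e5 := ler_norm (- E h (u - phi) p); rewrite normrN in e5.
  have [->|n0] := eqVneq (nrm (ip := E h) p) 0; first exact: nrm_ge0.
  have np : 0 < nrm (ip := E h) p by rewrite lt_neqAle eq_sym n0 nrm_ge0.
  rewrite -(ler_pM2r np) -expr2 (sqr_nrm sE) //.
  by rewrite -/p e3 in e1; lra.
have coord w : domN G m w -> `|w x| * Num.sqrt (m x) <= nrm (ip := E h) w.
  move=> Vw; rewrite -ler_sqr ?nnegrE ?mulr_ge0 ?nrm_ge0 ?sqrtr_ge0 //.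
  rewrite (sqr_nrm sE) // exprMn real_normK ?num_real // sqr_sqrtr //.
  apply: le_trans (ell2_coord m_ge0 exA x Vw.2) _.
  exact: (form_plus_ge_inner (ltW h0)).
have c1 := coord _ (siB sE Vu Vphi); have c2 := coord _ Vp.
have dE : (1 + h) * d = e / 2 * Num.sqrt (m x).
  by rewrite /d mulrC divfK // gt_eqF.
have k1 : `|u x - phi x| <= e / 2.
  by rewrite -(ler_pM2r sm) -dE; apply: le_trans Eup.
have k2 : `|p x| <= e / 2.
  by rewrite -(ler_pM2r sm) -dE; apply: le_trans c2 (le_trans Ep Eup).
have k3 : phi x - v x <= p x by rewrite /p /pos_part le_max lexx.
have := ler_norm (u x - phi x); have := ler_norm (p x).
lra.
Qed.

Lemma resolventD_ge0 h f : 0 < h -> H f -> (forall x, 0 <= f x) ->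
  forall x, 0 <= JD h f x.
Proof.
move=> h0 Hf f0 x; have [Vu uP] := JDP h0 Hf.
have sD := form_plus_si hil cfD (ltW h0).
have sE := form_plus_si hil cfN (ltW h0).
rewrite -oppr_le0; apply: (domD_comparison h0 (u := - JD h f) (v := 0)) => //.
- exact: (siN sD).
- exact: (si_0 sE).
- move=> psi Cp p0; rewrite subr0.
  have Dp := Cc_domD G m_gt0 exA Cp.
  rewrite (ipNl sD) // uP // oppr_le0; apply: inner_ge0 => //.
  exact: (domD_domN Dp).2.
Qed.

Lemma resolventD_le h f : 0 < h -> H f -> (forall x, 0 <= f x) ->
  forall x, JD h f x <= JN h f x.
Proof.
move=> h0 Hf f0; have [Vu uP] := JDP h0 Hf; have [Vv vP] := JNP h0 Hf.
have sE := form_plus_si hil cfN (ltW h0).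
apply: (domD_comparison h0) => //; first exact: resolventN_ge0.
move=> psi Cp p0; have Dp := Cc_domD G m_gt0 exA Cp; have Vp := Cc_domN G m_gt0 exA Cp.
by rewrite (ipBl sE) ?uP ?vP ?subrr //; exact: domD_domN.
Qed.

(** Test the equation [u + h L u = f] with the indicator of [x]; the neighbours other
    than [y] contribute nonnegative terms to the right hand side. *)
Lemma resolventD_vertex h f x y : 0 < h -> H f -> (forall w, 0 <= f w) ->
  f x + h * (edge G x y / m x) * JD h f y <=
  (1 + h * ((degree G x + killing G x) / m x)) * JD h f x.
Proof.
move=> h0 Hf f0; have [Du uP] := JDP h0 Hf; set u := JD h f in Du uP *.
have u0 : forall w, 0 <= u w by exact: resolventD_ge0.
pose dl : X -> R := fun w => (w == x)%:R.
have Cd : Cc dl := Cc_delta x.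
have Hd := Cc_ell2 m_ge0 exA Cd; have Dd := Cc_domD G m_gt0 exA Cd.
have Vu := domD_domN Du; have Vd := domD_domN Dd.
have sumd (B : {fset X}) (F : X -> R) : x \in B -> \sum_(w <- B) F w * dl w * m w = F x * m x.
  move=> xB; rewrite (big_fsetD1 x) //= /dl eqxx mulr1 big1_fset ?addr0 // => w.
  by rewrite !inE => /andP[/negbTE -> _]; rewrite mulr0 mul0r.
have innerd v : H v -> inner m v dl = v x * m x.
  move=> Hv; rewrite (inner_fin m_ge0 exA (B := [fset x]%fset)) //.
    by rewrite /fin_inner sumd // inE.
  by move=> w; rewrite inE /dl => /negbTE ->; rewrite mulr0 mul0r.
have en : energy G u dl <= (degree G x + killing G x) * u x - edge G x y * u y.
  have [k Bk] := exhausts_fset exA [fset x; y]%fset.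
  have c := cvg_comp _ _ (@cvg_addnr k) (fl_cvg fl Vu.1 Vd.1).
  apply: (lim_ler c) => l /=.
  have Bl := fsubset_trans Bk (exhausts_mono exA (leq_addl l k)).
  have xB : x \in A (l + k)%N by apply: (fsubsetP Bl); rewrite !inE eqxx.
  have yB : y \in A (l + k)%N by apply: (fsubsetP Bl); rewrite !inE eqxx orbT.
  rewrite -(fin_green G m_gt0) /fin_inner sumd // /neumannL /restrict0 xB.
  have mx : m x != 0 by rewrite gt_eqF.
  rewrite mulrDl mulrAC mulVf // mul1r [_ / m x * u x * m x]mulrAC divfK //.
  rewrite [leRHS](_ : _ = (degree G x * u x - edge G x y * u y) + killing G x * u x); last by ring.
  rewrite lerD2r.
  under eq_bigr do rewrite mulrBr.
  rewrite sumrB -mulr_suml; apply: lerB.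
    by rewrite ler_wpM2r // degree_le.
  rewrite (big_fsetD1 y) //= lerDl sumr_ge0 // => w _.
  by rewrite mulr_ge0 // edge_ge0.
have := uP _ Dd; rewrite /form_plus !innerd //; last exact: Vu.2.
move=> e; have q := ler_wpM2l (ltW h0) en.
rewrite -(ler_pM2r (m_gt0 x)).
have mx : m x != 0 by rewrite gt_eqF.
have -> : (f x + h * (edge G x y / m x) * u y) * m x = f x * m x + h * (edge G x y * u y).
  by field.
have -> : (1 + h * ((degree G x + killing G x) / m x)) * u x * m x =
    u x * m x + h * ((degree G x + killing G x) * u x) by field.
rewrite -e; lra.
Qed.

Lemma euler_ge0 (L : (X -> R) -> (X -> R) -> Prop) h n f :
  maccretive H (inner m) L ->
  (forall g, H g -> (forall x, 0 <= g x) -> forall x, 0 <= resolvent L h g x) ->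
  0 < h -> H f -> (forall x, 0 <= f x) ->
  forall x, 0 <= iter n (resolvent L h) f x.
Proof.
move=> ma pos h0 Hf f0; elim: n => //= n IH.
by apply: pos => //; exact: (iter_resolvent_H ma).
Qed.

End Positivity.

(** * Domination and strict positivity of the semigroups *)

Section Comparison.
Context {R : realType} {X : countType} {m : X -> R} (G : graph R X).
Context {A : nat -> {fset X}}.
Hypothesis m_gt0 : forall x, 0 < m x.
Hypothesis exA : exhausts A.
Implicit Types f g u v : X -> R.

Let m_ge0 x : 0 <= m x := ltW (m_gt0 x).
Local Notation H := (ell2 m).
Local Notation N := (@nrm R (X -> R) (inner m)).
Let hil := ell2_hilbert m_gt0 exA.
Let si := hil_si hil.
Let maN := neumann_op_maccretive G m_gt0 exA.
Let maD := opD_maccretive G m_gt0 exA.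
Let cfN := domN_closed G m_gt0 exA.
Let cfD := domD_closed G m_gt0 exA.
Local Notation JN := (resolvent (neumann_op m G)).
Local Notation JD := (resolvent (opD G m)).
Local Notation SN := (expsg H (inner m) (neumann_op m G)).
Local Notation SD := (expsg H (inner m) (opD G m)).

Let step_gt0 (t : R) n : 0 < t -> 0 < t / n.+1%:R.
Proof. by move=> t0; rewrite divr_gt0 // ltr0n. Qed.

Lemma expsg_coord (L : (X -> R) -> (X -> R) -> Prop) t f x :
  maccretive H (inner m) L -> 0 < t -> H f ->
  (fun n => euler L t n f x) @ \oo --> expsg H (inner m) L t f x.
Proof.
move=> ma t0 Hf.
apply: (ell2_cvg_coord m_gt0 exA (fun n => euler_H ma n t0 Hf) (expsg_H hil ma t0 Hf)).
exact: (expsg_cvg hil ma).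
Qed.

Lemma expsgD_ge0 t f : 0 < t -> H f -> (forall x, 0 <= f x) -> forall x, 0 <= SD t f x.
Proof.
move=> t0 Hf f0 x; apply: (lim_ger (expsg_coord (x := x) maD t0 Hf)) => n.
apply: (euler_ge0 _ maD) => // [g Hg g0|]; last exact: step_gt0.
by apply: (resolventD_ge0 G m_gt0 exA) => //; exact: step_gt0.
Qed.

Lemma iter_resolventD_le h n f : 0 < h -> H f -> (forall x, 0 <= f x) ->
  forall x, iter n (JD h) f x <= iter n (JN h) f x.
Proof.
move=> h0 Hf f0; elim: n => // n IH x; rewrite !iterS.
have HD := iter_resolvent_H maD n h0 Hf; have HN := iter_resolvent_H maN n h0 Hf.
have D0 : forall y, 0 <= iter n (JD h) f y.
  by apply: (euler_ge0 _ maD) => // g Hg g0; exact: (resolventD_ge0 G m_gt0 exA).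
apply: le_trans (resolventD_le G m_gt0 exA h0 HD D0 x) _.
have H0 : forall y, 0 <= (iter n (JN h) f - iter n (JD h) f) y.
  by move=> y; rewrite subr_ge0; exact: IH.
have e := resolventB hil maN h0 HN HD.
by have := resolventN_ge0 G m_gt0 exA h0 (siB si HN HD) H0 x; rewrite e subr_ge0.
Qed.

Lemma expsgD_le t f : 0 < t -> H f -> (forall x, 0 <= f x) ->
  forall x, SD t f x <= SN t f x.
Proof.
move=> t0 Hf f0 x.
apply: (ler_lim_seq (expsg_coord (x := x) maD t0 Hf) (expsg_coord (x := x) maN t0 Hf)) => n.
by apply: iter_resolventD_le => //; exact: step_gt0.
Qed.

(** At each of the [n] steps, mass stays at [z] up to the factor [(1 + h d)^-1]; at one
    of them it may jump from [z] to [y], which the factor [n] counts. *)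
Lemma iter_resolventD_lower h n f z y d : 0 < h -> H f -> (forall x, 0 <= f x) ->
  (degree G z + killing G z) / m z <= d -> (degree G y + killing G y) / m y <= d ->
  (1 + h * d)^-1 ^+ n * f z <= iter n (JD h) f z /\
  n%:R * h * (edge G y z / m y) * (1 + h * d)^-1 ^+ n.+1 * f z <= iter n (JD h) f y.
Proof.
move=> h0 Hf f0 dz dy.
have d0 : 0 <= d.
  by apply: le_trans dz; rewrite divr_ge0 // addr_ge0 ?degree_ge0 ?killing_ge0.
pose c := 1 + h * d; rewrite -/c.
have c0 : 0 < c by rewrite /c ltr_wpDr // mulr_ge0 // ltW.
have Hi k := iter_resolvent_H maD k h0 Hf.
have pos k : forall x, 0 <= iter k (JD h) f x.
  by apply: (euler_ge0 _ maD) => // g Hg g0; exact: (resolventD_ge0 G m_gt0 exA).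
have b0 x w : 0 <= edge G x w / m x by rewrite divr_ge0 // edge_ge0.
have step k x w : (degree G x + killing G x) / m x <= d ->
    iter k (JD h) f x + h * (edge G x w / m x) * iter k.+1 (JD h) f w <=
    c * iter k.+1 (JD h) f x.
  move=> dx; apply: le_trans (resolventD_vertex G m_gt0 exA x w h0 (Hi k) (pos k)) _.
  by rewrite ler_wpM2r ?(pos k.+1) // lerD2l ler_wpM2l // ltW.
elim: n => [|n [IH1 IH2]].
  by rewrite expr0 mul1r !mul0r.
have z1 : c^-1 ^+ n.+1 * f z <= iter n.+1 (JD h) f z.
  rewrite exprS -mulrA ler_pdivrMl //.
  apply: le_trans (step n z z dz); apply: le_trans IH1 _.
  by rewrite lerDl mulr_ge0 ?(pos n.+1) // mulr_ge0 // ltW.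
split=> //.
rewrite [X in X * f z <= _](_ : _ = c^-1 * (n%:R * h * (edge G y z / m y) * c^-1 ^+ n.+1 +
   h * (edge G y z / m y) * c^-1 ^+ n.+1)); last by rewrite -natr1 [c^-1 ^+ n.+2]exprS; ring.
rewrite -[leLHS]mulrA ler_pdivrMl //; apply: le_trans (step n y z dy).
rewrite mulrDl; apply: lerD => //.
by rewrite -[leLHS]mulrA ler_wpM2l // mulr_ge0 // ltW.
Qed.

(** From [1 + x <= e^x]. The bound [n.+2] on the exponent, instead of [n.+1], allows
    for the additional factor of a jump. *)
Lemma invr_expn_ge (c : R) n k : 0 <= c -> (k <= n.+2)%N ->
  expR (- (2 * c)) <= (1 + c / n.+1%:R)^-1 ^+ k.
Proof.
move=> c0 kn; have cn : 0 <= c / n.+1%:R by rewrite divr_ge0.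
have c1 : 0 < 1 + c / n.+1%:R by rewrite ltr_wpDr.
have e1 : (expR (c / n.+1%:R))^-1 <= (1 + c / n.+1%:R)^-1.
  by rewrite lef_pV2 ?posrE ?expR_gt0 ?expR_ge1Dx.
have e2 : (expR (c / n.+1%:R))^-1 ^+ k <= (1 + c / n.+1%:R)^-1 ^+ k.
  by rewrite lerXn2r // nnegrE invr_ge0 ?expR_ge0 // ltW.
apply: le_trans e2; rewrite -expRN -expRM_natl ler_expR mulrN lerN2.
have kk : k%:R <= 2 * n.+1%:R :> R.
  by rewrite -natrM ler_nat; lia.
apply: le_trans (ler_wpM2r cn kk) _.
by rewrite -mulrA [n.+1%:R * _]mulrC divfK // pnatr_eq0.
Qed.

Lemma expsgD_gt0_self t f z : 0 < t -> H f -> (forall x, 0 <= f x) -> 0 < f z ->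
  0 < SD t f z.
Proof.
move=> t0 Hf f0 fz; pose d := (degree G z + killing G z) / m z.
have d0 : 0 <= d by rewrite divr_ge0 // addr_ge0 ?degree_ge0 ?killing_ge0.
apply: lt_le_trans (_ : expR (- (2 * (t * d))) * f z <= _).
  by rewrite mulr_gt0 // expR_gt0.
apply: (lim_ger (expsg_coord (x := z) maD t0 Hf)) => n.
have [h _] := iter_resolventD_lower n.+1 (step_gt0 n t0) Hf f0 (lexx d) (lexx d).
apply: le_trans h; rewrite ler_pM2r // mulrAC.
by apply: invr_expn_ge; [rewrite mulr_ge0 // ltW|].
Qed.

Lemma expsgD_gt0_edge t f z y : 0 < t -> H f -> (forall x, 0 <= f x) -> 0 < f z ->
  0 < edge G z y -> 0 < SD t f y.
Proof.
move=> t0 Hf f0 fz ezy; rewrite edge_sym in ezy.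
pose d x := (degree G x + killing G x) / m x.
have d0 x : 0 <= d x by rewrite divr_ge0 // addr_ge0 ?degree_ge0 ?killing_ge0.
have dz : d z <= d z + d y by rewrite lerDl.
have dy : d y <= d z + d y by rewrite lerDr.
pose c := t * (d z + d y).
have c0 : 0 <= c by rewrite mulr_ge0 ?addr_ge0 // ltW.
apply: lt_le_trans (_ : t * (edge G y z / m y) * expR (- (2 * c)) * f z <= _).
  by rewrite !mulr_gt0 ?expR_gt0 ?invr_gt0.
apply: (lim_ger (expsg_coord (x := y) maD t0 Hf)) => n.
have [_ h] := iter_resolventD_lower n.+1 (step_gt0 n t0) Hf f0 dz dy.
apply: le_trans h; rewrite ler_pM2r // [n.+1%:R * _]mulrC divfK ?pnatr_eq0 //.
rewrite ler_wpM2l ?mulr_ge0 ?(ltW t0) ?invr_ge0 ?(ltW ezy) // [t / _ * _]mulrAC.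
exact: invr_expn_ge.
Qed.

(** Mass moves along a path, one edge in each half of the remaining time. *)
Lemma expsgD_gt0 t f z y : connected_graph G ->
  0 < t -> H f -> (forall x, 0 <= f x) -> 0 < f z -> 0 < SD t f y.
Proof.
move=> /(_ z y I I)[p [pp py _]].
elim: p z t f pp py => [|w p IH] z t f /= pp py t0 Hf f0 fz.
  by rewrite -py; exact: expsgD_gt0_self.
case/andP: pp => zw pp.
have t2 : 0 < t / 2 by rewrite divr_gt0.
rewrite (_ : t = t / 2 + t / 2); last by field.
rewrite (expsg_double hil maD) //.
apply: (IH w) => //.
- exact: (expsg_H hil maD).
- exact: expsgD_ge0.
- exact: expsgD_gt0_edge zw.
Qed.

(** * Equality of the two semigroups *)

Section Domination.
Variables S T : (X -> R) -> X -> R.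
Hypothesis S_lin : linear_on (H := H) S.
Hypothesis T_lin : linear_on (H := H) T.
Hypothesis S_H : forall f, H f -> H (S f).
Hypothesis T_H : forall f, H f -> H (T f).
Hypothesis S_le : forall f, H f -> N (S f) <= N f.
Hypothesis T_le : forall f, H f -> N (T f) <= N f.
Hypothesis S_gt0 : forall f z y, H f -> (forall x, 0 <= f x) -> 0 < f z -> 0 < S f y.
Hypothesis ST : forall f, H f -> (forall x, 0 <= f x) -> forall x, S f x <= T f x.

(** A finitely supported function lies between two multiples of [psi], on which the
    positive operator [T - S] vanishes. *)
Lemma domination_Cc psi f : H psi -> (forall x, 0 < psi x) ->
  T psi =1 S psi -> Cc f -> T f =1 S f.
Proof.
move=> Hp p0 eqp Cf.
have Hf := Cc_ell2 m_ge0 exA Cf.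
have [C CP] : exists C, forall x, `|f x| <= C * psi x.
  pose B := fset_set [set x | f x != 0].
  exists (\sum_(x <- B) `|f x| / psi x) => x.
  have [fx|fx] := eqVneq (f x) 0.
    rewrite fx normr0 mulr_ge0 ?(ltW (p0 x)) // sumr_ge0 // => y _.
    by rewrite divr_ge0 // ltW.
  have xB : x \in B by rewrite /B in_fset_set // mem_set.
  rewrite -ler_pdivrMr // (big_fsetD1 x) //= lerDl sumr_ge0 // => y _.
  by rewrite divr_ge0 // ltW.
have key g : H g -> (forall x, g x <= C * psi x) -> forall x, T g x <= S g x.
  move=> Hg gC x.
  have HCp : H (C *: psi) by exact: (siZ si).
  have HC : H (C *: psi - g) by exact: (siB si).
  have C0 y : 0 <= (C *: psi - g) y.
    by change (0 <= C * psi y - g y); rewrite subr_ge0.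
  have h := ST HC C0 x.
  rewrite (linear_onB T_lin HCp Hg) (linear_onB S_lin HCp Hg) in h.
  rewrite (linear_onZ hil C T_lin Hp) (linear_onZ hil C S_lin Hp) in h.
  have h' : C * S psi x - S g x <= C * T psi x - T g x := h.
  by move: h'; rewrite eqp lerD2l lerN2.
move=> x; apply/eqP; rewrite eq_le; apply/andP; split.
  by apply: key => // y; apply: le_trans (CP y); exact: ler_norm.
have HN : H (-1 *: f) by exact: (siZ si).
have NfC y : (-1 *: f) y <= C * psi y.
  by apply: le_trans (CP y); rewrite scaleN1r -normrN; exact: ler_norm.
have := key _ HN NfC x.
rewrite (linear_onZ hil (-1) T_lin Hf) (linear_onZ hil (-1) S_lin Hf) !scaleN1r.
by move=> h; rewrite -lerN2.
Qed.

(** In [T (T phi) >= T (S phi) >= S (S phi)] both inequalities are equalities. By the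
    first one, [T] kills [T phi - S phi >= 0], which is therefore zero since [T]
    dominates [S] and [S] improves positivity. By the second one, [T] and [S] agree on
    the strictly positive function [S phi]. *)
Lemma domination_square phi : H phi -> (forall x, 0 <= phi x) -> phi <> cst 0 ->
  T (T phi) =1 S (S phi) -> forall f, H f -> T f =1 S f.
Proof.
move=> Hphi phi0 phin0 e2.
have [x0 phix0] : exists x, 0 < phi x.
  apply: contrapT => h; apply: phin0; apply/funext => x; apply/eqP.
  rewrite eq_le phi0 andbT leNgt; apply/negP => px; apply: h; by exists x.
have HT := T_H Hphi; have HS := S_H Hphi.
have psi0 x : 0 < S phi x by exact: S_gt0 phix0.
have leST x : S phi x <= T phi x by exact: ST.
pose g := T phi - S phi.
have Hg : H g by exact: (siB si).
have g0 x : 0 <= g x by change (0 <= T phi x - S phi x); rewrite subr_ge0.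
have Tg x : T g x <= 0.
  rewrite (linear_onB T_lin HT HS).
  change (T (T phi) x - T (S phi) x <= 0).
  by rewrite e2 subr_le0; apply: (ST HS) => y; exact: ltW.
have gz x : g x = 0.
  apply/eqP; rewrite eq_le g0 andbT leNgt; apply/negP => gx.
  have := S_gt0 x Hg g0 gx; rewrite ltNge => /negP; apply.
  exact: le_trans (ST Hg g0 x) (Tg x).
have eqphi : T phi = S phi.
  by apply/funext => y; apply/eqP; rewrite -subr_eq0; apply/eqP; exact: gz.
have {}e2 x : T (S phi) x = S (S phi) x by rewrite -e2 eqphi.
move=> f Hf; suff h : T f - S f = 0.
  by move=> x; apply/eqP; rewrite -subr_eq0; apply/eqP; exact: (congr1 (fun v => v x) h).
have HTf := T_H Hf; have HSf := S_H Hf.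
apply: (nrm0_eq hil); first exact: (siB si).
apply/ler_addgt0Pr => e e0; rewrite add0r.
have e3 : 0 < e / 2 by rewrite divr_gt0.
have [u Cu fu] := Cc_dense m_gt0 exA Hf e3.
have Hu := Cc_ell2 m_ge0 exA Cu.
have eqTu : T u = S u by apply/funext; exact: (domination_Cc HS psi0 e2 Cu).
have HTu := T_H Hu.
have t1 := nrm_tri si HTf HTu HSf.
have t2 := T_le (siB si Hf Hu); rewrite (linear_onB T_lin Hf Hu) in t2.
have t3 := S_le (siB si Hu Hf); rewrite (linear_onB S_lin Hu Hf) in t3.
rewrite (nrmBC si Hu Hf) -eqTu in t3.
apply: le_trans t1 _; apply: le_trans (lerD t2 t3) _.
by move: fu; set a := nrm _ => fu; lra.
Qed.

End Domination.

(** * From equal semigroups to equal form domains *)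

Lemma expsg_half r phi : connected_graph G -> 0 < r -> H phi ->
  (forall x, 0 <= phi x) -> phi <> cst 0 ->
  SN (r + r) phi =1 SD (r + r) phi -> forall f, H f -> SN r f =1 SD r f.
Proof.
move=> conn r0 Hphi phi0 phin0 e2.
apply: (domination_square (S := SD r) (T := SN r) _ _ _ _ _ _ _ _ Hphi phi0 phin0).
- by move=> a f g Hf Hg; exact: (expsg_lin hil maD).
- by move=> a f g Hf Hg; exact: (expsg_lin hil maN).
- by move=> f Hf; exact: (expsg_H hil maD).
- by move=> f Hf; exact: (expsg_H hil maN).
- by move=> f Hf; exact: (expsg_le hil maD).
- by move=> f Hf; exact: (expsg_le hil maN).
- by move=> f z y Hf f0 fz; exact: expsgD_gt0 fz.
- by move=> f Hf f0 x; exact: expsgD_le.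
- move=> x; have := e2 x.
  by rewrite (expsg_double hil maN r0 Hphi) (expsg_double hil maD r0 Hphi).
Qed.

(** Equality on the whole space at time [r / 2] contains equality on [phi], so the
    halving can be repeated. *)
Lemma expsg_dyadic r phi : connected_graph G -> 0 < r -> H phi ->
  (forall x, 0 <= phi x) -> phi <> cst 0 -> SN r phi =1 SD r phi ->
  forall n f, H f -> SN (r / 2 ^+ n.+1) f =1 SD (r / 2 ^+ n.+1) f.
Proof.
move=> conn r0 Hphi phi0 phin0 e n.
have half (s : R) : s / 2 + s / 2 = s by field.
elim: n => [|n IH].
  rewrite expr1; apply: (expsg_half conn _ Hphi phi0 phin0); first by rewrite divr_gt0.
  by rewrite half.
have s0 : 0 < r / 2 ^+ n.+1 by rewrite divr_gt0 // exprn_gt0.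
have -> : r / 2 ^+ n.+2 = r / 2 ^+ n.+1 / 2 by rewrite exprSr invfM mulrA.
apply: (expsg_half conn _ Hphi phi0 phin0); first by rewrite divr_gt0.
by rewrite half; exact: IH.
Qed.

(** Let [f] be the vector in question and [k] its image under the Neumann operator. For
    [v] in the domain of the Dirichlet operator, symmetry of the Dirichlet semigroup
    at the times [s n] gives, in the limit, [ip k v = ip f (L v)] with [L] the
    Dirichlet operator. As [L] is self-adjoint, [f] lies in its domain, concretely
    [f = (1 + L)^-1 (f + k)]. *)
Lemma neumann_resolvent_domD (s : nat -> R) : (forall n, 0 < s n) -> s @ \oo --> (0 : R) ->
  (forall n f, H f -> SN (s n) f =1 SD (s n) f) ->
  forall a g, 0 < a -> H g -> domD G m (JN a (JN a g)).
Proof.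
move=> s0 sc eqs a g a0 Hg.
have [k [l [Lk Ll _]]] := resolvent2_dom hil maN a0 Hg.
set f := JN a (JN a g) in Lk *.
have [Hf Hk] := ma_dom maN Lk; have [_ Hl] := ma_dom maN Ll.
have Dsym h u v : 0 < h -> H u -> H v -> inner m (JD h u) v = inner m u (JD h v).
  by move=> h0 Hu Hv; exact: (form_resolvent_sym hil cfD (domD_dense G m_gt0 exA)).
have adj v w w' : opD G m v w -> opD G m w w' -> inner m k v = inner m f w.
  move=> Lv Lw; have [Hv Hw] := ma_dom maD Lv; have [_ Hw'] := ma_dom maD Lw.
  apply/eqP; rewrite -subr_eq0 -normr_eq0; apply/eqP.
  pose C := 3 * N l * N v + 3 * N w' * N f.
  have C0 : 0 <= C by rewrite addr_ge0 // !mulr_ge0 // nrm_ge0.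
  have bnd n : `|inner m k v - inner m f w| <= C * s n.
    have HNf := expsg_H hil maN (s0 n) Hf; have HDv := expsg_H hil maD (s0 n) Hv.
    have r1 := expsg_gen_rate hil maN (s0 n) Lk Ll.
    have r2 := expsg_gen_rate hil maD (s0 n) Lv Lw.
    set p := (s n)^-1 *: (SN (s n) f - f) + k in r1.
    set q := (s n)^-1 *: (SD (s n) v - v) + w in r2.
    have Hp1 : H ((s n)^-1 *: (SN (s n) f - f)) by apply: (siZ si); exact: (siB si).
    have Hq1 : H ((s n)^-1 *: (SD (s n) v - v)) by apply: (siZ si); exact: (siB si).
    have Hp : H p by exact: (siD si).
    have Hq : H q by exact: (siD si).
    have e : inner m k v - inner m f w = inner m p v - inner m f q.
      rewrite /p /q (ipDl si) // (ipDr si) // (ipZl si) ?(ipZr si) //; try exact: (siB si).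
      rewrite (ipBl si) // (ipBr si) // (funext (eqs n f Hf)).
      rewrite (expsg_sym hil maD Dsym (s0 n) Hf Hv); ring.
    have c1 := ip_le si Hp Hv; have c2 := ip_le si Hf Hq.
    rewrite e; apply: le_trans (ler_normB _ _) _.
    apply: le_trans (lerD c1 c2) _.
    have d1 := ler_wpM2r (nrm_ge0 (ip := inner m) v) r1.
    have d2 := ler_wpM2l (nrm_ge0 (ip := inner m) f) r2.
    apply: le_trans (lerD d1 d2) _.
    rewrite le_eqVlt; apply/orP; left; apply/eqP; rewrite /C; ring.
  apply/eqP; rewrite eq_le normr_ge0 andbT.
  have c := cvg0Z C sc.
  exact: (lim_ger c bnd).
have Hfk : H (f + k) by exact: (siD si).
have h1 : 0 < 1 :> R by [].
pose u := JD 1 (f + k).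
have Hu : H u by exact: (resolvent_H maD).
have [Vu _] := form_resolventP hil cfD (domD_dense G m_gt0 exA) h1 Hfk.
suff -> : f = u by [].
apply/eqP; rewrite -subr_eq0; apply/eqP.
have Hfu : H (f - u) by exact: (siB si).
apply: (form_resolvent_inj hil cfD (domD_dense G m_gt0 exA) h1 Hfu).
have orth g' : H g' -> inner m (JD 1 (f - u)) g' = 0.
  move=> Hg'; rewrite Dsym //.
  pose y := JD 1 g'; pose v := JD 1 y.
  have Hy : H y by exact: (resolvent_H maD).
  have Hv : H v by exact: (resolvent_H maD).
  have Ly := resolventP maD h1 Hg'; have Lv := resolventP maD h1 Hy.
  rewrite -/y invr1 scale1r in Ly; rewrite -/v invr1 scale1r in Lv.
  have Lw := maB maD Ly (L_resolvent hil maD h1 Ly).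
  have ad := adj v (y - v) (g' - y - JD 1 (g' - y)) Lv Lw.
  have e1 : inner m u y = inner m (f + k) v := Dsym 1 (f + k) y h1 Hfk Hy.
  have e2 := ipBl si Hf Hu Hy.
  have e3 := ipDl si Hf Hk Hv.
  have e4 := ipBr si Hy Hv Hf.
  have sum0 (a1 a2 a3 a4 a5 a6 a7 : R) : a7 = a1 - a2 -> a2 = a3 -> a3 = a4 + a5 ->
      a5 = a6 -> a6 = a1 - a4 -> a7 = 0 by move=> -> -> -> -> ->; ring.
  exact: (sum0 _ _ _ _ _ _ _ e2 e1 e3 ad e4).
apply: (hil_def hil); first exact: (resolvent_H maD).
by apply: orth; exact: (resolvent_H maD).
Qed.

(** Project [f] in [domN] onto [domD] for the form inner product. The difference [w]
    is orthogonal to the vectors [J (J g)], that is, [J w] is orthogonal to all [g];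
    so [J w = 0], and [w = 0] because the resolvent [J] is injective. *)
Lemma domD_eq_domN a : 0 < a -> (forall g, H g -> domD G m (JN a (JN a g))) ->
  domD G m = domN G m.
Proof.
move=> a0 sub; apply/seteqP; split=> [f|f Vf]; first exact: domD_domN.
have sE := form_plus_si hil cfN (ltW a0); have sD := form_plus_si hil cfD (ltW a0).
have [] := riesz sD (f := form_plus (inner m) (energy G) a f)
  (C := form_plus (inner m) (energy G) a f f) (form_plus_complete hil cfD a0).
- move=> c u v /domD_domN Vu /domD_domN Vv.
  by rewrite (ipDr sE) ?(ipZr sE) //; exact: (siZ sE).
- by move=> u /domD_domN Vu; exact: (cauchy_schwarz sE).
move=> u Du uP; have Vu := domD_domN Du.
suff -> : f = u by [].
apply/eqP; rewrite -subr_eq0; apply/eqP; set w := f - u.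
have Vw : domN G m w by exact: (siB sE).
have Hw : H w := Vw.2.
apply: (form_resolvent_inj hil cfN (domN_dense G m_gt0 exA) a0 Hw).
have Nsym h y z : 0 < h -> H y -> H z -> inner m (JN h y) z = inner m y (JN h z).
  by move=> h0 Hy Hz; exact: (form_resolvent_sym hil cfN (domN_dense G m_gt0 exA)).
have HJw := resolvent_H maN a0 Hw.
apply: (hil_def hil) => //.
have HJJw := resolvent_H maN a0 HJw.
have [VJ JP] := form_resolventP hil cfN (domN_dense G m_gt0 exA) a0 HJJw.
have DJ := sub _ HJw.
have orth : form_plus (inner m) (energy G) a (JN a (JN a (JN a w))) w = 0.
  have VDJ := domD_domN DJ.
  by rewrite (si_sym sE) // /w (ipBl sE) // -(uP _ DJ) subrr.
exact: (etrans (esym (Nsym _ _ _ a0 HJw Hw)) (etrans (esym (JP w Vw)) orth)).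
Qed.

End Comparison.

(** * The equivalences *)

Section Conclusion.
Context {R : realType} {X : countType} {m : X -> R} (G : graph R X).
Context {A : nat -> {fset X}}.
Hypothesis m_gt0 : forall x, 0 < m x.
Hypothesis exA : exhausts A.
Local Notation H := (ell2 m).
Local Notation SN := (expsg H (inner m) (neumann_op m G)).
Local Notation SD := (expsg H (inner m) (opD G m)).
Let m_ge0 x : 0 <= m x := ltW (m_gt0 x).
Let hil := ell2_hilbert m_gt0 exA.
Let si := hil_si hil.

Lemma expsg_eq_of_domD_eq t f : domD G m = domN G m -> SN t f = SD t f.
Proof. by move=> e; rewrite /neumann_op -e. Qed.

Lemma expsg_eq_domD_eq_domN t phi : connected_graph G -> 0 < t -> H phi ->
  (forall x, 0 <= phi x) -> phi <> cst 0 -> SN t phi =1 SD t phi ->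
  domD G m = domN G m.
Proof.
move=> conn t0 Hphi phi0 phin0 e.
pose s n := t / 2 ^+ n.+1.
have s0 n : 0 < s n by rewrite divr_gt0 // exprn_gt0.
have sc : s @ \oo --> (0 : R).
  apply: cvg0Z; rewrite (_ : (fun n => _) = (fun n => 2^-1 * 2^-1 ^+ n)).
    by apply: cvg0Z; apply: cvg_expr; rewrite ger0_norm ?invr_ge0 // invf_lt1 // ltr1n.
  by apply/funext => n; rewrite exprS invfM exprVn.
have es := expsg_dyadic m_gt0 exA conn t0 Hphi phi0 phin0 e.
apply: (domD_eq_domN m_gt0 exA ltr01) => g Hg.
exact: (neumann_resolvent_domD m_gt0 exA s0 sc es ltr01 Hg).
Qed.

Lemma strong_pointwise (u : nat -> X -> R) v : (forall k, H (u k)) -> H v ->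
  (fun k => l2norm m (u k - v)) @ \oo --> (0 : R) -> pointwise_cvg u v.
Proof.
move=> Hu Hv h x; apply: (ell2_cvg_coord m_gt0 exA Hu Hv).
exact/(ip_cvgP si Hu Hv).
Qed.

End Conclusion.

Theorem corollary3p3 (R : realType) (X : countType) (m : X -> R)
    (G : graph R X) (X_ : nat -> {fset X}) (PD : R -> (X -> R) -> (X -> R))
    (t : R)
    (X_nonempty : inhabited X)
    (m_gt0 : forall x, 0 < m x)
    (G_connected : connected_graph G)
    (X_exhaustion : exhaustion G X_)
    (PD_semigroup : is_exp_semigroup m (opD G m) PD)
    (t_gt0 : 0 < t) :
  [/\ domD G m = domN G m <->
        strong_cvg m (fun k => neumannP G m (X_ k) t) (PD t),
      (* Without 0 <= phi, an antisymmetric eigenfunction supported on two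
         twin leaves could satisfy this although domD differs from domN. *)
      domD G m = domN G m <->
        (exists phi : X -> R, [/\ Cc phi, forall x, 0 <= phi x, phi <> cst 0
           & pointwise_cvg (fun k => neumannP G m (X_ k) t phi) (PD t phi)])
    & domD G m = domN G m <->
        (forall phi : X -> R, Cc phi -> phi <> cst 0 ->
           pointwise_cvg (fun k => neumannP G m (X_ k) t phi) (PD t phi))].
Proof.
have exA : exhausts X_ by have [h1 h2 _] := X_exhaustion; split.
have hil := ell2_hilbert m_gt0 exA; have si := hil_si hil.
have maN := neumann_op_maccretive G m_gt0 exA; have maD := opD_maccretive G m_gt0 exA.
have CcH phi : Cc phi -> ell2 m phi.
  by apply: (Cc_ell2 _ exA) => x; exact: ltW.
have PDE f : ell2 m f -> expsg (ell2 m) (inner m) (opD G m) t f = PD t f.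
  by move=> Hf; exact: (sg_expsg hil maD PD_semigroup t_gt0 Hf).
have HPD f : ell2 m f -> ell2 m (PD t f).
  by move=> Hf; rewrite -PDE //; exact: (expsg_H hil maD).
have i_ii : domD G m = domN G m ->
    strong_cvg m (fun k => neumannP G m (X_ k) t) (PD t).
  move=> e f Hf; have [HN cN] := neumannP_cvg G m_gt0 exA t_gt0 Hf.
  rewrite (expsg_eq_of_domD_eq t f e) PDE // in cN.
  exact: ((ip_cvgP si HN (HPD f Hf)).1 cN).
have ii_iii : strong_cvg m (fun k => neumannP G m (X_ k) t) (PD t) ->
    forall phi, Cc phi ->
    pointwise_cvg (fun k => neumannP G m (X_ k) t phi) (PD t phi).
  move=> sc phi Cphi; have Hphi := CcH _ Cphi.
  have [HN _] := neumannP_cvg G m_gt0 exA t_gt0 Hphi.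
  exact: (strong_pointwise m_gt0 exA HN (HPD _ Hphi) (sc _ Hphi)).
have iii_i phi : Cc phi -> (forall x, 0 <= phi x) -> phi <> cst 0 ->
    pointwise_cvg (fun k => neumannP G m (X_ k) t phi) (PD t phi) ->
    domD G m = domN G m.
  move=> Cphi phi0 phin0 pc; have Hphi := CcH _ Cphi.
  apply: (expsg_eq_domD_eq_domN m_gt0 exA G_connected t_gt0 Hphi phi0 phin0) => x.
  rewrite PDE //.
  have [HN cN] := neumannP_cvg G m_gt0 exA t_gt0 Hphi.
  have HS := expsg_H hil maN t_gt0 Hphi.
  have c := ell2_cvg_coord m_gt0 exA (x := x) HN HS cN.
  exact: (cvg_unique _ c (pc x)).
have [x0] := X_nonempty.
pose delta : X -> R := fun y => (y == x0)%:R.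
have Cd : Cc delta := Cc_delta x0.
have d0 x : 0 <= delta x by rewrite ler0n.
have dn0 : delta <> cst 0.
  move=> /(congr1 (fun f => f x0)); rewrite /delta eqxx /= => /eqP.
  by rewrite oner_eq0.
split; split.
- exact: i_ii.
- by move=> /ii_iii h; apply: (iii_i delta) => //; exact: h.
- by move=> /i_ii /ii_iii h; exists delta; split=> //; exact: h.
- by move=> [phi [Cphi phi0 phin0 pc]]; exact: (iii_i phi).
- by move=> /i_ii /ii_iii h phi Cphi _; exact: h.
- by move=> h; apply: (iii_i delta) => //; exact: h.
Qed.
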